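(* Let either $Y=\mathbb{Z}$ and $L=1$, or $Y=\mathbb{Z}\times\{0,\ldots,L-1\}$ for some integer $L\ge 2$. Let $\mathbb{P}$ be a probability measure on the space $\Omega$ of environments such that the family $(\omega(x,\cdot,\cdot))_{x\in Y}$ is i.i.d. under $\mathbb{P}$. (1) If $\mathbb{E}[\delta^0]>1/L$, then for $\mathbb{P}$-almost every $\omega$ the excited random walk is transient in direction $e_1$, i.e. $P_{0,\omega}$-a.s. $X_n\cdot e_1\to\infty$ as $n\to\infty$. (2) If $\mathbb{E}[\delta^0]\le 1/L$, then for $\mathbb{P}$-almost every $\omega$ the excited random walk is recurrent, i.e. it returns $P_{0,\omega}$-a.s. infinitely often to its starting point $0$, and moreover $P_{0,\omega}$-a.s. $\limsup_{n\to\infty}X_n\cdot e_1=\infty$ and $\liminf_{n\to\infty}X_n\cdot e_1=-\infty$.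
   Context: Put $d=1$ if $Y=\mathbb{Z}$ and $d=2$ if $Y$ is a strip $\mathbb{Z}\times\{0,\ldots,L-1\}$. In the strip case, for $x\in Y$ and $e\in\mathbb{Z}^2$, $x+e$ is understood modulo $L$ in the second coordinate. Let $\ell=e_1$ be the first standard unit vector ($x\cdot e_1$ is the first coordinate of $x$), and fix $\kappa\in(0,1/(2d)]$. The space of environments is the set $\Omega$ of all $\omega=(\omega(x,e,i))_{x\in Y,\ e\in\mathbb{Z}^d,\ |e|=1,\ i\in\mathbb{N},\ i\ge1}$ with $\omega(x,e,i)\in[\kappa,1-\kappa]$ such that for all $x\in Y$ and $i\ge 1$: $\sum_{|e|=1}\omega(x,e,i)=1$ and $\sum_{|e|=1}\omega(x,e,i)\,e\cdot\ell\ge 0$. $\Omega$ carries the product topology and its Borel $\sigma$-algebra. Here $\omega(x,\cdot,\cdot)=(\omega(x,e,i))_{|e|=1,i\ge1}$; no independence is assumed between different $i$ or different $e$ at the same site $x$. An excited random walk (ERW) starting at $x\in Y$ in the environment $\omega\in\Omega$ is a $Y$-valued process $(X_n)_{n\ge0}$ on a probability space with measure $P_{x,\omega}$ such that $P_{x,\omega}[X_0=x]=1$ and, with $H_n=(X_m)_{0\le m\le n}$, $P_{x,\omega}$-a.s. for all $n\ge 0$ and all $|e|=1$, $$P_{x,\omega}[X_{n+1}=X_n+e\mid H_n]=\omega(X_n,e,\#\{m\le n\mid X_m=X_n\}).$$ (For the strip with $L=2$, where $e_2$ and $-e_2$ lead to the same site, the probability of jumping to that site is the sum of the two corresponding values.)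 $\mathbb{E}$ is expectation with respect to $\mathbb{P}$, and $\delta^x(\omega):=\sum_{i\ge1}\sum_{|e|=1}\omega(x,e,i)\,e\cdot\ell\in[0,\infty]$. *)

(* Defs.v *)
From HB Require Import structures.
From mathcomp Require Import all_boot all_order all_algebra finmap.
From mathcomp Require Import all_classical all_reals all_analysis.

Set Implicit Arguments.
Unset Strict Implicit.
Unset Printing Implicit Defensive.

Import Order.TTheory GRing.Theory Num.Theory.
Import numFieldNormedType.Exports.

Local Open Scope classical_set_scope.
Local Open Scope ring_scope.

Definition borel {U : topologicalType} : set (set U) := <<s @open U >>.

Definition is_iid d (T : measurableType d) (R : realType) (P : probability T R)
    (I : choiceType) (U : topologicalType) (xi : I -> T -> U) : Prop :=
  [/\ forall i B, borel B -> measurable (xi i @^-1` B),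
      forall i j B, borel B -> P (xi i @^-1` B) = P (xi j @^-1` B)
    & forall (J : {fset I}) (B : I -> set U),
        (forall i, borel (B i)) ->
        P (\bigcap_(i in [set` J]) (xi i @^-1` B i)) =
        (\prod_(i <- J) P (xi i @^-1` B i))%E].

(* [f] is a version of P[A | G], for a sub-sigma-algebra [G]. *)
Definition is_cond_prob d (T : measurableType d) (R : realType)
    (P : probability T R) (G : set (set T)) (A : set T) (f : T -> R) : Prop :=
  (forall B : set R, measurable B -> G (f @^-1` B)) /\
  (forall C, G C -> (\int[P]_(t in C) (f t)%:E = P (C `&` A))%E).

(* [Line] is Z; [Strip L] is Z x {0, ..., L - 1}. *)
Variant state_space := Line | Strip (L : nat) of (1 < L)%N.

Definition width (Y : state_space) : nat :=
  match Y with Line => 1 | Strip L _ => L end.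

(* The dimension d, as a syntactic successor so that [ord0 : 'I_(site_dim Y)]. *)
Definition site_dim (Y : state_space) : nat :=
  (match Y with Line => 0 | Strip _ _ => 1 end).+1.

(* Since 1 < L, 'Z_L is {0, ..., L - 1} with addition modulo L. *)
Definition site (Y : state_space) : zmodType :=
  match Y with Line => int | Strip L _ => (int * 'Z_L)%type end.

(* x . e_1 *)
Definition height (Y : state_space) : site Y -> int :=
  match Y return site Y -> int with
  | Line => fun x => x
  | Strip _ _ => fun x => x.1
  end.

(* x + e is [x + displ e]. *)
Definition displ (Y : state_space) : 'rV[int]_(site_dim Y) -> site Y :=
  match Y return 'rV[int]_(site_dim Y) -> site Y with
  | Line => fun e => e ord0 ord0
  | Strip L _ => fun e => (e ord0 ord0, (e ord0 ord_max)%:~R : 'Z_L)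
  end.

(* The 2d vectors e in Z^d with |e| = 1 are encoded by (j, s), standing for
   (-1)^s e_{j+1}; see [unit_vecP]. *)
Definition dir (Y : state_space) : finType := ('I_(site_dim Y) * bool)%type.

Definition unit_vec (Y : state_space) (a : dir Y) : 'rV[int]_(site_dim Y) :=
  (-1) ^+ a.2 *: delta_mx ord0 a.1.

Lemma unit_vec_inj (Y : state_space) : injective (@unit_vec Y).
Proof.
move=> [j s] [k t] /rowP E.
have := E j; have := E k; rewrite !mxE !eqxx /= !mulr1.
case: (eqVneq k j) => [->|_] /=; rewrite ?mulr1 ?mulr0.
  by move=> _; case: s {E}; case: t.
by case: t {E}.
Qed.

Lemma unit_vecP (Y : state_space) (e : 'rV[int]_(site_dim Y)) :
  reflect (exists a : dir Y, e = unit_vec a) (\sum_j e ord0 j ^+ 2 == 1).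
Proof.
apply: (iffP eqP) => [e1|[[k s] ->]].
  have [k ek] : exists k, e ord0 k != 0.
    apply/existsP; apply: contraT => /existsPn e0; move: e1.
    by rewrite big1// => j _; move/(_ j): e0; rewrite negbK => /eqP->; rewrite expr0n.
  have ge0 j : 0 <= e ord0 j ^+ 2 by exact: sqr_ge0.
  move: e1; rewrite (bigD1 k)//= => e1.
  have s0 : 0 <= \sum_(i < site_dim Y | i != k) e ord0 i ^+ 2 by exact: sumr_ge0.
  have k1 : 1 <= e ord0 k ^+ 2 by rewrite -gtz0_ge1 exprn_even_gt0.
  have k1' : e ord0 k ^+ 2 = 1.
    by apply/eqP; rewrite eq_le k1 andbT -e1 lerDl.
  have {}s0 : \sum_(i < site_dim Y | i != k) e ord0 i ^+ 2 = 0.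
    by apply: (@addrI _ 1); rewrite addr0 -[in LHS]k1' e1.
  have ej j : j != k -> e ord0 j = 0.
    move=> jk; move/eqP: s0; rewrite psumr_eq0// => /allP /(_ j).
    by rewrite mem_index_enum jk /= sqrf_eq0 => /(_ isT)/eqP.
  exists (k, e ord0 k == -1); apply/rowP => j; rewrite !mxE eqxx /=.
  case: (eqVneq j k) => [->|jk] /=; last by rewrite mulr0 ej.
  by rewrite mulr1; move/eqP: k1'; rewrite sqrf_eq1 => /orP[] /eqP ->.
rewrite (bigD1 k)//= big1 => [|j jk].
  by rewrite !mxE !eqxx mulr1 addr0 sqrr_sign.
by rewrite !mxE (negbTE jk) andbF mulr0 expr0n.
Qed.

(* e . l with l = e_1 *)
Definition dot_ell (Y : state_space) (a : dir Y) : int :=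
  unit_vec a ord0 ord0.

(* The index i >= 1 is stored as i.-1, so that nat indexes {i | 1 <= i}. *)
Notation cookies Y R := {ptws (dir Y * nat)%type -> R}.
Notation raw_env Y R := {ptws (site Y * dir Y * nat)%type -> R}.

(* omega(x, e, i), for 1 <= i only *)
Definition coef (Y : state_space) (R : realType) (w : raw_env Y R)
  (x : site Y) (a : dir Y) (i : nat) : R := w (x, a, i.-1).

Definition environments (Y : state_space) (R : realType) (kappa : R) :
    set (raw_env Y R) :=
  [set w | forall x i, (1 <= i)%N ->
    [/\ forall a, kappa <= coef w x a i <= 1 - kappa,
        \sum_a coef w x a i = 1
      & 0 <= \sum_a coef w x a i * (dot_ell a)%:~R]].

Arguments environments Y {R} kappa.

Lemma environments_neq0 (Y : state_space) (R : realType) (kappa : R) :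
  0 < kappa <= (2 * site_dim Y)%:R^-1 -> exists w, w \in environments Y kappa.
Proof.
move=> /andP[k0 k1]; exists (fun=> (2 * site_dim Y)%:R^-1); apply/mem_set => x i _.
have d0 : (0 : R) < (2 * site_dim Y)%:R by rewrite ltr0n muln_gt0.
have half : ((2 * site_dim Y)%:R^-1 : R) <= 2^-1.
  by rewrite lef_pV2 ?posrE// ler_nat leq_pmulr.
rewrite /coef; split.
- move=> _; rewrite k1 /= lerBrDr (le_trans (lerD half (le_trans k1 half)))//.
  by rewrite [leRHS]splitr div1r.
- rewrite sumr_const card_prod card_ord card_bool mulnC -[LHS]mulr_natr mulVf//.
  by rewrite gt_eqF.
- rewrite -mulr_sumr mulr_ge0 ?invr_ge0 ?(ltW d0)//.
  rewrite -(pair_bigA _ (fun j s => (dot_ell ((j, s) : dir Y))%:~R : R)) /=.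
  rewrite sumr_ge0// => j _; rewrite big_bool /= /dot_ell /unit_vec /= !mxE.
  by rewrite expr0 expr1 mul1r mulN1r -intrD addNr.
Qed.

(* The space Omega; set_type carries the subspace topology, and [raw_env Y R]
   the product topology. *)
Definition env (Y : state_space) (R : realType) (kappa : R)
    (hk : 0 < kappa <= (2 * site_dim Y)%:R^-1) : Type :=
  set_type (environments Y kappa).

Section env_instances.
Variables (Y : state_space) (R : realType) (kappa : R).
Variable hk : 0 < kappa <= (2 * site_dim Y)%:R^-1.

HB.instance Definition _ :=
  Topological.copy (env hk) (set_type (environments Y kappa)).

(* Measurable types of the library are pointed. *)
HB.instance Definition _ :=
  isPointed.Build (env hk)
    (let: exist w hw := cid (environments_neq0 hk) in exist _ w hw).

End env_instances.

(* Omega with its Borel sigma-algebra *)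
Notation borel_env hk := (g_sigma_algebraType (@open (env hk))).

Section walk.
Variables (Y : state_space) (R : realType) (kappa : R).
Variable hk : 0 < kappa <= (2 * site_dim Y)%:R^-1.

(* omega(x, e, i), for i >= 1 *)
Definition omega (w : borel_env hk) : site Y -> dir Y -> nat -> R :=
  coef (set_val (w : env hk)).

(* omega(x, ., .) *)
Definition omega_at (x : site Y) (w : borel_env hk) : cookies Y R :=
  fun p => omega w x p.1 p.2.+1.

Definition delta (x : site Y) (w : borel_env hk) : \bar R :=
  (\sum_(1 <= i <oo)
     (\sum_(a : dir Y) omega w x a i * (dot_ell a)%:~R)%:E)%E.

(* #{m <= n | X_m = X_n} *)
Definition visits (X : nat -> site Y) (n : nat) : nat :=
  #|[set m : 'I_n.+1 | X m == X n]%SET|.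

(* sigma(X_0, ..., X_n); as Y is countable, every set of histories is an
   admissible event. *)
Definition history d (T : measurableType d) (X : nat -> T -> site Y) (n : nat) :
    set (set T) :=
  preimage_set_system setT (fun t (m : 'I_n.+1) => X m t) setT.

(* The sum over b merges the directions leading to the same site; it has more
   than one term only when L = 2, for e_2 and -e_2. *)
Definition is_ERW d (T : measurableType d) (P : probability T R)
    (X : nat -> T -> site Y) (x : site Y) (w : borel_env hk) : Prop :=
  [/\ forall n (B : set (site Y)), measurable (X n @^-1` B),
      P (X 0 @^-1` [set x]) = 1%E
    & forall n (a : dir Y),
        is_cond_prob P (history X n)
          [set t | X n.+1 t = X n t + displ (unit_vec a)]
          (fun t => \sum_(b | displ (unit_vec b) == displ (unit_vec a))
             omega w (X n t) b (visits (X ^~ t) n))].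

(* P_{x,w}-a.s., [E] holds for the trajectory of the excited random walk; the
   law of the walk is determined by x and w. *)
Definition ERW_as (x : site Y) (w : borel_env hk) (E : set (nat -> site Y)) : Prop :=
  forall d (T : measurableType d) (P : probability T R)
    (X : nat -> T -> site Y),
    is_ERW P X x w -> {ae P, forall t, E (X ^~ t)}.

Definition transient (w : borel_env hk) : Prop :=
  ERW_as 0 w
    [set X | ((height (X n))%:~R : R) @[n --> \oo] --> +oo%R].

Definition recurrent (w : borel_env hk) : Prop :=
  ERW_as 0 w [set X | infinite_set [set n | X n = 0]].

Definition oscillating (w : borel_env hk) : Prop :=
  ERW_as 0 w
    [set X | limn_esup (fun n => (height (X n))%:~R%:E : \bar R) = +oo%E /\
             limn_einf (fun n => (height (X n))%:~R%:E : \bar R) = -oo%E].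

End walk.

(* Main.v *)
Require Import Defs.
From HB Require Import structures.
From mathcomp Require Import all_boot all_order all_algebra finmap.
From mathcomp Require Import all_classical all_reals all_analysis measurable_realfun.
From mathcomp Require Import zify ring lra.

(* Let p be the probability, averaged over the environment, that the walk never
   goes below its starting level. The drift consumed up to a stopping time is
   the expected displacement. Up to the exit from the levels 0, ..., k - 1 this
   compares k p with the drift consumed at these levels, each of which offers
   L E[delta] in mean. If p > 0, a walk that has just entered a new level leaves
   it for ever with positive probability, so a definite part of the drift there
   is never used; hence p = 0 when L E[delta] <= 1. If p = 0, the walk crosses a
   level arbitrarily often before it gets far above, so that by ellipticity it
   uses up any given number of cookies at each site there; hence p > 0 when
   L E[delta] > 1.

   If p > 0, the walk has at each of the levels k, k + m, ..., k + (r - 1) m,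
   for m large, a nearly independent chance p of staying above k for ever; so
   almost surely it does not fall below k from arbitrarily high. If p = 0, level
   0 is crossed infinitely often, and ellipticity forces infinitely many visits
   to 0 and visits to every level below.

   All these estimates concern finitely many steps, where probabilities are
   polynomials in the cookies. Disjoint sets of levels are then independent,
   and almost sure statements are obtained from bounds uniform in the number of
   steps. *)

Set Implicit Arguments.
Unset Strict Implicit.
Unset Printing Implicit Defensive.

Import Order.TTheory GRing.Theory Num.Theory.
Import numFieldNormedType.Exports.

Local Open Scope classical_set_scope.
Local Open Scope ring_scope.

(** * Sites, histories and finite-horizon values *)

(** The critical case L E[delta] = 1 leaves no slack, so the waste at a level must be bounded below
    by a constant times p. Ellipticity provides it: the first cookie met at a level has drift at
    most 1 - 2 kappa, and with mean probability at least kappa p the walk leaves the level for ever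
    right after that cookie. The quantities involved depend on the levels below, on the level itself
    and on the levels above, so independence between sites is enough.

    When p = 0, the obstacle is that the walk may meet its own past below a level. Seen from above,
    an excursion below the level matters only through the site where it returns. It can be traded
    for a short forced path at a bounded price, and a walk with few excursions is thus compared with
    a fresh one.

    Never going below a level is not decided in finite time: p is a supremum over the number of
    steps, followed by an infimum over the target level. Events of the actual walk are only bounded
    from above by the polynomials, which suffices because every almost sure statement excludes a bad
    event. *)

Section geometry.
Variable Y : state_space.
Implicit Types (x y : site Y) (a : dir Y).

Definition shiftv a : site Y := displ (unit_vec a).

Lemma heightD x y : height (x + y) = height x + height y.
Proof. by case: Y x y. Qed.

Lemma height0 : height (0 : site Y) = 0.
Proof. by case: Y. Qed.

Lemma heightN x : height (- x) = - height x.
Proof. by apply/eqP; rewrite -addr_eq0 -heightD addNr height0. Qed.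

Lemma height_shiftv a : height (shiftv a) = dot_ell a.
Proof. by rewrite /shiftv /dot_ell; move: a; case: Y. Qed.

Lemma dot_ell_bound a : -1 <= dot_ell a <= 1.
Proof.
rewrite /dot_ell /unit_vec !mxE eqxx /=.
by case: a => j [] /=; case: (ord0 == j); rewrite ?expr1 ?expr0.
Qed.

Definition right_dir : dir Y := (ord0, false).
Definition left_dir : dir Y := (ord0, true).

Lemma dot_ell_right : dot_ell right_dir = 1.
Proof. by rewrite /dot_ell /unit_vec !mxE !eqxx. Qed.

Lemma dot_ell_left : dot_ell left_dir = -1.
Proof. by rewrite /dot_ell /unit_vec !mxE !eqxx. Qed.

End geometry.

Definition level (Y : state_space) : int -> seq (site Y) :=
  match Y return int -> seq (site Y) with
  | Line => fun j => [:: j]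
  | Strip L _ => fun j => [seq (j, y) | y <- enum 'Z_L]
  end.

Lemma mem_level (Y : state_space) j (x : site Y) :
  (x \in level Y j) = (height x == j).
Proof.
case: Y x => [x|L hL [i y]] /=; first by rewrite inE.
apply/mapP/eqP => [[z _ [-> _]]//|->].
by exists y => //; rewrite mem_enum.
Qed.

Lemma level_uniq (Y : state_space) j : uniq (level Y j).
Proof.
case: Y => [//|L hL] /=.
by rewrite map_inj_uniq ?enum_uniq// => ? ? [].
Qed.

Lemma size_level (Y : state_space) j : size (level Y j) = width Y.
Proof.
by case: Y => [//|L hL] /=; rewrite size_map -cardE card_ord Zp_cast.
Qed.

Lemma width_gt0 (Y : state_space) : (0 < width Y)%N.
Proof. by case: Y => [//|L hL] /=; apply: ltnW. Qed.

(** On the line a level is a single site and the path is empty, so any direction can serve as [v];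
    this is why [dot_ell v = 0] is asserted for [0 < r] only. *)
Lemma vertical_path (Y : state_space) : exists v : dir Y,
  forall x y : site Y, height x = height y ->
  exists r, [/\ (r <= width Y)%N, y = x + shiftv v *+ r
    & (0 < r)%N -> dot_ell v = 0].
Proof.
case: Y => [|L hL].
  by exists (right_dir Line) => x y /= ->; exists 0%N; rewrite mulr0n addr0.
pose v : dir (Strip hL) := (ord_max, false).
exists v => -[i1 y1] [i2 y2] /= <-.
have dv : dot_ell v = 0 by rewrite /dot_ell /unit_vec !mxE /= mulr0.
exists (y2 - y1 : 'Z_L); split => //.
  by rewrite (leq_trans (ltnW (ltn_ord _)))// Zp_cast.
have vM n : shiftv v *+ n = (0, n%:R) :> (int * 'Z_L)%type.
  elim: n => [//|n IH]; rewrite mulrS IH [n.+1%:R]mulrS /shiftv /=.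
  rewrite -[X in (X, _)]/(dot_ell v) dv.
  by rewrite /unit_vec !mxE !eqxx expr0 mulr1; congr pair; rewrite addr0.
rewrite vM natr_Zp; congr pair; first by rewrite addr0.
by rewrite addrC subrK.
Qed.

Lemma site_embedding (Y : state_space) :
  exists f : site Y -> nat, injective f.
Proof.
case: Y => [|L hL] /=.
  by exists (fun x : int => choice.pickle x); apply: pcan_inj choice.pickleK.
exists (fun x => choice.pickle (choice.pickle x.1, choice.pickle x.2)) => -[i1 y1] [i2 y2] /=.
by move=> /(pcan_inj choice.pickleK) [/(pcan_inj choice.pickleK) -> /(pcan_inj choice.pickleK) ->].
Qed.

Section histories.
Variable Y : state_space.
Implicit Types (h : seq (site Y)) (a : dir Y).

Definition pos h : site Y := head 0 h.
Definition ht h : int := height (pos h).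
(** Only earlier visits count: this is the zero-based index of the cookie that governs the next
    step. *)
Definition prior h : nat := count_mem (pos h) (behead h).
Definition extend h a : seq (site Y) := (pos h + shiftv a) :: h.

Lemma ht_extend h a : ht (extend h a) = ht h + dot_ell a.
Proof. by rewrite /ht /= heightD height_shiftv. Qed.

Lemma ht_extend_ge h a : ht h - 1 <= ht (extend h a).
Proof. by rewrite ht_extend lerD2l; case/andP: (dot_ell_bound a). Qed.

Lemma ht_extend_le h a : ht (extend h a) <= ht h + 1.
Proof. by rewrite ht_extend lerD2l; case/andP: (dot_ell_bound a). Qed.

End histories.

Arguments ht {Y} h : simpl never.

Section value_def.
Variables (R : realType) (Y : state_space) (c : site Y -> dir Y -> nat -> R).
Implicit Types (h : seq (site Y)) (a : dir Y) (n m : nat).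
Implicit Types (S : seq (site Y) -> bool) (f g : seq (site Y) -> R).

(* Expected payoff [f] for a walk with past [h] (most recent site first) that is
   stopped by [S], or else after [n] steps. *)
Fixpoint value S f n h : R :=
  if n is n'.+1 then
    if S h then f h
    else \sum_a c (pos h) a (prior h) * value S f n' (extend h a)
  else f h.

Definition drift x i : R := \sum_a c x a i * (dot_ell a)%:~R.

Fixpoint drift_sum (Q : pred (site Y)) (h : seq (site Y)) : R :=
  if h is x :: h' then drift_sum Q h' + (Q x)%:R * drift x (count_mem x h')
  else 0.

(** The current site is dropped because its cookie is used only by the next step. *)
Definition consumed Q h := drift_sum Q (behead h).

Lemma consumed_extend Q h a : h != [::] ->
  consumed Q (extend h a) =
  consumed Q h + (Q (pos h))%:R * drift (pos h) (prior h).
Proof. by case: h. Qed.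

Lemma drift_sum_level j h :
  drift_sum (fun x => height x == j) h =
  \sum_(x <- level Y j) \sum_(0 <= i < count_mem x h) drift x i.
Proof.
elim: h => [|y h IH] /=; first by rewrite big1// => x _; rewrite big_geq.
have [yj|yj] := eqVneq (height y) j; last first.
  rewrite mul0r addr0 IH; apply: eq_big_seq => x; rewrite mem_level => /eqP xj.
  by have -> : (y == x) = false by apply: contraNF yj => /eqP->; rewrite xj.
have yl : y \in level Y j by rewrite mem_level yj.
rewrite mul1r IH (bigD1_seq y)//= ?level_uniq// [RHS](bigD1_seq y)//= ?level_uniq//.
rewrite eqxx add1n big_nat_recr//= addrAC; do 2?congr (_ + _).
by apply: eq_bigr => x /negbTE; rewrite eq_sym => ->.
Qed.

Lemma drift_sum_levels k h :
  \sum_(0 <= j < k) drift_sum (fun x => height x == j%:Z) h =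
  drift_sum (fun x => 0 <= height x < k%:Z) h.
Proof.
elim: h => [|x h IH] /=; first by rewrite big1.
rewrite big_split /= IH -mulr_suml; congr (_ + _ * _).
rewrite -natr_sum; congr _%:R.
case: (leP 0 (height x)) => hx /=; last first.
  by rewrite big1// => j _; case: eqP => // xj; lia.
case: (height x) hx => // n _; elim: k {IH} => [|k IHk]; first by rewrite big_geq.
rewrite big_nat_recr//= IHk !ltz_nat ltnS eqz_nat [(n <= k)%N]leq_eqVlt.
by case: ltngtP.
Qed.

End value_def.

Definition admissible (R : realType) (Y : state_space) (kappa : R)
    (c : site Y -> dir Y -> nat -> R) :=
  forall x i, [/\ forall a, kappa <= c x a i <= 1 - kappa,
    \sum_a c x a i = 1 & 0 <= drift c x i].

(** * Optional stopping, monotonicity and locality of finite-horizon values *)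

Section value.
Variables (R : realType) (Y : state_space).
Implicit Types (h : seq (site Y)) (a : dir Y) (n m : nat).
Implicit Types (S : seq (site Y) -> bool) (f g : seq (site Y) -> R).

Variables (kappa : R) (c : site Y -> dir Y -> nat -> R).
Hypotheses (kappa_gt0 : 0 < kappa) (c_adm : admissible kappa c).
Local Notation V := (value c).

Lemma adm_ge x a i : kappa <= c x a i.
Proof. by case: (c_adm x i) => /(_ a) /andP[]. Qed.

Lemma adm_ge0 x a i : 0 <= c x a i.
Proof. exact: le_trans (ltW kappa_gt0) (adm_ge _ _ _). Qed.

Lemma adm_sum x i : \sum_a c x a i = 1.
Proof. by case: (c_adm x i). Qed.

Lemma drift_ge0 x i : 0 <= drift c x i.
Proof. by case: (c_adm x i). Qed.

Lemma kappa_lt1 : kappa < 1.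
Proof.
have [/(_ (right_dir Y)) /andP[? ?] _ _] := c_adm 0 0%N.
by have := kappa_gt0; lra.
Qed.

(** The step to the left has probability at least [kappa] and contributes -1 instead of +1. This gap
    below 1 is what decides the critical case. *)
Lemma drift_le x i : drift c x i <= 1 - kappa *+ 2.
Proof.
rewrite /drift.
have -> : 1 - kappa *+ 2 = \sum_a c x a i
    - kappa *+ 2 by rewrite adm_sum.
rewrite (bigD1 (left_dir Y))//= [in leRHS](bigD1 (left_dir Y))//=.
rewrite dot_ell_left mulrN1.
have : \sum_(a | a != left_dir Y) c x a i * (dot_ell a)%:~R <=
    \sum_(a | a != left_dir Y) c x a i.
  apply: ler_sum => a _; rewrite ler_piMr ?adm_ge0//.
  by rewrite -[1]/(1%:~R) ler_int; case/andP: (dot_ell_bound a).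
by have := adm_ge x (left_dir Y) i; lra.
Qed.

(** Optional stopping as an inequality: [S'] stops no later than [S], and there [g] dominates what
    can still be gained. [I] is an invariant of the histories up to [S']. The equations on sizes tie
    the remaining steps to the length of the past, for payoffs that are bounded through that
    length. *)
Lemma value_tower_sized (I : seq (site Y) -> Prop) S S' f g n h :
  (forall h a, I h -> ~~ S' h -> I (extend h a)) ->
  (forall h, I h -> S h -> S' h) ->
  (forall h' m, I h' -> S' h' -> (m <= n)%N -> (size h' + m = size h + n)%N ->
     V S f m h' <= g h') ->
  (forall h', I h' -> ~~ S' h' -> (size h' = size h + n)%N -> f h' <= g h') ->
  I h -> V S f n h <= V S' g n h.
Proof.
move=> IS SS'; elim: n => [|n IHn] in h * => fg fg0 Ih.
  have [S'h|S'h] := boolP (S' h); last by apply: fg0; rewrite ?addn0.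
  exact: (fg _ 0%N).
have [S'h|S'h] := boolP (S' h).
  by rewrite [leRHS]/= S'h fg.
rewrite /= (negbTE S'h) (negbTE (contra (SS' _ Ih) S'h)).
apply: ler_sum => a _; rewrite ler_wpM2l ?adm_ge0// IHn//; last exact: IS.
  by move=> h' m Ih' S'h' mn /= e; rewrite fg// ?e ?addSnnS// ltnW.
by move=> h' Ih' S'h' /= e; rewrite fg0// e addSnnS.
Qed.

Lemma value_tower (I : seq (site Y) -> Prop) S S' f g n h :
  (forall h a, I h -> ~~ S' h -> I (extend h a)) ->
  (forall h, I h -> S h -> S' h) ->
  (forall h m, I h -> S' h -> (m <= n)%N -> V S f m h <= g h) ->
  (forall h, I h -> ~~ S' h -> f h <= g h) ->
  I h -> V S f n h <= V S' g n h.
Proof.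
move=> IS SS' fg fg0; apply: value_tower_sized => //.
  by move=> h' m Ih' S'h' mn _; apply: fg.
by move=> h' Ih' S'h' _; apply: fg0.
Qed.

Lemma value_stop S f n h : S h -> V S f n h = f h.
Proof. by case: n => //= n ->. Qed.

Lemma value_le (I : seq (site Y) -> Prop) S f g n h :
  (forall h a, I h -> ~~ S h -> I (extend h a)) ->
  (forall h, I h -> f h <= g h) ->
  I h -> V S f n h <= V S g n h.
Proof.
move=> IS fg Ih; apply: value_tower IS _ _ _ Ih => // [h' m Ih' Sh' _|h' Ih' _].
  by rewrite value_stop// fg.
exact: fg.
Qed.

Lemma value_mono S f g n h : (forall h, f h <= g h) -> V S f n h <= V S g n h.
Proof. by move=> fg; apply: (@value_le (fun=> True)). Qed.

Lemma value_harmonic (I : seq (site Y) -> Prop) S f n h :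
  (forall h a, I h -> ~~ S h -> I (extend h a)) ->
  (forall h, I h -> ~~ S h ->
     \sum_a c (pos h) a (prior h) * f (extend h a) = f h) ->
  I h -> V S f n h = f h.
Proof.
move=> IS fE; elim: n h => [//|n IHn] h Ih /=.
case: ifPn => [//|Sh]; rewrite -[RHS]fE//.
by apply: eq_bigr => a _; rewrite IHn//; apply: IS.
Qed.

Lemma value_cst S r n h : V S (fun=> r) n h = r.
Proof.
apply: (@value_harmonic (fun=> True)) => // h' _ _.
by rewrite -mulr_suml adm_sum mul1r.
Qed.

Lemma value_eq S f g n h : f =1 g -> V S f n h = V S g n h.
Proof.
move=> fg; elim: n h => [//|n IHn] h /=; rewrite fg.
by under eq_bigr do rewrite IHn.
Qed.

Lemma valueD S f g n h :
  V S (fun h => f h + g h) n h = V S f n h + V S g n h.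
Proof.
elim: n h => [//|n IHn] h /=; case: ifPn => // _.
by rewrite -big_split; apply: eq_bigr => a _; rewrite IHn mulrDr.
Qed.

Lemma valueZ S r f n h : V S (fun h => r * f h) n h = r * V S f n h.
Proof.
elim: n h => [//|n IHn] h /=; case: ifPn => // _.
by rewrite mulr_sumr; apply: eq_bigr => a _; rewrite IHn mulrCA.
Qed.

Lemma valueB S f g n h :
  V S (fun h => f h - g h) n h = V S f n h - V S g n h.
Proof.
rewrite -[- V S g n h]mulN1r -valueZ -valueD.
by apply: value_eq => h'; rewrite mulN1r.
Qed.

Lemma value_sum (T : Type) (r : seq T) S (F : T -> seq (site Y) -> R) n h :
  V S (fun h => \sum_(x <- r) F x h) n h = \sum_(x <- r) V S (F x) n h.
Proof.
elim: r => [|x r IH].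
  under value_eq do rewrite big_nil.
  by rewrite value_cst big_nil.
under value_eq do rewrite big_cons.
by rewrite big_cons valueD IH.
Qed.

Lemma value_ge0 S f n h : (forall h, 0 <= f h) -> 0 <= V S f n h.
Proof. by move=> f0; rewrite -(value_cst S 0 n h); apply: value_mono. Qed.

Lemma value_bool_ge0 S (B : seq (site Y) -> bool) n h :
  0 <= V S (fun h => (B h)%:R) n h.
Proof. by apply: value_ge0 => h'; rewrite ler0n. Qed.

Lemma value_bool_le1 S (B : seq (site Y) -> bool) n h :
  V S (fun h => (B h)%:R) n h <= 1.
Proof.
rewrite -[leRHS](value_cst S 1 n h); apply: value_mono => h'.
by case: (B h').
Qed.

Lemma value_eq0 (I : seq (site Y) -> Prop) S f n h :
  (forall h a, I h -> ~~ S h -> I (extend h a)) ->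
  (forall h, I h -> f h = 0) -> I h -> V S f n h = 0.
Proof.
move=> IS f0 Ih; apply/eqP; rewrite eq_le -(value_cst S 0 n h).
by rewrite !(@value_le I)// => h' /f0->.
Qed.

(** A payoff that vanishes off [S] is collected only by stopping, so further steps can only help. *)
Lemma value_horizon S f n m h : (forall h, 0 <= f h) ->
  (forall h, ~~ S h -> f h = 0) -> (n <= m)%N -> V S f n h <= V S f m h.
Proof.
move=> f0 fS; elim: n m h => [|n IHn] [|m] h nm //.
  rewrite [leRHS]/=; case: ifPn => [//|Sh].
  by rewrite /= fS// sumr_ge0// => a _; rewrite mulr_ge0 ?adm_ge0 ?value_ge0.
rewrite /=; case: ifPn => // _.
by apply: ler_sum => a _; rewrite ler_wpM2l ?adm_ge0 ?IHn.
Qed.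

Lemma value_bisim (rel : seq (site Y) -> seq (site Y) -> Prop) S S' f g n h h' :
  (forall h h', rel h h' -> S h = S' h' /\ f h = g h') ->
  (forall h h', rel h h' -> ~~ S h ->
     [/\ pos h = pos h', prior h = prior h'
       & forall a, rel (extend h a) (extend h' a)]) ->
  rel h h' -> V S f n h = V S' g n h'.
Proof.
move=> Sf step; elim: n h h' => [|n IHn] h h' hh'; first by case: (Sf _ _ hh').
have [Sh fh] := Sf _ _ hh'; rewrite /= -Sh fh; case: ifPn => // /step - /(_ _ hh').
by move=> [<- <- hh2]; apply: eq_bigr => a _; rewrite (IHn _ _ (hh2 a)).
Qed.

(** Meeting [B] at the moment when [S] stops the walk is one way of ever meeting [B']. *)
Lemma value_hit_le S (B B' : seq (site Y) -> bool) n h :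
  (forall h, B h -> B' h) ->
  V S (fun h => (S h && B h)%:R) n h <= V B' (fun h => (B' h)%:R) n h.
Proof.
move=> BB'; elim: n h => [|n IHn] h.
  by rewrite /= ler_nat; have := BB' h; case: (S h) (B h) (B' h) => -[] []// ->.
rewrite /=; case: (boolP (B' h)) => B'h.
  have := value_bool_le1 S (fun h => S h && B h) n.+1 h; exact.
case: ifPn => [Sh|_].
  by rewrite (negbTE (contra (BB' h) B'h)) andbF sumr_ge0// => a _;
    rewrite mulr_ge0 ?adm_ge0 ?value_bool_ge0.
by apply: ler_sum => a _; rewrite ler_wpM2l ?adm_ge0.
Qed.

Lemma value_hit_mono (B B' : seq (site Y) -> bool) n h :
  (forall h, B h -> B' h) ->
  V B (fun h => (B h)%:R) n h <= V B' (fun h => (B' h)%:R) n h.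
Proof.
move=> BB'; apply: le_trans (value_hit_le B n h BB').
by under [leRHS]value_eq do rewrite andbb.
Qed.

Lemma prior_count h : h != [::] -> count_mem (pos h) h = (prior h).+1.
Proof. by case: h => //= x h _; rewrite eqxx. Qed.

(* A history is irrelevant as long as the walk stays at levels [>= k], except
   for the number of visits to each site there. *)
Definition agree k h h' :=
  [/\ h != [::], h' != [::], pos h = pos h' &
     forall x, k <= height x -> count_mem x h = count_mem x h'].

Lemma agree_prior k h h' : agree k h h' -> k <= ht h -> prior h = prior h'.
Proof.
move=> [h0 h0' hh' cE] kh; apply: succn_inj.
by rewrite -!prior_count// -hh' cE.
Qed.

Lemma agree_extend k h h' a : agree k h h' -> agree k (extend h a) (extend h' a).
Proof.
move=> [h0 h0' hh' cE]; split => //=; first by rewrite hh'.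
by move=> x kx; rewrite hh' cE.
Qed.

Lemma value_agree k S S' f g n h h' :
  (forall h h', agree k h h' -> S h = S' h' /\ f h = g h') ->
  (forall h, ~~ S h -> k <= ht h) ->
  agree k h h' -> V S f n h = V S' g n h'.
Proof.
move=> Sf Sk; apply: value_bisim => // h1 h2 h12 /Sk k1.
split; [by case: h12|exact: agree_prior h12 k1|].
by move=> a; apply: agree_extend.
Qed.

(** The height minus the drift consumed is a martingale. *)
Lemma value_height S n h : h != [::] ->
  V S (fun h => (ht h)%:~R) n h =
  (ht h)%:~R + V S (consumed c predT) n h - consumed c predT h.
Proof.
move=> h0; apply/eqP; rewrite -addrAC -subr_eq -valueB; apply/eqP.
apply: (@value_harmonic (fun h => h != [::])) => // {h0}h h0 _.
under eq_bigr do rewrite consumed_extend// ht_extend intrD mul1r.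
have -> : \sum_a c (pos h) a (prior h) * ((ht h)%:~R + (dot_ell a)%:~R -
    (consumed c predT h + drift c (pos h) (prior h))) =
   \sum_a c (pos h) a (prior h) * ((ht h)%:~R - consumed c predT h -
      drift c (pos h) (prior h)) + drift c (pos h) (prior h).
  rewrite -big_split /=; apply: eq_bigr => a _; ring.
by rewrite -mulr_suml adm_sum mul1r subrK.
Qed.

Lemma drift_sum_ge0 Q h : 0 <= drift_sum c Q h.
Proof. by elim: h => //= x h IH; rewrite addr_ge0// mulr_ge0 ?drift_ge0. Qed.

Lemma drift_sum_le (Q Q' : pred (site Y)) h :
  {in h, forall x, Q x -> Q' x} -> drift_sum c Q h <= drift_sum c Q' h.
Proof.
elim: h => //= x h IH QQ'; rewrite lerD ?IH//.
  by move=> y yh; apply: QQ'; rewrite inE yh orbT.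
rewrite ler_wpM2r ?drift_ge0// ler_nat; have := QQ' x (mem_head _ _); case: (Q x) => [->|_]//.
Qed.


End value.

(** * Crossings of levels *)

Section forced_paths.
Variables (R : realType) (Y : state_space).
Implicit Types (h : seq (site Y)) (a : dir Y) (n m : nat) (s : seq (dir Y)).

Definition exits (lo hi : int) h := (ht h <= lo) || (hi <= ht h).

(** Entries into the half-space below [j], not into level [j]; a walk that starts below [j] has none
    yet. *)
Fixpoint entries (j : int) h : nat :=
  if h is y :: t then
    (entries j t + nat_of_bool ([&& t != [::], height y < j & j <= ht t])%R)%N
  else 0%N.

Lemma entries_extend j h a : h != [::] ->
  entries j (extend h a) =
  (entries j h + nat_of_bool ((ht (extend h a) < j) && (j <= ht h))%R)%N.
Proof. by move=> h0; rewrite /= h0. Qed.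

Lemma entries_extend_low j h a : ht h < j ->
  entries j (extend h a) = entries j h.
Proof. by move=> hj; rewrite /= [j <= _]leNgt hj !andbF addn0. Qed.

Lemma entries_extend_high j h a : j <= ht (extend h a) ->
  entries j (extend h a) = entries j h.
Proof. by move=> hj; rewrite /= [height _ < j]ltNge [height _](_ : _ = ht (extend h a))// hj andbF addn0. Qed.

Lemma leq_entries j h a : (entries j h <= entries j (extend h a))%N.
Proof. by rewrite /= leq_addr. Qed.

Fixpoint walk h s := if s is a :: s' then walk (extend h a) s' else h.

Lemma walk_cat h s1 s2 : walk h (s1 ++ s2) = walk (walk h s1) s2.
Proof. by elim: s1 h => //=. Qed.

Lemma walk_neq0 h s : h != [::] -> walk h s != [::].
Proof. by elim: s h => //= a s IH h _; apply: IH. Qed.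

Lemma pos_walk_nseq h r v : pos (walk h (nseq r v)) = pos h + shiftv v *+ r.
Proof.
by elim: r h => [|r IH] h /=; rewrite ?mulr0n ?addr0// IH mulrS addrA.
Qed.

Fixpoint avoids (S : seq (site Y) -> bool) h s :=
  if s is a :: s' then ~~ S h && avoids S (extend h a) s' else true.

Lemma avoids_cat S h s1 s2 :
  avoids S h (s1 ++ s2) = avoids S h s1 && avoids S (walk h s1) s2.
Proof. by elim: s1 h => //= a s IH h; rewrite IH andbA. Qed.

Lemma avoids_nseq (I : seq (site Y) -> Prop) S h v r :
  (forall h, I h -> I (extend h v)) -> (forall h, I h -> ~~ S h) ->
  I h -> avoids S h (nseq r v) /\ I (walk h (nseq r v)).
Proof.
move=> Iv IS; elim: r h => //= r IH h Ih; rewrite IS//=.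
exact/IH/Iv.
Qed.

Variables (kappa : R) (c : site Y -> dir Y -> nat -> R).
Hypotheses (kappa_gt0 : 0 < kappa) (c_adm : admissible kappa c).
Local Notation V := (value c).

Lemma value_path_ge S f n h s : (forall h, 0 <= f h) -> avoids S h s ->
  kappa ^+ size s * V S f n (walk h s) <= V S f (size s + n) h.
Proof.
move=> f0; elim: s h => [|a s IH] h /=; first by rewrite mul1r.
move=> /andP[Sh /IH {}IH]; rewrite (negbTE Sh) (bigD1 a)//= -[leLHS]addr0.
rewrite lerD//.
  rewrite exprS -mulrA ler_pM// ?(adm_ge c_adm)// ?(ltW kappa_gt0)//.
  by rewrite mulr_ge0 ?exprn_ge0 ?(ltW kappa_gt0) ?(value_ge0 kappa_gt0 c_adm).
rewrite sumr_ge0// => b _.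
by rewrite mulr_ge0 ?(adm_ge0 kappa_gt0 c_adm) ?(value_ge0 kappa_gt0 c_adm).
Qed.

Section marks_and_targets.
Variables (marks targets : seq (site Y) -> nat) (l : nat).

(** No mark is gained along the path, nor by a one-step deviation from it. A walk that deviates
    still has as many marks to go, so the inductive bound applies to it unchanged. *)
Fixpoint quiet h s : Prop :=
  if s is a :: s' then
    (forall b, marks (extend h b) = marks h) /\ quiet (extend h a) s'
  else True.

Lemma quiet_cat h s1 s2 :
  quiet h s1 -> quiet (walk h s1) s2 -> quiet h (s1 ++ s2).
Proof. by elim: s1 h => //= a s IH h [? ?] ?; split=> //; apply: IH. Qed.

Lemma quiet_nseq (I : seq (site Y) -> Prop) h v r :
  (forall h, I h -> I (extend h v)) ->
  (forall h b, I h -> marks (extend h b) = marks h) ->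
  I h -> quiet h (nseq r v) /\ I (walk h (nseq r v)).
Proof.
move=> Iv IS; elim: r h => //= r IH h Ih.
by have [? ?] := IH _ (Iv _ Ih); split=> //; split=> // b; apply: IS.
Qed.

Lemma marks_quiet h s : quiet h s -> marks (walk h s) = marks h.
Proof. by elim: s h => //= a s IH h [mE /IH->]. Qed.

Hypothesis targets_extend : forall h a, (targets h <= targets (extend h a))%N.
Hypothesis marks_extend : forall h a,
  (marks h <= marks (extend h a) <= (marks h).+1)%N.
Hypothesis forced : forall h a, h != [::] ->
  marks (extend h a) = (marks h).+1 ->
  exists s, [/\ (size s <= l)%N, quiet (extend h a) s
    & (targets (extend h a) < targets (walk (extend h a) s))%N].

Variables (e0 v0 : nat).
Let S h := (e0 < marks h)%N.
Let f h : R := ((e0 < marks h) && (targets h < v0))%N%:R.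
(** After a mark, a target is reached with probability at least [kappa ^+ l], which halves the
    weight [2 ^+ v]; in mean the weight is multiplied by at most [rho]. *)
Let rho : R := 1 - kappa ^+ l / 2.

Let kl_gt0 : 0 < kappa ^+ l. Proof. exact: exprn_gt0. Qed.
Let kl_le1 : kappa ^+ l <= 1.
Proof. by rewrite exprn_ile1 ?(ltW kappa_gt0)// ltW ?(kappa_lt1 kappa_gt0 c_adm). Qed.
Let rho_gt0 : 0 < rho. Proof. by have := kl_le1; rewrite /rho; lra. Qed.
Let f_ge0 h : 0 <= f h. Proof. by rewrite /f ler0n. Qed.
Let fS h : ~~ S h -> f h = 0. Proof. by rewrite /f /S; case: ltnP. Qed.

(* After each mark the walk reaches the next target along a forced path, with
   probability at least [kappa ^+ l] and before the next mark. So
   [rho ^+ (- marks) * 2 ^+ (- targets)] is a supermartingale at the marks. *)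
Lemma forced_value e v n h : h != [::] ->
  (marks h + e <= e0)%N -> (v0 <= targets h + v)%N ->
  V S f n h <= rho ^+ e * 2 ^+ v.
Proof.
elim: e v n h => [|e IHe] v n h h0 me vt.
  rewrite mul1r (le_trans (value_bool_le1 kappa_gt0 c_adm _ _ _ _))//.
  by rewrite exprn_ege1// ler1n.
elim: n h v h0 me vt => [|n IHn] h v h0 me vt.
  rewrite /= fS ?mulr_ge0 ?exprn_ge0 ?(ltW rho_gt0)//.
  by rewrite /S -leqNgt (leq_trans _ me)// leq_addr.
case: v => [|v] in vt *.
  rewrite (@value_eq0 _ _ _ _ kappa_gt0 c_adm (fun h => (v0 <= targets h)%N)).
  - by rewrite mulr_ge0 ?exprn_ge0 ?(ltW rho_gt0).
  - by move=> h' a h'v _; apply: leq_trans h'v (targets_extend _ _).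
  - by move=> h' h'v; rewrite /f [(_ < v0)%N]ltnNge h'v andbF.
  - by rewrite addn0 in vt.
rewrite /= {1}/S ltnNge (leq_trans (leq_addr _ _) me) /=.
rewrite -[leRHS]mul1r -[X in _ <= X * _](adm_sum c_adm (pos h) (prior h)).
rewrite mulr_suml.
apply: ler_sum => a _; rewrite ler_wpM2l ?(adm_ge0 kappa_gt0 c_adm)//.
have vt' : (v0 <= targets (extend h a) + v.+1)%N.
  by rewrite (leq_trans vt)// leq_add2r targets_extend.
have := marks_extend h a; rewrite leq_eqVlt => /andP[/orP[/eqP mE _|m1 m2]].
  by apply: IHn; rewrite -?mE.
have {m1 m2} mE : marks (extend h a) = (marks h).+1.
  by apply/eqP; rewrite eqn_leq m2.
have [s [sl qs ts]] := forced h0 mE.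
set h' := extend h a in mE qs ts vt' *.
have h'0 : h' != [::] by [].
have me' : (marks h' + e <= e0)%N by rewrite mE addSnnS.
pose M := rho ^+ e * 2 ^+ v.+1.
have M0 : 0 <= M by rewrite mulr_ge0 ?exprn_ge0 ?(ltW rho_gt0).
(* [M] bounds the value after any deviation; following the whole path, with probability at least
   [kappa ^+ size s], improves on it. *)
have step g : g != [::] -> (marks g + e <= e0)%N ->
    (v0 <= targets g + v.+1)%N -> quiet g s ->
    V S f (size s + n) g <= kappa ^+ size s * (V S f n (walk g s) - M) + M.
  elim: s {sl qs ts} g => [|b s IHs] g g0 ge gv /=.
    by rewrite mul1r subrK.
  move=> [mg qs]; rewrite {1}/S ltnNge (leq_trans (leq_addr _ _) ge) /=.
  have gvb b' : (v0 <= targets (extend g b') + v.+1)%N.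
    by rewrite (leq_trans gv)// leq_add2r targets_extend.
  have VM : V S f n (walk (extend g b) s) <= M.
    apply: IHe; rewrite ?walk_neq0// ?(marks_quiet qs) ?mg//.
    rewrite (leq_trans (gvb b))// leq_add2r.
    elim: s (extend g b) {IHs qs} => //= d s IH g'.
    exact: leq_trans (targets_extend _ _) (IH _).
  rewrite (bigD1 b)//=.
  have cb := adm_ge c_adm (pos g) b (prior g).
  have cb0 := adm_ge0 kappa_gt0 c_adm (pos g) b (prior g).
  have := IHs (extend g b) isT; rewrite mg => /(_ ge (gvb _) qs) {}IHs.
  set W := value c S f n (walk _ _) in VM IHs *; set K := kappa ^+ size s in IHs *.
  apply: (@le_trans _ _ (c (pos g) b (prior g) * (K * (W - M) + M) +
      \sum_(i | i != b) c (pos g) i (prior g) * M)).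
    rewrite lerD ?ler_wpM2l//.
    apply: ler_sum => d _; rewrite ler_wpM2l ?(adm_ge0 kappa_gt0 c_adm)//.
    by apply: IHe => //; rewrite mg.
  have sumM : \sum_i c (pos g) i (prior g) * M = M.
    by rewrite -mulr_suml (adm_sum c_adm) mul1r.
  rewrite (bigD1 b)//= in sumM; rewrite mulrDr -addrA sumM lerD2r exprS -/K.
  rewrite -subr_ge0.
  have -> : kappa * K * (W - M) - c (pos g) b (prior g) * (K * (W - M)) =
     (c (pos g) b (prior g) - kappa) * K * (M - W) by ring.
  by rewrite !mulr_ge0 ?subr_ge0 ?exprn_ge0 ?(ltW kappa_gt0).
(* The horizon is lengthened so that the whole forced path fits in. *)
have mono := value_horizon kappa_gt0 c_adm h' f_ge0 fS (leq_addl (size s) n).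
apply: le_trans mono (le_trans (step _ h'0 me' vt' qs) _).
have Vw : V S f n (walk h' s) <= rho ^+ e * 2 ^+ v.
  apply: IHe; rewrite ?walk_neq0 ?(marks_quiet qs)//; lia.
have kls : kappa ^+ l <= kappa ^+ size s.
  by rewrite ler_wiXn2l ?(ltW kappa_gt0) ?ltW ?(kappa_lt1 kappa_gt0 c_adm).
rewrite /M [rho ^+ e.+1]exprS [2 ^+ v.+1]exprS.
set A := rho ^+ e; set B := 2 ^+ v; rewrite -/A -/B in Vw.
have AB : 0 <= A * B by rewrite mulr_ge0 ?exprn_ge0 ?(ltW rho_gt0).
apply: (@le_trans _ _ (kappa ^+ size s * (- (A * B)) + A * (2 * B))).
  rewrite lerD2r ler_wpM2l ?exprn_ge0 ?(ltW kappa_gt0)//; lra.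
apply: (@le_trans _ _ (kappa ^+ l * (- (A * B)) + A * (2 * B))).
  by rewrite lerD2r !mulrN lerN2 ler_wpM2r.
by rewrite /rho le_eqVlt; apply/orP; left; apply/eqP; field.
Qed.

(** Stopping at the first moment with more than [e0] marks is optimal: before it the payoff is 0,
    and afterwards new targets can only spoil it. So the bound holds for every rule [S']. *)
Lemma forced_bound S' n h : h != [::] -> marks h = 0%N ->
  V S' f n h <= rho ^+ e0 * 2 ^+ v0.
Proof.
move=> h0 m0; apply: (@le_trans _ _ (V S f n h)); last first.
  by apply: forced_value; rewrite ?m0 ?leq_addl.
elim: n h {h0 m0} => [//|n IHn] h /=.
have [Sh|Sh] := boolP (S h); last first.
  case: ifPn => _; first by rewrite fS// sumr_ge0// => a _;
    rewrite mulr_ge0 ?(adm_ge0 kappa_gt0 c_adm) ?(value_ge0 kappa_gt0 c_adm).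
  by apply: ler_sum => a _; rewrite ler_wpM2l ?(adm_ge0 kappa_gt0 c_adm).
case: ifPn => // _.
have [tv|tv] := ltnP (targets h) v0.
  rewrite (_ : f h = 1); last by move: Sh; rewrite /S /f tv => ->.
  rewrite -[leRHS](adm_sum c_adm (pos h) (prior h)); apply: ler_sum => a _.
  by rewrite ler_piMr ?(adm_ge0 kappa_gt0 c_adm)// (value_bool_le1 kappa_gt0 c_adm).
rewrite big1 ?f_ge0// => a _.
rewrite (@value_eq0 _ _ _ _ kappa_gt0 c_adm (fun h => (v0 <= targets h)%N)) ?mulr0//.
- by move=> h' b h'v _; apply: leq_trans h'v (targets_extend _ _).
- by move=> h' h'v; rewrite /f [(_ < v0)%N]ltnNge h'v andbF.
- exact: leq_trans tv (targets_extend _ _).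
Qed.

End marks_and_targets.
End forced_paths.

Section crossing_estimates.
Variables (R : realType) (Y : state_space).
Implicit Types (h : seq (site Y)) (a : dir Y) (n m : nat) (s : seq (dir Y)).
Variables (kappa : R) (c : site Y -> dir Y -> nat -> R).
Hypotheses (kappa_gt0 : 0 < kappa) (c_adm : admissible kappa c).
Local Notation V := (value c).

Lemma entries_step j h a :
  (entries j h <= entries j (extend h a) <= (entries j h).+1)%N.
Proof.
by case: h => [//|x h]; rewrite entries_extend// leq_addr -addn1 leq_add2l leq_b1.
Qed.

Lemma entryP j h a : h != [::] -> entries j (extend h a) = (entries j h).+1 ->
  ht (extend h a) = j - 1 /\ j <= ht h.
Proof.
move=> h0; rewrite entries_extend//; case: andP => [[h1 h2] _|_]; last by lia.
by have := ht_extend_ge h a; lia.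
Qed.

Lemma count_walk (Q : pred (site Y)) h s : (count Q h <= count Q (walk h s))%N.
Proof.
by elim: s h => //= a s IH h; apply: leq_trans (IH _); rewrite /= leq_addl.
Qed.

Lemma vertical_walk h (y : site Y) : ht h = height y ->
  exists s, [/\ (size s <= width Y)%N, pos (walk h s) = y,
    forall S, (forall h', ht h' = ht h -> ~~ S h') -> avoids S h s,
    quiet (entries (ht h + 1)) h s
    & forall x, height x != ht h -> count_mem x (walk h s) = count_mem x h].
Proof.
move=> hy; have [v /(_ _ _ hy)[r [rw -> rv]]] := vertical_path Y.
exists (nseq r v); rewrite size_nseq pos_walk_nseq; case: r rv {y hy} rw => [|r] dv rw.
  by split.
have {}dv := dv isT.
pose I (g : seq (site Y)) := ht g = ht h.
have Iv g : I g -> I (extend g v) by rewrite /I ht_extend dv addr0.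
have Ih : I h by [].
split => //.
- by move=> S hS; have [] := avoids_nseq r.+1 Iv hS Ih.
- have [] // := @quiet_nseq _ (entries (ht h + 1)) I h v r.+1 Iv _ Ih.
  by move=> g b Ig; rewrite entries_extend_low// Ig ltrDl.
- move=> x xh; have : forall k (g : seq (site Y)), I g ->
    count_mem x (walk g (nseq k v)) = count_mem x g.
    elim=> //= k IH g Ig; rewrite IH; last exact: Iv.
    rewrite /=; have -> : (pos g + shiftv v == x) = false; last by [].
    by apply: contraNF xh => /eqP <-; rewrite heightD height_shiftv dv addr0; apply/eqP.
  exact.
Qed.

(** An entry below the level of [x] lands one level lower. From there a path inside that level leads
    to the left neighbour of [x], and a step to the right visits [x]. No step from below that level
    is an entry, so the path is quiet. *)
Lemma visits_bound S (x y : site Y) n (N I : nat) :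
  V S (fun h => ((N < entries (height x) h) && (count_mem x h < I))%N%:R) n [:: y]
    <= (1 - kappa ^+ (width Y).+1 / 2) ^+ N * 2 ^+ I.
Proof.
apply: (forced_bound kappa_gt0 c_adm (marks := entries (height x))
  (targets := count_mem x)) => //.
- by move=> h a; rewrite /= leq_addl.
- by move=> h a; apply: entries_step.
move=> h a h0 /(entryP h0)[h1 h2].
have hx : ht (extend h a) = height (x - shiftv (right_dir Y)).
  by rewrite heightD heightN height_shiftv dot_ell_right.
have [s [sw ps _ qs _]] := vertical_walk hx.
exists (s ++ [:: right_dir Y]); rewrite size_cat addn1; split => //.
  have E : ht (extend h a) + 1 = height x by rewrite h1 subrK.
  rewrite E in qs; apply: quiet_cat qs _; split => // b.
  by rewrite entries_extend_low// /ht ps -hx h1; lia.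
rewrite walk_cat /= ps subrK eqxx add1n ltnS.
exact: count_walk.
Qed.

Definition below m (x : site Y) := height x <= - m%:Z.

Definition outside m k (x : site Y) := (height x <= - m%:Z) || (k%:Z <= height x).

(** An entry below 0 lands on level -1, from where [m.+1] steps to the left end with a new visit at
    or below [- m], even if the landing site already counts as one. *)
Lemma descent_bound S (y : site Y) n (N m : nat) :
  V S (fun h => ((N < entries 0 h) &&
         (count (below m) h < 1))%N%:R) n [:: y]
    <= (1 - kappa ^+ m.+1 / 2) ^+ N * 2 ^+ 1.
Proof.
apply: (forced_bound kappa_gt0 c_adm (marks := entries 0)
  (targets := count (below m))) => //.
- by move=> h a; rewrite /= leq_addl.
- by move=> h a; apply: entries_step.
move=> h a h0 /(entryP h0)[h1 h2].
move: (extend h a) h1 => g h1 {h h0 h2 a}.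
have [q _] : quiet (entries 0) g (nseq m (left_dir Y)) /\
    ht (walk g (nseq m (left_dir Y))) < 0.
  apply: (@quiet_nseq _ (entries 0) (fun g => ht g < 0)).
  - by move=> g' g0; rewrite ht_extend dot_ell_left; lia.
  - by move=> g' b g0; rewrite entries_extend_low.
  - by rewrite h1.
have hw : ht (walk g (nseq m (left_dir Y))) = -1 - m%:Z.
  rewrite /ht pos_walk_nseq heightD [height (pos g)]h1.
  have -> : height (shiftv (left_dir Y) *+ m) = - m%:Z; last by [].
  elim: {g h1 q} m => [|m IH]; rewrite ?mulr0n ?height0//.
  by rewrite mulrS heightD IH height_shiftv dot_ell_left; lia.
exists (nseq m (left_dir Y) ++ [:: left_dir Y]).
rewrite size_cat size_nseq addn1; split => //.
  apply: quiet_cat => //; split => // b.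
  by rewrite entries_extend_low// hw; lia.
rewrite walk_cat /= /below /outside heightD height_shiftv dot_ell_left [height _]hw.
by rewrite (_ : _ <= _) ?add1n ?ltnS ?count_walk//; lia.
Qed.

Lemma clock_quiet h s (l : nat) :
  (size h %% l.+1 + size s < l.+1)%N -> quiet (fun h => size h %/ l.+1)%N h s.
Proof.
elim: s h => //= a s IH h hs.
have E : (size h).+1 = (size h %/ l.+1 * l.+1 + (size h %% l.+1).+1)%N.
  by rewrite addnS -divn_eq.
have lt : ((size h %% l.+1).+1 < l.+1)%N by apply: leq_trans hs; lia.
split => [_|]; first by rewrite /= E divnMDl// (divn_small lt) addn0.
by apply: IH; rewrite /= E modnMDl (modn_small lt); lia.
Qed.

(** The marks are the ticks of a clock of period [(k + m).+1]. From any site between the two levels,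
    [k + m] steps to the right lead out, and they fit between two ticks. *)
Lemma exit_bound S (y : site Y) n (N k m : nat) : (0 < k + m)%N ->
  V S (fun h => ((N < size h %/ (k + m).+1) &&
         (count (outside m k) h < 1))%N%:R)
    n [:: y] <= (1 - kappa ^+ (k + m) / 2) ^+ N * 2 ^+ 1.
Proof.
move=> km; apply: (forced_bound kappa_gt0 c_adm
  (marks := fun h => (size h %/ (k + m).+1)%N)
  (targets := count (outside m k))) => //.
- by move=> h a; rewrite /= leq_addl.
- by move=> h a /=; rewrite divnS//; case: dvdn; rewrite ?add0n ?add1n leqnn ?leqnSn.
- move=> h a h0 mark; set g := extend h a.
  have sg : (size g %% (k + m).+1 = 0)%N.
    by move: mark; rewrite /= divnS// /dvdn; case: eqP => //= _; lia.
  move: g sg => {h h0 mark a} g sg.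
  (* A site at or below [- m] has already been counted; a further step to the left provides the new
     visit that is required. *)
  have [g1|g1] := boolP (ht g <= - m%:Z).
    exists [:: left_dir Y]; split => //.
      by apply: clock_quiet; rewrite sg /=; lia.
    rewrite /= /outside heightD height_shiftv.
    rewrite dot_ell_left -[height (pos g)]/(ht g).
    by rewrite (_ : ht g + -1 <= - m%:Z) //; lia.
  exists (nseq (k + m).-1 (right_dir Y) ++ [:: right_dir Y]).
  rewrite size_cat size_nseq /= addn1 prednK//; split => //.
    by apply: clock_quiet; rewrite sg size_cat size_nseq /=; lia.
  rewrite walk_cat /= /below /outside heightD height_shiftv dot_ell_right pos_walk_nseq.
  have -> : height (pos g + shiftv (right_dir Y) *+ (k + m).-1) =
      ht g + (k + m)%:Z - 1.
    rewrite heightD -addrA; congr (_ + _); rewrite -[X in X%:Z]prednK//.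
    elim: (k + m).-1 => [|r IH]; rewrite ?mulr0n ?height0//.
    by rewrite mulrS heightD IH height_shiftv dot_ell_right; lia.
  rewrite (_ : k%:Z <= _) ?orbT ?add1n ?ltnS ?count_walk//; lia.
- by rewrite /= divn_small// !ltnS.
Qed.

Lemma exits_outside m k h : h != [::] ->
  exits (- m%:Z) k%:Z h = outside m k (pos h).
Proof. by []. Qed.

Lemma exit_clock n h (N k m : nat) : (N.+1 * (k + m).+1 <= size h + n)%N ->
  h != [::] -> exits (- m%:Z) k%:Z h || (count (outside m k) h < 1)%N ->
  V (exits (- m%:Z) k%:Z) (fun h => (~~ exits (- m%:Z) k%:Z h)%:R) n h <=
  V (exits (- m%:Z) k%:Z) (fun h => ((N < size h %/ (k + m).+1) &&
         (count (outside m k) h < 1))%N%:R) n h.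
Proof.
elim: n h => [|n IHn] h hn h0 /orP[Sh|hc].
- by rewrite /= Sh ler0n.
- rewrite /= hc andbT leq_divRL//; rewrite addn0 in hn.
  by rewrite hn; case: exits.
- by rewrite /= Sh ler0n.
- rewrite /=; case: ifPn => [->|Sh]; first by rewrite ler0n.
  apply: ler_sum => a _; rewrite ler_wpM2l ?(adm_ge0 kappa_gt0 c_adm)//.
  apply: IHn => //; first by rewrite /= addSnnS.
  rewrite exits_outside//= ; case: (outside _ _ _) => //=.
Qed.

(* Either the walk leaves the strip between the levels [- m] and [k] late, or
   it leaves it at [- m], which the submartingale [ht] bounds. *)
Lemma hitting_time_tail n (N k m : nat) : (0 < k)%N ->
  ((N.+2) * (k + m).+1 <= n)%N ->
  V (fun h => k%:Z <= ht h) (fun h => (ht h < k%:Z)%R%:R) n [:: 0] <=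
  k%:R / (k + m)%:R + (1 - kappa ^+ (k + m) / 2) ^+ N * 2.
Proof.
move=> k0 Nn; have km : (0 : R) < (k + m)%:R by rewrite ltr0n addn_gt0 k0.
set S' := @exits Y (- m%:Z) k%:Z.
apply: (@le_trans _ _ (V S' (fun h => (ht h < k%:Z)%R%:R) n [:: 0])).
  apply: (value_tower kappa_gt0 c_adm (I := fun=> True)) => //.
    by move=> h _ kh; rewrite /S' /exits kh orbT.
  move=> h n' _ S'h _; case: ltP => kh.
    exact: (value_bool_le1 kappa_gt0 c_adm).
  by rewrite value_stop// ltNge kh.
pose I h := h != [::] :> seq (site Y) /\ (- m%:Z <= ht h <= k%:Z).
(* The linear function of the height is 1 at [- m] and 0 at [k]; the last term pays for a walk that
   has not left in time. *)
have : V S' (fun h => (ht h < k%:Z)%R%:R) n [:: 0] <=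
    V S' (fun h => (k + m)%:R^-1 * (k%:R - (ht h)%:~R) + (~~ S' h)%:R) n [:: 0].
  apply: (value_le kappa_gt0 c_adm (I := I)).
  - move=> h a [h0 hI] S'h; split => //; move: S'h; rewrite /S' /exits.
    by have := ht_extend_ge h a; have := ht_extend_le h a; lia.
  - move=> h [h0 /andP[h1 h2]]; have := h1; rewrite -(@ler_int R) => h1'.
    have := h2; rewrite -(@ler_int R) => h2'.
    have ge0 : 0 <= (k + m)%:R^-1 * (k%:R - (ht h)%:~R) :> R.
      by rewrite mulr_ge0 ?invr_ge0 ?(ltW km)// subr_ge0.
    rewrite /S' /exits; case: (ltP (ht h) k%:Z) => hk /=; last by rewrite addr_ge0.
    case: (leP (ht h) (- m%:Z)) => hm /=; last by rewrite lerDr.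
    rewrite addr0 (_ : ht h = - m%:Z); last by apply/eqP; rewrite eq_le hm h1.
    by rewrite rmorphN /= opprK -natrD mulVf ?gt_eqF.
  - by split => //; rewrite /ht /= height0; lia.
move=> /le_trans; apply; rewrite valueD lerD//.
  rewrite valueZ mulrC ler_wpM2r ?invr_ge0 ?(ltW km)// valueB.
  rewrite (value_cst c_adm) (value_height c_adm)// /consumed /= /ht /= height0.
  rewrite subr0 add0r lerBlDr lerDl (value_ge0 kappa_gt0 c_adm)// => h.
  exact: drift_sum_ge0.
rewrite -[X in _ * X]expr1; apply: le_trans _ (exit_bound S' 0 n N _).
  apply: exit_clock => //=; first by rewrite mulSn in Nn *; lia.
  by case: (boolP (exits _ _ _)) => //; rewrite exits_outside//= => /negbTE->.
by rewrite addn_gt0 k0.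
Qed.

End crossing_estimates.

(** * Few crossings of a level, compared with the escape of a fresh walk *)

Section comparison.
Variables (R : realType) (Y : state_space).
Implicit Types (h : seq (site Y)) (a : dir Y) (n m : nat) (s : seq (dir Y)).
Variables (kappa : R) (c : site Y -> dir Y -> nat -> R).
Hypotheses (kappa_gt0 : 0 < kappa) (c_adm : admissible kappa c).
Local Notation V := (value c).
Variables (j k : int) (N : nat).
Hypothesis jk : j < k.

Let S h := k <= ht h.
Let f h : R := ((k <= ht h)%R && (entries j h <= N)%N)%:R.
Let T := @exits Y (j - 2) k.
Let g h : R := (k <= ht h)%R%:R.
Let w := (width Y).+1.
Let C := (kappa ^+ w)^-1.

Let kw_gt0 : 0 < kappa ^+ w. Proof. exact: exprn_gt0. Qed.
Let C_ge1 : 1 <= C.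
Proof.
by rewrite invf_ge1// exprn_ile1 ?(ltW kappa_gt0)// ltW ?(kappa_lt1 kappa_gt0 c_adm).
Qed.
Let C_ge0 : 0 <= C. Proof. exact: le_trans ler01 C_ge1. Qed.
Let Vg_ge0 m h : 0 <= V T g m h.
Proof. exact: (value_bool_ge0 kappa_gt0 c_adm). Qed.

Let Vf_eq0 n h : (N < entries j h)%N -> V S f n h = 0.
Proof.
apply: (value_eq0 kappa_gt0 c_adm (I := fun h => (N < entries j h)%N)).
  by move=> h' a h'N _; apply: leq_trans h'N (leq_entries _ _ _).
by move=> h' h'N; rewrite /f leqNgt h'N andbF.
Qed.

(* The left-hand walk only matters through its trace on the levels [>= j]. Each
   of its excursions below [j], returning to [j] at a given site, is replaced
   by a forced path inside level [j - 1], at the price of a factor [C]. *)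
Lemma comparison n m h h2 : h != [::] -> h2 != [::] ->
  (forall x, j <= height x -> count_mem x h = count_mem x h2) ->
  (n * w <= m)%N -> (entries j h <= N)%N ->
  (pos h = pos h2 -> j <= ht h ->
     V S f n h <= C ^+ (N - entries j h) * V T g m h2) /\
  (ht h < j -> ht h2 = j - 1 ->
     V S f n h <= C ^+ (N - entries j h).+1 * V T g m h2).
Proof.
elim: n m h h2 => [|n IHn] m h h2 h0 h20 hh2 nm hN.
  split=> [p12 jh|hj _]; last first.
    by rewrite /= /f [k <= _]leNgt (lt_trans hj jk) mulr_ge0// exprn_ge0.
  rewrite /= /f hN andbT; have [kh|_] := boolP (k <= ht h); last first.
    by rewrite mulr_ge0// exprn_ge0.
  have -> : V T g m h2 = 1.
    by rewrite value_stop /g /T/exits /ht -p12 -/(ht h) ?kh ?orbT.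
  by rewrite mulr1 exprn_ege1.
split => [p12 jh|hj h2j].
  have [kh|kh] := boolP (k <= ht h).
    rewrite value_stop// /f hN andbT kh.
    have -> : V T g m h2 = 1.
      by rewrite value_stop /g /T/exits /ht -p12 -/(ht h) ?kh ?orbT.
    by rewrite mulr1 exprn_ege1.
  case: m nm => [|m] nm; first by rewrite mulSn in nm.
  have pE : prior h = prior h2 by apply: (@agree_prior _ j) => //; split.
  rewrite /= /S (negbTE kh) {1}/T /exits /ht -p12 -/(ht h) (negbTE kh) orbF.
  rewrite (_ : (ht h <= j - 2) = false); last by apply/negbTE; lia.
  rewrite -pE mulr_sumr.
  apply: ler_sum => a _; rewrite mulrCA ler_wpM2l ?(adm_ge0 kappa_gt0 c_adm)//.
  have hh2' x : j <= height x ->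
      count_mem x (extend h a) = count_mem x (extend h2 a).
    by move=> jx; rewrite /= p12 hh2.
  have nm' : (n * w <= m)%N by rewrite mulSn in nm; lia.
  have [jh'|jh'] := boolP (j <= ht (extend h a)).
    have eE := entries_extend_high jh'.
    have [| | |||+ _] := IHn m (extend h a) (extend h2 a); rewrite ?eE//.
    by apply; rewrite // /= p12.
  have eE : entries j (extend h a) = (entries j h).+1.
    by rewrite entries_extend// ltNge jh' jh addn1.
  have [Ne|eN] := ltnP N (entries j (extend h a)).
    by rewrite Vf_eq0// mulr_ge0// exprn_ge0.
  have [| | |||_] := IHn m (extend h a) (extend h2 a); rewrite // eE subnSK -?eE//.
  have E : ht (extend h2 a) = ht (extend h a) by rewrite /ht /= p12.
  by have h2' := ht_extend_ge h a; apply; rewrite ?E; lia.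
have kh : (k <= ht h) = false by apply/negbTE; lia.
rewrite /= {1}/S kh -[leRHS]mul1r.
rewrite -[X in _ <= X * _](adm_sum c_adm (pos h) (prior h)) mulr_suml.
apply: ler_sum => a _; rewrite ler_wpM2l ?(adm_ge0 kappa_gt0 c_adm)//.
have eE := entries_extend_low a hj.
(* While the excursion lasts, the other walk waits on level [j - 1]. *)
have [hj'|jh'] := ltP (ht (extend h a)) j.
  have [| | |||_] := IHn m (extend h a) h2; rewrite ?eE//.
  - move=> x jx /=; rewrite -hh2//.
    have -> : (pos h + shiftv a == x) = false; last by [].
    by apply: contraTF jx => /eqP <-; rewrite -ltNge.
  - by rewrite mulSn in nm; lia.
  - by apply.
have hj' : ht (extend h a) = j by have := ht_extend_le h a; lia.
(* The excursion ends at [y + e_1]: the waiting walk is led to [y] inside its level, and then one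
   step to the right. *)
set y := pos (extend h a) - shiftv (right_dir Y).
have hy : ht h2 = height y.
  by rewrite /y heightD heightN height_shiftv dot_ell_right [height _]hj'.
have [s [sw ps sS _ sc]] := vertical_walk hy.
set h3 := walk h2 (s ++ [:: right_dir Y]).
have ls : (size (s ++ [:: right_dir Y]) <= w)%N by rewrite size_cat addn1.
have h3V : kappa ^+ w * V T g (m - size (s ++ [:: right_dir Y])) h3 <= V T g m h2.
  apply: (@le_trans _ _ (V T g (size (s ++ [:: right_dir Y]) +
      (m - size (s ++ [:: right_dir Y]))) h2)); last first.
    by rewrite subnKC// (leq_trans ls)// (leq_trans _ nm)// mulSn leq_addr.
  apply: le_trans (value_path_ge kappa_gt0 c_adm _ _ _).
  - rewrite ler_wpM2r// ler_wiXn2l ?(ltW kappa_gt0)//.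
    exact/ltW/(kappa_lt1 kappa_gt0 c_adm).
  - by move=> ?; rewrite /g ler0n.
  - rewrite avoids_cat sS /= /T /exits; first by rewrite /ht ps -hy; lia.
    by move=> h' ->; lia.
have [| | |||+ _] := IHn (m - size (s ++ [:: right_dir Y]))%N (extend h a) h3.
- by [].
- exact: walk_neq0.
- move=> x jx; rewrite /h3 walk_cat /= ps subrK hh2// sc//.
  by apply: contraTneq jx => ->; lia.
- by rewrite mulSn in nm; move: ls; lia.
- by rewrite eE.
rewrite eE /h3 walk_cat /= ps subrK hj' => /(_ erefl (lexx _)) /le_trans; apply.
rewrite exprSr -mulrA ler_wpM2l ?exprn_ge0// /C ler_pdivlMl// .
by move: h3V; rewrite /h3 walk_cat.
Qed.

(** When the walk first visits level [j], at [x] say, it looks from [j] upwards like a walk started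
    at [x - e_1] whose first step is to the right. The sum removes the dependence on the random [x].
    The start on level [j - 1] leaves room for the forced paths and produces escape probabilities
    from that level, for one more factor [C]. *)
Lemma few_entries n : 0 <= j ->
  V S f n [:: 0] <= C ^+ N.+1 * \sum_(x <- level Y j)
    V T g (n * w).+1 [:: x - shiftv (right_dir Y)].
Proof.
move=> j0; set G := _ * _.
rewrite -[G](value_cst c_adm (fun h => j <= ht h) G n [:: 0]).
pose I h := [/\ h != [::], {in behead h, forall x, height x < j}, ht h <= j
  & entries j h = 0%N].
apply: (value_tower kappa_gt0 c_adm (I := I)).
- move=> h a [h0 hb hj he]; rewrite -ltNge => {}hj; split => //.
  + case: h h0 hb hj {he} => //= x h _ hb xj y; rewrite inE => /orP[/eqP->//|].
    exact: hb.
  + by have := ht_extend_le h a; lia.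
  + by rewrite entries_extend_low.
- by move=> h _ kh; apply: le_trans (ltW jk) kh.
- move=> h m [h0 hb hj he] jh mn.
  have {jh}hj : ht h = j by lia.
  set y := pos h - shiftv (right_dir Y).
  have [| | |||+ _] := @comparison m (n * w) h (extend [:: y] (right_dir Y)).
  + by [].
  + by [].
  + move=> x jx; case: h h0 hb hj {he} @y => //= z h _ hb hz.
    rewrite subrK addn0; congr (_ + _)%N.
    have -> : count_mem x h = 0%N by apply/count_memPn/negP => /hb; lia.
    case: eqVneq jx => // <-; rewrite heightD heightN height_shiftv.
    by rewrite dot_ell_right; have : height z = j := hz; lia.
  + by rewrite leq_mul2r mn orbT.
  + by rewrite he.
  have pE : pos h = pos (extend [:: y] (right_dir Y)) by rewrite /= subrK.
  rewrite he subn0 hj => /(_ pE (lexx _)) /le_trans; apply; rewrite /G exprSr -mulrA ler_wpM2l ?exprn_ge0//.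
  have yl : pos h \in level Y j by rewrite mem_level -hj.
  rewrite (bigD1_seq _ yl (level_uniq _ _)) mulrDr -[leLHS]addr0.
  rewrite lerD//; last by rewrite mulr_ge0// sumr_ge0// => x _; apply: Vg_ge0.
  rewrite -/y /C ler_pdivlMl//.
  have := value_path_ge kappa_gt0 c_adm (S := T) (f := g) (n * w) (h := [:: y])
    (s := [:: right_dir Y]).
  rewrite [size _]/= expr1 add1n => H; apply: le_trans (H _ _).
  + by rewrite ler_wpM2r// -[leRHS]expr1 ler_wiXn2l ?(ltW kappa_gt0)// ltW
      ?(kappa_lt1 kappa_gt0 c_adm).
  + by move=> ?; rewrite /g ler0n.
  + rewrite /= andbT /T /exits /ht /= heightD heightN height_shiftv dot_ell_right.
    by rewrite [height _]hj; lia.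
- move=> h [h0 hb hj he] jh; rewrite /f [k <= _]leNgt (lt_trans _ jk) ?ltNge//=.
  rewrite mulr_ge0 ?exprn_ge0// sumr_ge0// => x _; exact: Vg_ge0.
- by split; rewrite // /ht /= height0.
Qed.
End comparison.

(** * Drift consumed at a level, and falls *)

Section level_drifts.
Variables (R : realType) (Y : state_space).
Implicit Types (h : seq (site Y)) (a : dir Y) (n m r : nat) (k b : int).
Variables (kappa : R) (c : site Y -> dir Y -> nat -> R).
Hypotheses (kappa_gt0 : 0 < kappa) (c_adm : admissible kappa c).
Local Notation V := (value c).

Definition above k h := k <= ht h.
Definition beneath k h := ht h < k.

Lemma aboveN k h : ~~ above k h = beneath k h.
Proof. by rewrite /above /beneath -ltNge. Qed.

Definition on_level (j : int) : pred (site Y) := fun x => height x == j.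

Definition level_drift j (I : nat) : R :=
  \sum_(x <- level Y j) \sum_(0 <= i < I) drift c x i.

Definition no_return k n (y : site Y) : R :=
  V (beneath k) (fun h => (above k h)%:R) n [:: y].

(** Up to the exit the height is at least -1, so [1 + ht] is nonnegative, and it is at least [k.+1]
    on escape. Its mean is 1 plus the drift consumed, all of it at levels 0, ..., [k - 1]. *)
Lemma escape_consumed (k : nat) n :
  k.+1%:R * V (exits (-1) k%:Z) (fun h => (above k%:Z h)%:R) n [:: 0] <=
  1 + \sum_(0 <= j < k) V (exits (-1) k%:Z) (consumed c (on_level j%:Z)) n [:: 0].
Proof.
set S := exits _ _; rewrite -(valueZ c) -(value_sum c_adm).
pose I h := [/\ h != [::], {in behead h, forall x, 0 <= height x < k%:Z} & -1 <= ht h].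
have I0 : I [:: 0] by split; rewrite // /ht /= height0.
have IS h a : I h -> ~~ S h -> I (extend h a).
  move=> [h0 hb h1]; rewrite /S /exits => hS; split => //.
    case: h h0 hb h1 hS => //= x h _ hb; rewrite /ht /= => h1 hS y.
    by rewrite inE => /orP[/eqP->|/hb//]; lia.
  by have := ht_extend_ge h a; lia.
apply: (@le_trans _ _ (V S (fun h => 1 + (ht h)%:~R) n [:: 0])).
  apply: (value_le kappa_gt0 c_adm (I := I)) => // h [_ _ h1].
  rewrite /above; case: (leP k%:Z (ht h)) => kh; rewrite ?mulr1 ?mulr0.
    by rewrite -natr1 addrC lerD2l -[k%:R]/(k%:Z%:~R) ler_int.
  by rewrite -[1]/(1%:~R) -intrD ler0z; lia.
rewrite valueD (value_cst c_adm) lerD2l (value_height c_adm)//.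
rewrite [consumed _ _ [:: 0]]/consumed subr0 {1}/ht height0 mulr0z add0r.

apply: (value_le kappa_gt0 c_adm (I := I)) => // h [_ hb _].
rewrite drift_sum_levels; apply: (drift_sum_le c_adm) => x xh _.
exact: hb.
Qed.

Lemma drift_sum_low j h : {in h, forall x, height x < j} ->
  drift_sum c (on_level j) h = 0.
Proof.
elim: h => //= x h IH hb; rewrite IH ?add0r => [|z zh]; last first.
  by apply: hb; rewrite inE zh orbT.
by have := hb x (mem_head _ _); rewrite /on_level; case: eqP => [->|_ _];
  rewrite ?ltxx// mul0r.
Qed.

Lemma drift_le_level x I : (0 < I)%N ->
  drift c x 0 <= level_drift (height x) I.
Proof.
move=> I0; rewrite /level_drift (bigD1_seq x)/= ?mem_level ?level_uniq//.
case: I I0 => // I _; rewrite big_nat_recl//= -addrA lerDl addr_ge0//.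
  by rewrite sumr_ge0// => ? _; apply: (drift_ge0 c_adm).
by do 2!rewrite sumr_ge0// => ? _; apply: (drift_ge0 c_adm).
Qed.

Lemma drift_sum_level_le j h (I : nat) : (size h <= I)%N ->
  drift_sum c (on_level j) h <= level_drift j I.
Proof.
move=> hI; rewrite drift_sum_level; apply: ler_sum => x _.
have cI : (count_mem x h <= I)%N by apply: leq_trans (count_size _ _) hI.
rewrite [leRHS](big_cat_nat (leq0n _) cI)//= lerDl sumr_ge0// => i _; exact: (drift_ge0 c_adm).
Qed.

Lemma no_returnE k n h : above k h -> agree k h [:: pos h] ->
  V (beneath k) (fun h => (beneath k h)%:R) n h = 1 - no_return k n (pos h).
Proof.
move=> kh ag; rewrite /no_return.
have -> : V (beneath k) (fun h => (beneath k h)%:R) n h =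
    V (beneath k) (fun h => (beneath k h)%:R) n [:: pos h].
  apply: (@value_agree _ _ _ k) => //; last by move=> h1; rewrite /beneath -leNgt.
  by move=> h1 h2 [_ _ p12 _]; rewrite /beneath /ht p12.
rewrite -[X in X - _](value_cst c_adm (beneath k) 1 n [:: pos h]) -valueB; apply: value_eq => h'.
by rewrite -aboveN; case: above; rewrite ?subrr ?subr0.
Qed.

Lemma no_return_ge0 k n y : 0 <= no_return k n y.
Proof. exact: (value_bool_ge0 kappa_gt0 c_adm). Qed.

Lemma no_return_le1 k n y : no_return k n y <= 1.
Proof. exact: (value_bool_le1 kappa_gt0 c_adm). Qed.

Lemma no_return_horizon k n m y : height y = k -> (n <= m)%N ->
  no_return k m y <= no_return k n y.
Proof.
move=> yk nm.
have ag : agree k [:: y] [:: pos [:: y]] by split.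
have ky : above k [:: y] by rewrite /above /ht /= yk.
rewrite -[X in no_return k m X]/(pos [:: y]) -[X in no_return k n X]/(pos [:: y]).
rewrite -lerN2 -(lerD2l 1) -!no_returnE//.
by apply: (value_horizon kappa_gt0 c_adm) => // h /negbTE->.
Qed.

(* With probability at least [kappa * no_return] the walk leaves level [j] for
   ever right after its first step there, and then consumes at this level only
   the drift of the first cookie of the site where it arrived. *)
Lemma level_consumed j k n m (I : nat) h : 0 <= j -> j < k ->
  h != [::] -> {in behead h, forall x, height x < j} -> ht h = j ->
  (size h + n <= I)%N -> (n <= m)%N ->
  V (exits (-1) k) (consumed c (on_level j)) n h <=
  level_drift j I - kappa * no_return (j + 1) m (pos h + shiftv (right_dir Y)) *
    (level_drift j I - drift c (pos h) 0).
Proof.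
move=> j0 jk h0 hb hj hI nm; set y := pos h + _; set D := level_drift j I.
set d := drift c (pos h) 0; set q := no_return _ _ _.
have I0 : (0 < I)%N by case: h {hb hj y d q} h0 hI; case: I D.
have dD : d <= D by rewrite /d /D -hj; apply: drift_le_level.
have d0 : 0 <= d by apply: (drift_ge0 c_adm).
have k1 : kappa <= 1 by apply/ltW/(kappa_lt1 kappa_gt0 c_adm).
have q0 : 0 <= q by apply: no_return_ge0.
have q1 : q <= 1 by apply: no_return_le1.
have yj : height y = j + 1 by rewrite heightD height_shiftv dot_ell_right [height _]hj.
have cs0 : consumed c (on_level j) h = 0.
  exact: drift_sum_low.
have pr0 : prior h = 0%N.
  by apply/count_memPn/negP => /hb; rewrite -/(ht h) hj ltxx.
have hE : h = pos h :: behead h by case: h h0 {hb hj hI y d q d0 dD q0 q1 yj cs0 pr0}.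
have csh : drift_sum c (on_level j) h = d.
  rewrite hE /= [drift_sum _ _ _]cs0 add0r [count_mem _ _]pr0.
  by rewrite /on_level [height _]hj eqxx mul1r.
have new x : j + 1 <= height x -> count_mem x h = 0%N.
  move=> jx; apply/count_memPn; rewrite hE inE negb_or; apply/andP; split.
    by apply: contraTneq jx => ->; rewrite [height _]hj; lia.
  by apply/negP => /hb; lia.
have consumed_le n' h' : (size h' + n' <= I)%N ->
    V (exits (-1) k) (consumed c (on_level j)) n' h' <= D.
  move=> hI'; rewrite -[D](value_cst c_adm (exits (-1) k) D n' h').
  apply: (value_tower_sized kappa_gt0 c_adm (I := fun=> True)) => // g.
    move=> m' _ Sg _ e; rewrite value_stop//; apply: drift_sum_level_le.
    by rewrite size_behead (leq_trans _ hI')// -e (leq_trans (leq_pred _))// leq_addr.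
  move=> _ _ e; apply: drift_sum_level_le.
  by rewrite size_behead (leq_trans _ hI')// -e leq_pred.
have kq1 : kappa * q <= 1 by rewrite mulr_ile1// ltW.
case: n hI nm => [|n] hI nm.
  rewrite /= cs0 subr_ge0 -[leRHS]mul1r ler_pM ?mulr_ge0// ?subr_ge0 ?(ltW kappa_gt0)//.
  by rewrite lerBlDr lerDl.
have Sh : exits (-1) k h = false by rewrite /exits hj; apply/negbTE; lia.
rewrite /= Sh (bigD1 (right_dir Y))//=.
set hr := extend h _.
(* Every other first step is charged the full drift [D] of the level. *)
suff Vr : V (exits (-1) k) (consumed c (on_level j)) n hr <= D - q * (D - d).
  set cr := c _ _ _.
  have cr0 : 0 <= cr by apply: (adm_ge0 kappa_gt0 c_adm).
  have kcr : kappa <= cr by apply: (adm_ge c_adm).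
  apply: (@le_trans _ _ (cr * (D - q * (D - d)) +
     \sum_(a | a != right_dir Y) c (pos h) a (prior h) * D)).
    rewrite lerD ?ler_wpM2l//.
    apply: ler_sum => a _; rewrite ler_wpM2l ?(adm_ge0 kappa_gt0 c_adm)//.
    by apply: consumed_le; rewrite /= addSnnS.
  have : \sum_a c (pos h) a (prior h) * D = D.
    by rewrite -mulr_suml (adm_sum c_adm) mul1r.
  rewrite (bigD1 (right_dir Y))//= -/cr => E.
  rewrite mulrBr -addrA [- _ + _]addrC addrA E lerB//.
  by rewrite mulrA ler_wpM2r ?subr_ge0// ler_wpM2r.
(* After the step to the right the walk is stopped on its return to level [j] or at [k]; only in the
   former case can more than [d] be consumed. *)
pose E h := exits j k h.
apply: (@le_trans _ _ (V E (fun h => d + (D - d) * (E h && beneath (j + 1) h)%:R) n hr)).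
  apply: (value_tower_sized kappa_gt0 c_adm
    (I := fun h => h != [::] /\ drift_sum c (on_level j) (behead h) = d)).
  - move=> g a [g0 dg]; rewrite /E /exits negb_or => /andP[jg _]; split => //=.
    case: g g0 dg jg => //= x g _ ->; rewrite /on_level => jx.
    suff /negbTE-> : height x != j by rewrite mul0r addr0.
    by apply: contraNneq jx => xj; rewrite /ht /= xj.
  - move=> g _; rewrite /E /exits => /orP[gn|->]; last by rewrite orbT.
    by rewrite (le_trans gn)//; lia.
  - move=> g m' [g0 dg] Eg mn e.
    rewrite /beneath ltzD1 Eg /=; case: (leP (ht g) j) => gj.
      rewrite mulr1 addrCA subrr addr0; apply: consumed_le.
      by rewrite e /= addSnnS.
    rewrite mulr0 addr0 value_stop ?/consumed ?dg//.
    by move: Eg; rewrite /E /exits leNgt gj /= => ->; rewrite orbT.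
  - by move=> g [g0 dg] /negbTE-> _; rewrite mulr0 addr0 /consumed dg.
  - by split.
rewrite valueD (value_cst c_adm) valueZ.
have -> : D - q * (D - d) = d + (D - d) * (1 - q) by ring.
rewrite lerD2l ler_wpM2l ?subr_ge0//.
apply: le_trans (value_hit_le kappa_gt0 c_adm _ _ _ (fun _ => id)) _.
rewrite no_returnE.
- by rewrite lerD2l lerN2 no_return_horizon// ltnW.
- by rewrite /above /ht /= -/y yj.
- by split => // x jx; rewrite /= new.
Qed.
End level_drifts.

(** * Total drift from below, and falls from high levels *)

Section deep_falls.
Variables (R : realType) (Y : state_space).
Implicit Types (h : seq (site Y)) (a : dir Y) (n m r : nat) (k b : int).
Variables (kappa : R) (c : site Y -> dir Y -> nat -> R).
Hypotheses (kappa_gt0 : 0 < kappa) (c_adm : admissible kappa c).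
Local Notation V := (value c).

Lemma level_drift_le j (I : nat) : level_drift c j I <= (width Y * I)%:R.
Proof.
have le1 x i : drift c x i <= 1.
  apply: le_trans (drift_le kappa_gt0 c_adm x i) _.
  by rewrite lerBlDr lerDl mulrn_wge0// ltW.
rewrite -(size_level Y j) /level_drift.
elim: level => [|x s IH]; first by rewrite big_nil.
rewrite big_cons /= mulSn natrD lerD// -[in leRHS](subn0 I).
by rewrite -sumr_const_nat; apply: ler_sum.
Qed.

(** The first [I] cookies of level [j] are all used unless [k] is not reached, level [j] is crossed
    at most [N] times, or one of its sites has fewer than [I] visits in spite of more crossings. In
    these cases the crude bound [width Y * I] is given up. The total drift consumed is the mean
    height, at most [k]. *)
Lemma consumed_lower (k m N I n : nat) :
  \sum_(0 <= j < k - m) (level_drift c j%:Z I - (width Y * I)%:R *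
    (V (above k%:Z) (fun h => (beneath k%:Z h)%:R) n [:: 0] +
     V (above k%:Z) (fun h => (above k%:Z h && (entries j%:Z h <= N)%N)%:R) n [:: 0] +
     \sum_(x <- level Y j%:Z) V (above k%:Z) (fun h =>
        ((N < entries (height x) h) && (count_mem x h < I))%N%:R) n [:: 0]))
  <= k%:R.
Proof.
set S := above k%:Z.
pose J h := h != [::] /\ ht h <= k%:Z.
have J0 : J [:: 0] by split; rewrite // /ht /= height0.
have JS h a : J h -> ~~ S h -> J (extend h a).
  move=> [h0 hk]; rewrite aboveN /beneath => hS; split => //.
  by have := ht_extend_le h a; lia.
apply: (@le_trans _ _ (\sum_(0 <= j < k - m)
    V S (consumed c (on_level j%:Z)) n [:: 0])).
  rewrite !big_nat; apply: ler_sum => j /andP[_ jk].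
  set D := level_drift _ _ _; set M := (_ * _)%:R.
  rewrite -(value_sum c_adm) -!valueD -valueZ.
  rewrite -[X in X - _](value_cst c_adm S D n [:: 0]) -valueB.
  apply: (value_le kappa_gt0 c_adm (I := J)) => // h [h0 hk].
  have DM : D <= M by apply: level_drift_le.
  have c0 : 0 <= consumed c (on_level j%:Z) h by apply: (drift_sum_ge0 c_adm).
  have M0 : 0 <= M by rewrite ler0n.
  set X := \sum_(x <- _) _.
  have X0 : 0 <= X by rewrite sumr_ge0.
  have bad (t : R) : 1 <= t -> D - M * t <= consumed c (on_level j%:Z) h.
    move=> t1; apply: le_trans c0; rewrite subr_le0 (le_trans DM)//.
    by rewrite ler_peMr.
  case: (boolP (S h)) => Sh; last first.
    by apply: bad; rewrite -[beneath _ _]aboveN Sh -addrA /= mulr1n lerDl addr_ge0.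
  case: (leqP (entries j%:Z h) N) => hN.
    by apply: bad; rewrite /= addrAC addrC mulr1n lerDl addr_ge0.
  case: (boolP (all (fun x => I <= count_mem x h)%N (level Y j%:Z))) => [/allP hI|].
    rewrite (@le_trans _ _ D)//; first by rewrite gerBl mulr_ge0// !addr_ge0.
    rewrite /consumed drift_sum_level /D /level_drift big_seq [leRHS]big_seq.
    apply: ler_sum => x xl; have := hI x xl; have := xl; rewrite mem_level => /eqP xj.
    case: h h0 hk Sh {c0 X X0 bad hN hI} => // y h _ _ Sh /=.
    have -> : (y == x) = false.
      by apply: contraTF Sh => /eqP->; rewrite aboveN /beneath /ht /= xj; lia.
    rewrite add0n => cI; rewrite [leRHS](big_cat_nat (leq0n _) cI)//= lerDl.
    by rewrite sumr_ge0// => i _; exact: (drift_ge0 c_adm).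
  case/allPn => x xl; rewrite -ltnNge => xI; apply: bad.
  rewrite -[1]add0r lerD ?addr_ge0// /X (bigD1_seq x)//= ?level_uniq//.
  have := xl; rewrite mem_level => /eqP->; rewrite hN xI.
  by rewrite lerDl sumr_ge0.
rewrite -(value_sum c_adm).
have V_ht : V S (consumed c predT) n [:: 0] = V S (fun h => (ht h)%:~R) n [:: 0].
  by rewrite (value_height c_adm)// [X in _ - X]/consumed subr0 /ht height0 add0r.
apply: (@le_trans _ _ (V S (consumed c predT) n [:: 0])).
  apply: (value_mono kappa_gt0 c_adm) => h.
  by rewrite drift_sum_levels (drift_sum_le c_adm).
rewrite V_ht -[leRHS](value_cst c_adm S k%:R n [:: 0]).
apply: (value_le kappa_gt0 c_adm (I := J)) => // h [_ hk].
by rewrite -[k%:R]/(k%:Z%:~R) ler_int.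
Qed.

Definition falls k r m h := beneath k h && has (fun x => k + (r * m)%:Z <= height x) h.

Definition fall_value k r m n h := V (falls k r m) (fun h => (falls k r m h)%:R) n h.

(** The walk must climb [m] levels without going below [k] before its fall counts. Only cookies at
    levels from [k] on matter, hence the independence from the past below [k]. *)
Definition late_fall k m n (y : site Y) : R :=
  V (exits (k - 1) (k + m%:Z)) (fun h => (above (k + m%:Z) h)%:R *
    V (beneath k) (fun h => (beneath k h)%:R) n h) n [:: y].

Lemma fresh_agree k h : h != [::] -> {in behead h, forall x, height x < k} ->
  agree k h [:: pos h].
Proof.
case: h => //= x h _ hb; split => // y ky; rewrite /= addn0.
by have -> : count_mem y h = 0%N; [apply/count_memPn/negP => /hb; lia|rewrite addn0].
Qed.

Lemma entries_fresh k h : {in behead h, forall x, height x < k} ->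
  entries k h = 0%N.
Proof.
case: h => //= x h; elim: h x => [//|y h IH] x hb.
rewrite [entries _ _]/= IH => [|z zh]; last by apply: hb; rewrite inE zh orbT.
by rewrite /ht /= [k <= _]leNgt (hb y (mem_head _ _)) andbF.
Qed.

(** Before falling from [r.+1] blocks above [k], the walk passes level [k + m]. If it has been below
    [k] between its arrival at [k] and that moment, the rest still contains a fall below [k + m]
    from [r] blocks above. If not, the fall is a late one. *)
Lemma fall_split k r m n h : (0 < m)%N ->
  h != [::] -> {in behead h, forall x, height x < k} -> ht h = k ->
  fall_value k r.+1 m n h <=
  V (above (k + m%:Z)) (fun h => (above (k + m%:Z) h && (0 < entries k h)%N)%:R *
     fall_value (k + m%:Z) r m n h) n h + late_fall k m n (pos h).
Proof.
move=> m0 h0 hb hk; set S := above _.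
have e0 : entries k h = 0%N by exact: entries_fresh.
have F0 k' r' h' : 0 <= fall_value k' r' m n h'.
  exact: (value_bool_ge0 kappa_gt0 c_adm).
have kSm : k + (r.+1 * m)%N%:Z = k + m%:Z + (r * m)%N%:Z.
  by rewrite mulSn PoszD addrA.
apply: (@le_trans _ _ (V S (fun h =>
   (S h && (0 < entries k h)%N)%:R * fall_value (k + m%:Z) r m n h +
   (S h && (entries k h == 0)%N)%:R * fall_value k r.+1 m n h) n h)).
  pose I h := h != [::] :> seq (site Y) /\ {in behead h, forall x, height x < k + m%:Z}.
  have noF h' : I h' -> falls k r.+1 m h' -> S h'.
    move=> [h'0 h'b] /andP[_ /hasP[x xh xk]].
    case: h' h'0 h'b xh => //= y h' _ h'b; rewrite inE => /orP[/eqP <-|/h'b].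
      by rewrite /S /above /ht /= (le_trans _ xk)// kSm lerDl.
    by rewrite ltNge (le_trans _ xk)// kSm lerDl.
  apply: (value_tower kappa_gt0 c_adm (I := I)).
  - move=> h' a [h'0 h'b]; rewrite aboveN /beneath => h'k; split => //.
    case: h' h'0 h'b h'k => //= y h' _ h'b yk z; rewrite inE => /orP[/eqP->//|].
    exact: h'b.
  - exact: noF.
  - move=> h' n' Ih' Sh' nn; rewrite Sh' /=.
    have mono : V (falls k r.+1 m) (fun h => (falls k r.+1 m h)%:R) n' h' <=
        fall_value k r.+1 m n h'.
      by apply: (value_horizon kappa_gt0 c_adm) => // h1 /negbTE->.
    case: posnP => e; rewrite ?mul0r ?add0r ?addr0 mul1r//.
    apply: le_trans mono _; apply: (value_hit_mono kappa_gt0 c_adm) => h1.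
    rewrite /falls kSm => /andP[h1k ->]; rewrite andbT.
    by move: h1k; rewrite /beneath; lia.
  - move=> h' Ih' Sh'; rewrite (_ : falls _ _ _ h' = false) ?addr_ge0 ?mulr_ge0//.
    by apply: contraNF Sh'; apply: noF.
  - by split => // x xh; have := hb x xh; lia.
rewrite valueD lerD2l.
pose E := @exits Y (k - 1) (k + m%:Z).
have km : 0 < m%:Z :> int by [].
rewrite /late_fall -(value_agree (k := k) c (S := E) (f := fun h =>
    (above (k + m%:Z) h)%:R * V (beneath k) (fun h => (beneath k h)%:R) n h)
    n _ _ (fresh_agree h0 hb)).
- apply: (value_tower kappa_gt0 c_adm (I := fun h => [/\ h != [::],
     k <= ht h -> entries k h = 0%N & ht h < k -> (0 < entries k h)%N])).
  + move=> h' a [h'0 h1 h2]; rewrite /E /exits negb_or -!ltNge => /andP[h3 h4].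
    have kh : k <= ht h' by lia.
    split => // h5; first by rewrite entries_extend_high// h1.
    by rewrite entries_extend// h5 kh addn1.
  + by move=> h' _ Sh; rewrite /E /exits [X in _ || X]Sh orbT.
  + move=> h' n' [h'0 h1 h2] Eh' _; case: (leP k (ht h')) => kh.
      have Sh' : S h'.
        by move: Eh'; rewrite /E /exits => /orP[|//]; lia.
      rewrite value_stop// -/S Sh' h1// !mul1r.
      by apply: (value_hit_mono kappa_gt0 c_adm) => h6 /andP[].
    rewrite (@value_eq0 _ _ _ _ kappa_gt0 c_adm (fun h => (0 < entries k h)%N)).
    * by rewrite mulr_ge0// (value_bool_ge0 kappa_gt0 c_adm).
    * by move=> h6 a e6 _; apply: leq_trans e6 (leq_entries _ _ _).
    * by move=> h6 e6; rewrite eqn0Ngt e6 andbF mul0r.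
    * exact: h2.
  + move=> h' _; rewrite /E /exits negb_or => /andP[_ /negbTE Sh'].
    by rewrite /S /above Sh' !mul0r.
  + by split; rewrite // hk ltxx.
- move=> h1 h2 h12; have [_ _ p12 _] := h12.
  have -> : E h1 = exits (k - 1) (k + m%:Z) h2 by rewrite /E /exits /ht p12.
  split => //; rewrite /above /ht p12; congr (_ * _).
  apply: (@value_agree _ _ _ k _ _ _ _ _ _ _ _ _ h12) => [h3 h4 [_ _ p34 _]|h3].
    by rewrite /beneath /ht p34.
  by rewrite /beneath -leNgt.
- by move=> h1; rewrite /E /exits; lia.
Qed.

Definition escape k hi n (y : site Y) : R :=
  V (exits (k - 1) hi) (fun h => (hi <= ht h)%R%:R) n [:: y].

(** Heights change by at most one per step, so reaching [K] takes at least [n1] steps, during which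
    the walk has not been below [k]. *)
Lemma escape_no_return k (K : int) n1 n2 h : k <= K -> ht h + n1%:Z <= K ->
  V (exits (k - 1) K) (fun h => (K <= ht h)%R%:R) n2 h <=
  V (beneath k) (fun h => (above k h)%:R) n1 h.
Proof.
move=> kK; elim: n1 n2 h => [|n1 IH] n2 h hK.
  rewrite /= /above; case: (leP k (ht h)) => kh.
    exact: (value_bool_le1 kappa_gt0 c_adm).
  rewrite value_stop; last by rewrite /exits; lia.
  by rewrite [K <= _]leNgt (lt_le_trans kh)//; lia.
case: (leP k (ht h)) => kh; last first.
  rewrite !value_stop; last by rewrite /exits; lia.
    by rewrite [K <= _]leNgt (lt_le_trans kh)//; lia.
  exact: kh.
rewrite [leRHS]/= /beneath ltNge kh /=.
have hE : exits (k - 1) K h = false by rewrite /exits; apply/negbTE; lia.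
case: n2 => [|n2] /=.
  rewrite [K <= _]leNgt (_ : ht h < K) ?sumr_ge0//; last by lia.
  by move=> a _; rewrite mulr_ge0 ?(adm_ge0 kappa_gt0 c_adm)//
    (value_bool_ge0 kappa_gt0 c_adm).
rewrite hE; apply: ler_sum => a _; rewrite ler_wpM2l ?(adm_ge0 kappa_gt0 c_adm)//.
by apply: IH; have := ht_extend_le h a; lia.
Qed.

(** A walk that goes on from [k + m] to the far level [K] before going below [k] has not fallen
    within [n] steps. Late falls are thus controlled by the difference of two escape
    probabilities. *)
Lemma late_fall_le k m n n' (K : int) y : height y = k -> (n <= n')%N ->
  k + m%:Z + n%:Z <= K ->
  late_fall k m n y <= escape k (k + m%:Z) n' y - escape k K n' y.
Proof.
move=> yk nn kK; set E := @exits Y (k - 1) (k + m%:Z).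
pose q h := V (beneath k) (fun h => (above k h)%:R) n h.
have qE h : V (beneath k) (fun h => (beneath k h)%:R) n h = 1 - q h.
  rewrite -[X in X - _](value_cst c_adm (beneath k) 1 n h) -valueB.
  by apply: value_eq => h'; rewrite -aboveN; case: above; rewrite ?subrr ?subr0.
have q0 h : 0 <= q h by apply: (value_bool_ge0 kappa_gt0 c_adm).
have q1 h : q h <= 1 by apply: (value_bool_le1 kappa_gt0 c_adm).
apply: (@le_trans _ _ (V E (fun h => (above (k + m%:Z) h)%:R -
    (above (k + m%:Z) h)%:R * q h) n' [:: y])).
  rewrite /late_fall; under value_eq do rewrite qE mulrBr mulr1.
  apply: (value_horizon kappa_gt0 c_adm) => // h.
    by rewrite -[X in X - _]mulr1 -mulrBr mulr_ge0// subr_ge0.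
  by rewrite /E /exits negb_or => /andP[_ /negbTE hk]; rewrite /above hk mul0r subrr.
rewrite valueB lerD2l lerN2.
apply: (value_tower kappa_gt0 c_adm (I := fun h => ht h <= k + m%:Z)).
- move=> h a hk; rewrite /E /exits; have := ht_extend_le h a; lia.
- by move=> h _; rewrite /E /exits; lia.
- move=> h n1 hk; rewrite /E /exits /above => /orP[hl|hh] _.
    rewrite value_stop; last by rewrite /exits hl.
    rewrite [K <= _]leNgt (_ : ht h < K) ?mulr_ge0//; lia.
  by rewrite hh mul1r; apply: escape_no_return; lia.
- move=> h hk; rewrite /E /exits => hE.
  by rewrite [K <= _]leNgt (_ : ht h < K) ?mulr_ge0//; lia.
- by rewrite /ht /= yk; lia.
Qed.

(** Going below [k] before [k + m] is the complement of escape; the past is irrelevant because the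
    walk has just arrived at [k] for the first time. *)
Lemma early_fall_le k m n n' h : (0 < m)%N -> (n <= n')%N ->
  h != [::] -> {in behead h, forall x, height x < k} -> ht h = k ->
  V (above (k + m%:Z)) (fun h => (above (k + m%:Z) h && (0 < entries k h)%N)%:R) n h
  <= 1 - escape k (k + m%:Z) n' (pos h).
Proof.
move=> m0 nn h0 hb hk; set E := @exits Y (k - 1) (k + m%:Z).
have km : 0 < m%:Z :> int by [].
apply: (@le_trans _ _ (V E (fun h => (beneath k h)%:R) n h)).
  apply: (value_tower kappa_gt0 c_adm (I := fun h => h != [::] /\
     (k <= ht h -> entries k h = 0%N))).
  - move=> h' a [h'0 h1]; rewrite /E /exits negb_or -!ltNge => /andP[h3 h4].
    by split => // h5; rewrite entries_extend_high// h1//; lia.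
  - by move=> h' _; rewrite /E /exits /above => ->; rewrite orbT.
  - move=> h' n1 [h'0 h1] Eh' _; rewrite /beneath; case: (ltP (ht h') k) => kh.
      exact: (value_bool_le1 kappa_gt0 c_adm).
    rewrite value_stop ?h1 ?andbF//.
    by move: Eh'; rewrite /E /exits /above => /orP[|//]; lia.
  - by move=> h' _; rewrite /E /exits negb_or /above => /andP[_ /negbTE->].
  - by split => // _; exact: entries_fresh.
rewrite lerBrDr; set x := [:: pos h].
have -> : V E (fun h => (beneath k h)%:R) n h = V E (fun h => (beneath k h)%:R) n x.
  apply: (@value_agree _ _ _ k _ _ _ _ _ _ _ _ _ (fresh_agree h0 hb)).
    by move=> h1 h2 [_ _ p12 _]; rewrite /E /exits /beneath /ht p12.
  by move=> h1; rewrite /E /exits; lia.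
apply: (@le_trans _ _ (V E (fun h => (beneath k h)%:R) n' x +
    escape k (k + m%:Z) n' (pos h))).
  rewrite lerD2r; apply: (value_horizon kappa_gt0 c_adm) => // h'.
  by rewrite /E /exits /beneath; case: ltP => //; lia.
rewrite -valueD -[leRHS](value_cst c_adm E 1 n' x).
apply: (value_mono kappa_gt0 c_adm) => h'; rewrite /beneath.
case: ltP => h1; first by rewrite [_ <= ht h']leNgt (_ : ht h' < _) ?addr0//; lia.
by rewrite add0r lern1 leq_b1.
Qed.

Lemma fall_start b r m n : 0 <= b ->
  fall_value b r m n [:: 0] <=
  V (above b) (fun h => (above b h)%:R * fall_value b r m n h) n [:: 0].
Proof.
move=> b0; pose I h := h != [::] :> seq (site Y) /\
  {in behead h, forall x, height x < b}.
have noF h' : I h' -> falls b r m h' -> above b h'.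
  move=> [h'0 h'b] /andP[_ /hasP[x xh xk]].
  case: h' h'0 h'b xh => //= y h' _ h'b; rewrite inE => /orP[/eqP <-|/h'b].
    by rewrite /above /ht /= (le_trans _ xk)// lerDl.
  by rewrite ltNge (le_trans _ xk)// lerDl.
apply: (value_tower kappa_gt0 c_adm (I := I)).
- move=> h' a [h'0 h'b]; rewrite aboveN /beneath => h'k; split => //.
  case: h' h'0 h'b h'k => //= y h' _ h'b yk z; rewrite inE => /orP[/eqP->//|].
  exact: h'b.
- exact: noF.
- move=> h n' Ih Sh nn; rewrite Sh mul1r.
  by apply: (value_horizon kappa_gt0 c_adm) => // h1 /negbTE->.
- move=> h' Ih' Sh'; rewrite (_ : falls _ _ _ h' = false) ?mulr_ge0//.
    exact: (value_bool_ge0 kappa_gt0 c_adm).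
  by apply: contraNF Sh'; apply: noF.
- by [].
Qed.

End deep_falls.

(** * Expectations of polynomials in the cookies *)

Section bounded_expectation.
Context d (T : measurableType d) (R : realType) (P : probability T R).
Implicit Types (f g : T -> R).

Definition bounded_measurable f :=
  measurable_fun setT f /\ exists M, forall w, `|f w| <= M.

Definition expect f : R := \int[P]_w f w.

Lemma bounded_measurable_integrable f : bounded_measurable f ->
  P.-integrable setT (EFin \o f).
Proof.
move=> [mf [M fM]]; apply: measurable_bounded_integrable => //.
  by rewrite (le_lt_trans (probability_le1 P measurableT))// ltry.
exists M; split; first exact: num_real.
by move=> M' MM' w _; apply: le_trans (fM w) (ltW MM').
Qed.

Lemma bm_cst r : bounded_measurable (fun=> r).
Proof. by split; [exact: measurable_cst|exists `|r|]. Qed.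

Lemma bmD f g : bounded_measurable f -> bounded_measurable g ->
  bounded_measurable (fun w => f w + g w).
Proof.
move=> [mf [M fM]] [mg [N gN]]; split; first exact: measurable_funD.
by exists (M + N) => w; rewrite (le_trans (ler_normD _ _))// lerD.
Qed.

Lemma bmM f g : bounded_measurable f -> bounded_measurable g ->
  bounded_measurable (fun w => f w * g w).
Proof.
move=> [mf [M fM]] [mg [N gN]]; split; first exact: measurable_funM.
by exists (M * N) => w; rewrite normrM ler_pM.
Qed.

Lemma bm_sum (I : Type) (r : seq I) (F : I -> T -> R) :
  (forall i, bounded_measurable (F i)) ->
  bounded_measurable (fun w => \sum_(i <- r) F i w).
Proof.
move=> bF; elim: r => [|i r IH].
  by under eq_fun do rewrite big_nil; exact: bm_cst.
by under eq_fun do rewrite big_cons; exact: bmD.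
Qed.

Lemma bm_prod (I : Type) (r : seq I) (Q : pred I) (F : I -> T -> R) :
  (forall i, bounded_measurable (F i)) ->
  bounded_measurable (fun w => \prod_(i <- r | Q i) F i w).
Proof.
move=> bF; elim: r => [|i r IH].
  by under eq_fun do rewrite big_nil; exact: bm_cst.
under eq_fun do rewrite big_cons.
by case: (Q i) => //; exact: bmM.
Qed.

Lemma bm_indic (A : set T) : measurable A -> bounded_measurable (\1_A).
Proof.
by move=> mA; split => //; exists 1 => w; rewrite indicE; case: (_ \in _);
  rewrite ?normr1 ?normr0.
Qed.

Lemma bm_ext f g : f =1 g -> bounded_measurable f -> bounded_measurable g.
Proof. by move=> /funext->. Qed.

Lemma expect_ext f g : f =1 g -> expect f = expect g.
Proof. by move=> /funext->. Qed.

Lemma expect_cst r : expect (fun=> r) = r.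
Proof.
rewrite /expect Rintegral_cst// -[RHS]mulr1; congr (_ * _).
by rewrite [X in fine X](_ : _ = 1%E)//; exact: probability_setT.
Qed.

Lemma expectD f g : bounded_measurable f -> bounded_measurable g ->
  expect (fun w => f w + g w) = expect f + expect g.
Proof. by move=> bf bg; apply: RintegralD => //; apply: bounded_measurable_integrable. Qed.

Lemma expectZ r f : bounded_measurable f ->
  expect (fun w => r * f w) = r * expect f.
Proof. by move=> bf; apply: RintegralZl => //; apply: bounded_measurable_integrable. Qed.

Lemma expectB f g : bounded_measurable f -> bounded_measurable g ->
  expect (fun w => f w - g w) = expect f - expect g.
Proof. by move=> bf bg; apply: RintegralB => //; apply: bounded_measurable_integrable. Qed.

Lemma expect_sum (I : Type) (r : seq I) (F : I -> T -> R) :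
  (forall i, bounded_measurable (F i)) ->
  expect (fun w => \sum_(i <- r) F i w) = \sum_(i <- r) expect (F i).
Proof.
move=> bF; elim: r => [|i r IH].
  by rewrite big_nil -[RHS](expect_cst 0); apply: expect_ext => w; rewrite big_nil.
rewrite big_cons -IH -expectD//; last exact: bm_sum.
by apply: expect_ext => w; rewrite big_cons.
Qed.

Lemma expect_le f g : bounded_measurable f -> bounded_measurable g ->
  (forall w, f w <= g w) -> expect f <= expect g.
Proof.
by move=> bf bg fg; apply: le_Rintegral => //; apply: bounded_measurable_integrable.
Qed.

Lemma expect_ge0 f : (forall w, 0 <= f w) -> 0 <= expect f.
Proof. by move=> f0; apply: Rintegral_ge0. Qed.

Lemma expect_indic (A : set T) : measurable A -> expect \1_A = fine (P A).
Proof. by move=> mA; rewrite /expect /Rintegral integral_indic// setIT. Qed.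

Lemma le_norm_expect f M : bounded_measurable f -> (forall w, `|f w| <= M) ->
  `|expect f| <= M.
Proof.
move=> bf fM; have fM' w : - M <= f w <= M by rewrite -ler_norml.
rewrite ler_norml -[X in X <= _]expect_cst -[X in _ && (_ <= X)]expect_cst.
apply/andP; split; apply: expect_le => //; try exact: bm_cst.
  by move=> w; case/andP: (fM' w).
by move=> w; case/andP: (fM' w).
Qed.

Lemma measurable_layer f t : measurable_fun setT f -> measurable [set w | t < f w].
Proof.
move=> mf; rewrite [X in measurable X](_ : _ = setT `&` f @^-1` `]t, +oo[).
  exact: mf.
by rewrite setTI; apply/seteqP; split => w /=; rewrite in_itv /= andbT.
Qed.

Lemma layer_indic f t w : \1_[set w | t < f w] w = (t < f w)%R%:R :> R.
Proof.
by rewrite indicE; congr (nat_of_bool _)%:R; apply/idP/idP; rewrite inE.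
Qed.

Lemma sum_layers_bounds (N : nat) (y : R) : 0 <= y <= N%:R ->
  y <= \sum_(0 <= i < N) (i%:R < y)%R%:R <= y + 1.
Proof.
elim: N => [|N IH] /andP[y0 yN].
  by rewrite big_geq//; apply/andP; split => //; rewrite addr_ge0.
rewrite big_nat_recr//=; have [Ny|yN'] := ltP N%:R y; last first.
  by rewrite addr0 IH// y0.
rewrite (_ : \sum_(0 <= i < N) _ = N%:R).
  by rewrite natr1 yN/= -natr1 lerD2r ltW.
rewrite (eq_big_nat _ _ (F2 := fun=> 1)) => [|i /andP[_ iN]].
  by rewrite sumr_const_nat subn0.
by rewrite (le_lt_trans _ Ny)// ler_nat ltnW.
Qed.

Lemma eq0_archi (x C : R) : (forall N : nat, `|x| <= C / N.+1%:R) -> x = 0.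
Proof.
move=> xC; apply/eqP; rewrite -normr_eq0; apply: contraT => x0.
have x1 : 0 < `|x| by rewrite lt_neqAle eq_sym x0 normr_ge0.
have C0 : 0 <= C by have := xC 0%N; rewrite divr1; apply: le_trans.
have := archi_boundP (divr_ge0 C0 (ltW x1)); set N := Num.bound _.
have := xC N; rewrite ler_pdivlMr// ltr_pdivrMr// => h1 h2.
have := lt_le_trans h2 (ler_wpM2r (ltW x1) (_ : N%:R <= N.+1%:R)).
by rewrite ler_nat leqnSn [X in _ < X]mulrC => /(_ isT); rewrite ltNge h1.
Qed.

(* Approximation of [f] by the step function counting the thresholds [i / N]
   that it exceeds. *)
Lemma expect_layers f g W Z : bounded_measurable f -> bounded_measurable g ->
  bounded_measurable W -> bounded_measurable Z ->
  (forall w, 0 <= f w <= 1) -> (forall w, 0 <= g w <= 1) ->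
  (forall t, expect (fun w => \1_[set w | t < f w] w * W w) =
             expect (fun w => \1_[set w | t < g w] w * Z w)) ->
  expect (fun w => f w * W w) = expect (fun w => g w * Z w).
Proof.
move=> bf bg bW bZ f01 g01 fg; apply/eqP; rewrite -subr_eq0; apply/eqP.
have [_ [MW hW]] := bW; have [_ [MZ hZ]] := bZ.
apply: (@eq0_archi _ (MW + MZ)) => N.
pose step (f : T -> R) w : R :=
  N.+1%:R^-1 * \sum_(0 <= i < N.+1) \1_[set w | i%:R / N.+1%:R < f w] w.
have N0 : 0 < N.+1%:R :> R by rewrite ltr0n.
have bstep f' : bounded_measurable f' -> bounded_measurable (step f').
  move=> bf'; apply: bmM; first exact: bm_cst.
  by apply: bm_sum => i; apply: bm_indic; apply: measurable_layer; case: bf'.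
have approx f' V M : bounded_measurable f' -> bounded_measurable V ->
    (forall w, 0 <= f' w <= 1) -> (forall w, `|V w| <= M) ->
    `|expect (fun w => f' w * V w) - expect (fun w => step f' w * V w)| <= M / N.+1%:R.
  move=> bf' bV f'01 hV; rewrite -expectB; [|exact: bmM|by apply: bmM => //; exact: bstep].
  apply: le_norm_expect.
    apply: (bm_ext (f := fun w => f' w * V w + (-1) * (step f' w * V w))).
      by move=> w; rewrite mulN1r.
    apply: bmD; first exact: bmM.
    by apply: bmM; [exact: bm_cst|apply: bmM => //; exact: bstep].
  move=> w; rewrite -mulrBl normrM mulrC ler_pM//.
  have /andP[f0 f1] := f'01 w.
  have : 0 <= f' w * N.+1%:R <= N.+1%:R.
    by rewrite mulr_ge0//= -[leRHS]mul1r ler_wpM2r.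
  move=> /sum_layers_bounds /andP[l1 l2].
  rewrite /step; under eq_bigr do rewrite layer_indic ltr_pdivrMr//.
  move: l1 l2; set X := \sum_(_ <= _ < _) _ => l1 l2.
  have -> : f' w - N.+1%:R^-1 * X = (f' w * N.+1%:R - X) / N.+1%:R.
    by field; rewrite gt_eqF.
  rewrite normrM [X in _ * X]gtr0_norm ?invr_gt0// -[leRHS]mul1r ler_wpM2r ?invr_ge0//.
  by rewrite ler_norml; lra.
have := approx f W MW bf bW f01 hW; have := approx g Z MZ bg bZ g01 hZ.
suff -> : expect (fun w => step f w * W w) = expect (fun w => step g w * Z w).
  set a := expect (fun w => f w * _ w); set b := expect (fun w => g w * Z w).
  set e := expect (fun w => step g w * _ w).
  move=> h1 h2; rewrite mulrDl.
  have -> : a - b = (a - e) - (b - e) by ring.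
  by rewrite (le_trans (ler_normB _ _))// lerD.
have stepE f' V : bounded_measurable f' -> bounded_measurable V ->
    expect (fun w => step f' w * V w) = N.+1%:R^-1 * \sum_(0 <= i < N.+1)
      expect (fun w => \1_[set w | i%:R / N.+1%:R < f' w] w * V w).
  move=> bf' bV; have bl i : bounded_measurable
      (fun w => \1_[set w | i%:R / N.+1%:R < f' w] w * V w).
    by apply: bmM => //; apply: bm_indic; apply: measurable_layer; case: bf'.
  rewrite -expect_sum// -expectZ; last exact: bm_sum.
  by apply: expect_ext => w; rewrite /step -mulrA mulr_suml.
by rewrite !stepE//; under eq_bigr do rewrite fg.
Qed.

End bounded_expectation.

(** * Independence, from events to products of functions *)

Section iid_products.
Context d (T : measurableType d) (R : realType) (P : probability T R).
Variables (I : choiceType) (U : topologicalType) (xi : I -> T -> U).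
Hypothesis iidP : is_iid P xi.

(** Borel measurability through upper level sets, as [U] carries only a topology. *)
Definition layers_borel (u : U -> R) := forall t : R, borel [set z | t < u z].

Let cylinder (J : {fset I}) (B : I -> set U) : set T :=
  \bigcap_(i in [set` J]) (xi i @^-1` B i).

Lemma borelT : borel [set: U].
Proof.
by apply: sub_sigma_algebra; exact: openT.
Qed.

Lemma measurable_xi i B : borel B -> measurable (xi i @^-1` B).
Proof. by case: iidP => + _ _; apply. Qed.

Let measurable_cylinder J B : (forall i, borel (B i)) -> measurable (cylinder J B).
Proof.
by move=> bB; apply: fin_bigcap_measurable => // i _; exact: measurable_xi.
Qed.

Lemma layers_measurable i u : layers_borel u -> measurable_fun setT (u \o xi i).
Proof.
move=> bu; apply: (measurability _ (RGenOInfty.measurableE R)) => _ [_ [t ->] <-].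
rewrite setTI (_ : _ @^-1` _ = xi i @^-1` [set z | t < u z]).
  exact: measurable_xi.
by apply/seteqP; split => w /=; rewrite in_itv /= andbT.
Qed.

Let bm_xi i u : layers_borel u -> (forall z, 0 <= u z <= 1) ->
  bounded_measurable (fun w => u (xi i w)).
Proof.
move=> bu u01; split; first exact: layers_measurable.
by exists 1 => w; have /andP[u0 u1] := u01 (xi i w); rewrite ger0_norm.
Qed.

Lemma expect_ident i j u : layers_borel u -> (forall z, 0 <= u z <= 1) ->
  expect P (fun w => u (xi i w)) = expect P (fun w => u (xi j w)).
Proof.
move=> bu u01.
have e k : expect P (fun w => u (xi k w)) = expect P (fun w => u (xi k w) * 1).
  by apply: expect_ext => w; rewrite mulr1.
rewrite !e; apply: expect_layers => //; try exact: bm_xi; try exact: bm_cst.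
move=> t.
have E k : expect P (fun w => \1_[set w | t < u (xi k w)] w * 1) =
    fine (P (xi k @^-1` [set z | t < u z])).
  rewrite -expect_indic; last exact: measurable_xi.
  by apply: expect_ext => w; rewrite mulr1.
by rewrite !E; case: iidP => _ /(_ i j) -> //; exact: bu.
Qed.

(** Factors are removed one at a time: [expect_layers] replaces the factor at [y] by indicators of
    its upper level sets, and such an indicator merely adds the index [y] to the cylinder. *)
Let expect_prod_cylinder (r : seq I) (u : I -> U -> R) J B : uniq r ->
  (forall i, layers_borel (u i)) -> (forall i z, 0 <= u i z <= 1) ->
  (forall i, borel (B i)) -> (forall i, i \in r -> i \notin J) ->
  expect P (fun w => \prod_(i <- r) u i (xi i w) * \1_(cylinder J B) w) =
  \prod_(i <- r) expect P (fun w => u i (xi i w)) * fine (P (cylinder J B)).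
Proof.
move=> + bu u01; elim: r J B => [|y r IH] J B.
  move=> _ bB _; rewrite big_nil mul1r -expect_indic; last exact: measurable_cylinder.
  by apply: expect_ext => w; rewrite big_nil mul1r.
move=> /= /andP[yr ur] bB rJ.
have yJ : y \notin J by apply: rJ; rewrite mem_head.
have {}rJ i : i \in r -> i \notin J by move=> ir; apply: rJ; rewrite inE ir orbT.
set K := \prod_(i <- r) expect P (fun w => u i (xi i w)) * fine (P (cylinder J B)).
have -> : \prod_(i <- y :: r) expect P (fun w => u i (xi i w)) *
    fine (P (cylinder J B)) = expect P (fun w => u y (xi y w) * K).
  rewrite big_cons -mulrA -/K mulrC -expectZ//; last exact: bm_xi.
  by apply: expect_ext => w; rewrite mulrC.
pose W w := \prod_(i <- r) u i (xi i w) * \1_(cylinder J B) w : R.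
transitivity (expect P (fun w => u y (xi y w) * W w)).
  by apply: expect_ext => w; rewrite big_cons mulrA.
apply: expect_layers => //; first exact: bm_xi.
- exact: bm_xi.
- apply: bmM; last by apply: bm_indic; exact: measurable_cylinder.
  by apply: bm_prod => i; apply: bm_xi.
- exact: bm_cst.
move=> t; pose B' i := if i == y then [set z | t < u y z] else B i.
have bB' i : borel (B' i) by rewrite /B'; case: ifP => // _; exact: bu.
have capE : [set w | t < u y (xi y w)] `&` cylinder J B = cylinder (y |` J)%fset B'.
  apply/seteqP; split => w /=.
    move=> [ty cJ] i /=; rewrite in_fset1U /B'; case: eqP => [->//|_ /= iJ].
    exact: cJ.
  move=> cJ; split.
    by have := cJ y; rewrite /= fset1U1 /B' eqxx; apply.
  move=> i /= iJ; have := cJ i; rewrite /= in_fset1U iJ orbT /B'.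
  by case: eqP => [iy|_]; [rewrite -iy iJ in yJ|apply].
transitivity (expect P (fun w =>
    \prod_(i <- r) u i (xi i w) * \1_(cylinder (y |` J)%fset B') w)).
  by apply: expect_ext => w; rewrite -capE indicI /= /W; ring.
rewrite IH//; last first.
  move=> i ir; rewrite in_fset1U negb_or rJ// andbT.
  by apply: contraNneq yr => <-.
have my : measurable [set w | t < u y (xi y w)] by exact: (measurable_xi y (bu y t)).
transitivity (K * fine (P [set w | t < u y (xi y w)])); last first.
  rewrite -expect_indic// -expectZ; last exact: bm_indic.
  by apply: expect_ext => w; rewrite mulrC.
rewrite /K -mulrA; congr (_ * _).
case: iidP => _ _ prodE.
rewrite /cylinder !prodE// big_fsetU1//= /B' eqxx.
rewrite (eq_big_seq (fun i => P (xi i @^-1` B i))); last first.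
  by move=> i iJ; case: eqP => // iy; rewrite -iy iJ in yJ.
have fin A : measurable A -> P A \is a fin_num.
  by move=> mA; rewrite ge0_fin_numE// (le_lt_trans (probability_le1 P mA))// ltry.
rewrite fineM ?fin//; first by rewrite mulrC.
by rewrite -prodE//; apply: fin; exact: measurable_cylinder.
Qed.

Lemma expect_prod (r : seq I) (u : I -> U -> R) : uniq r ->
  (forall i, layers_borel (u i)) -> (forall i z, 0 <= u i z <= 1) ->
  expect P (fun w => \prod_(i <- r) u i (xi i w)) =
  \prod_(i <- r) expect P (fun w => u i (xi i w)).
Proof.
move=> ur bu u01.
have := @expect_prod_cylinder r u fset0 (fun=> setT) ur bu u01 (fun=> borelT)
  (fun=> fun=> isT).
have -> : cylinder fset0 (fun=> setT) = setT by apply/seteqP; split.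
rewrite (_ : fine (P setT) = 1); last first.
  by rewrite [X in fine X](_ : _ = 1%E)//; exact: probability_setT.
rewrite mulr1 => <-; apply: expect_ext => w.
by rewrite indicT mulr1.
Qed.

End iid_products.

(** * Independence and translation invariance for polynomials in the cookies *)

Section cookie_polynomials.
Variables (Y : state_space) (R : realType) (kappa : R).
Variable hk : 0 < kappa <= (2 * site_dim Y)%:R^-1.
Variable P : probability (borel_env hk) R.
Hypothesis iidP : is_iid P (@omega_at Y R kappa hk).

Implicit Types (A : pred (site Y)) (w : borel_env hk).

Let kappa_gt0 : 0 < kappa. Proof. by case/andP: hk. Qed.

Definition cookie (w : borel_env hk) (x : site Y) (a : dir Y) (i : nat) : R :=
  omega w x a i.+1.

Lemma cookie_admissible w : admissible kappa (cookie w).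
Proof.
move=> x i; have H : environments Y kappa (set_val (w : env hk)) := set_valP _.
exact: (H x i.+1 isT).
Qed.

Lemma cookie01 w x a i : 0 <= cookie w x a i <= 1.
Proof.
have [/(_ a) /andP[h1 h2] _ _] := cookie_admissible w x i.
by rewrite (le_trans (ltW kappa_gt0) h1) (le_trans h2)// lerBlDr lerDl ltW.
Qed.

Local Notation trip := (site Y * dir Y * nat)%type.

Definition monomial (l : seq trip) w := \prod_(t <- l) cookie w t.1.1 t.1.2 t.2.

(** The functions given to [expect_prod] must have values in [0, 1] on all real families, not only
    on those of environments; on the latter, clipping changes nothing. *)
Let clip (r : R) := Num.max 0 (Num.min 1 r).

Let clip01 r : 0 <= clip r <= 1.
Proof. by rewrite le_max lexx ge_max ler01 ge_min lexx. Qed.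

Let clip_id r : 0 <= r <= 1 -> clip r = r.
Proof. by move=> /andP[r0 r1]; rewrite /clip min_r// max_r. Qed.

Let site_monomial (l : seq trip) x (z : cookies Y R) : R :=
  \prod_(t <- l | t.1.1 == x) clip (z (t.1.2, t.2)).

Let site_monomial01 l x z : 0 <= site_monomial l x z <= 1.
Proof.
rewrite /site_monomial; apply/andP; split.
  by apply: prodr_ge0 => t _; case/andP: (clip01 (z (t.1.2, t.2))).
by apply: prodr_ile1 => t _; apply: clip01.
Qed.

Let site_monomial_borel l x : layers_borel (site_monomial l x).
Proof.
move=> t; rewrite /borel.
have : measurable_fun setT
    (site_monomial l x : g_sigma_algebraType (@open (cookies Y R)) -> R).
  have : bounded_measurable
    (site_monomial l x : g_sigma_algebraType (@open (cookies Y R)) -> R).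
    apply: (bm_prod (T := g_sigma_algebraType (@open (cookies Y R)))) => q; split.
      apply: measurable_maxr; first exact: measurable_cst.
      apply: measurable_minr; first exact: measurable_cst.
      apply: (measurability _ (RGenOInfty.measurableE R)) => _ [_ [s ->] <-].
      rewrite setTI; apply: sub_sigma_algebra.
      suff : open ((fun z : cookies Y R => z (q.1.2, q.2)) @^-1` `]s, +oo[) by [].
      apply: open_comp; last exact: rray_open.
      by move=> z _; exact: (@proj_continuous _ (fun=> R) (q.1.2, q.2)).
    by exists 1 => z; rewrite ger0_norm; case/andP: (clip01 (z (q.1.2, q.2))).
  by case.
exact: measurable_layer.
Qed.

Lemma prod_by_site (r : seq (site Y)) (l : seq trip) (F : trip -> R) : uniq r ->
  {in l, forall t, t.1.1 \in r} ->
  \prod_(t <- l) F t = \prod_(x <- r) \prod_(t <- l | t.1.1 == x) F t.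
Proof.
move=> ur lr.
rewrite [RHS](eq_bigr (fun x => \prod_(t <- l) if t.1.1 == x then F t else 1)).
  rewrite exchange_big /=; apply: eq_big_seq => t tl.
  rewrite (bigD1_seq t.1.1)//= ?lr// eqxx big1 ?mulr1// => x.
  by rewrite eq_sym => /negbTE->.
by move=> x _; rewrite big_mkcond.
Qed.

Let site_expect (l : seq trip) x :=
  expect P (fun w => \prod_(t <- l | t.1.1 == x) cookie w 0 t.1.2 t.2).

(** Independence splits the monomial by sites and the common law moves each factor to site 0. Only
    the grouping by sites remains, whence both multiplicativity over disjoint sets of sites and
    translation invariance. *)
Lemma expect_monomial (r : seq (site Y)) (l : seq trip) : uniq r ->
  {in l, forall t, t.1.1 \in r} ->
  expect P (monomial l) = \prod_(x <- r) site_expect l x.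
Proof.
move=> ur lr.
have siteE y x w : \prod_(t <- l | t.1.1 == x) cookie w y t.1.2 t.2 =
    site_monomial l x (omega_at y w).
  apply: eq_bigr => t _; rewrite clip_id//; exact: cookie01.
transitivity (expect P (fun w => \prod_(x <- r) site_monomial l x (omega_at x w))).
  apply: expect_ext => w; rewrite /monomial (prod_by_site _ ur lr).
  by apply: eq_bigr => x _; rewrite -siteE; apply: eq_bigr => t /eqP->.
rewrite (expect_prod iidP)//.
apply: eq_bigr => x _; rewrite (expect_ident iidP x 0)//.
by apply: expect_ext => w; rewrite -siteE.
Qed.

Lemma bm_cookie x a i : bounded_measurable (fun w => cookie w x a i).
Proof.
apply: (bm_ext (f := fun w => site_monomial [:: (x, a, i)] x (omega_at x w))).
  move=> w; rewrite /site_monomial big_mkcond big_seq1 /= eqxx clip_id//.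
  exact: cookie01.
split; first exact: (layers_measurable iidP _ (site_monomial_borel _ _)).
by exists 1 => w; rewrite ger0_norm; case/andP: (site_monomial01 [:: (x, a, i)] x (omega_at x w)).
Qed.

Lemma expect_monomial_cat l1 l2 :
  (forall t1 t2, t1 \in l1 -> t2 \in l2 -> t1.1.1 != t2.1.1) ->
  expect P (monomial (l1 ++ l2)) = expect P (monomial l1) * expect P (monomial l2).
Proof.
move=> l12; pose r := undup [seq t.1.1 | t <- l1 ++ l2].
have ur : uniq r by exact: undup_uniq.
have lr : {in l1 ++ l2, forall t, t.1.1 \in r}.
  by move=> t tl; rewrite mem_undup; apply/mapP; exists t.
rewrite !(expect_monomial ur)//; last 2 first.
- by move=> t tl; apply: lr; rewrite mem_cat tl orbT.
- by move=> t tl; apply: lr; rewrite mem_cat tl.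
rewrite -big_split; apply: eq_bigr => x _; rewrite /site_expect.
have [/hasP[t tl1 /eqP tx]|no1] := boolP (has (fun t => t.1.1 == x) l1); last first.
  rewrite [X in _ = X * _](_ : _ = 1) ?mul1r.
    apply: expect_ext => w; rewrite big_cat /= [X in X * _]big1_seq ?mul1r//.
    by move=> t /andP[tx tl]; case/hasP: no1; exists t.
  rewrite -[RHS](expect_cst P 1); apply: expect_ext => w; rewrite big1_seq//.
  by move=> t /andP[tx tl]; case/hasP: no1; exists t.
have no2 t2 : ~ ((t2.1.1 == x) && (t2 \in l2)).
  by move=> /andP[/eqP t2x t2l]; have := l12 t t2 tl1 t2l; rewrite tx t2x eqxx.
rewrite [X in _ = _ * X](_ : _ = 1) ?mulr1.
  apply: expect_ext => w; rewrite big_cat /= [X in _ * X]big1_seq ?mulr1//.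
  by move=> t2 /no2.
rewrite -[RHS](expect_cst P 1); apply: expect_ext => w; rewrite big1_seq//.
by move=> t2 /no2.
Qed.

Definition translate (z : site Y) (l : seq trip) : seq trip :=
  [seq (t.1.1 + z, t.1.2, t.2) | t <- l].

Lemma expect_monomial_translate (z : site Y) l :
  expect P (monomial (translate z l)) = expect P (monomial l).
Proof.
pose r := undup [seq t.1.1 | t <- l].
have lr : {in l, forall t, t.1.1 \in r}.
  by move=> t tl; rewrite mem_undup; apply/mapP; exists t.
rewrite (expect_monomial (undup_uniq _) lr).
rewrite (@expect_monomial (map (+%R^~ z) r)); last 2 first.
- by rewrite map_inj_uniq ?undup_uniq//; exact: addIr.
- by move=> _ /mapP[t tl ->] /=; apply: map_f; apply: lr.
rewrite big_map; apply: eq_bigr => x _; apply: expect_ext => w.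
by rewrite big_map /=; apply: eq_bigl => t; rewrite (inj_eq (addIr z)).
Qed.

(* [f] is a polynomial in the cookies of the sites in [A], and [g] is the same
   polynomial in the cookies of the sites translated by [z]. *)
Definition poly_rel (A : pred (site Y)) z (f g : borel_env hk -> R) :=
  exists s : seq (R * seq trip),
    [/\ {in s, forall q, {in q.2, forall t, A t.1.1}},
        forall w, f w = \sum_(q <- s) q.1 * monomial q.2 w
      & forall w, g w = \sum_(q <- s) q.1 * monomial (translate z q.2) w].

Definition poly A f := poly_rel A 0 f f.

Lemma poly_rel_ext A z f g f' g' : f =1 f' -> g =1 g' ->
  poly_rel A z f g -> poly_rel A z f' g'.
Proof. by move=> /funext<- /funext<-. Qed.

Lemma poly_rel_cst A z r : poly_rel A z (fun=> r) (fun=> r).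
Proof.
exists [:: (r, [::])]; split => [q|w|w]; first by rewrite inE => /eqP->.
  by rewrite big_seq1 /monomial big_nil mulr1.
by rewrite big_seq1 /monomial big_nil mulr1.
Qed.

Lemma poly_rel_cookie A z x a i : A x ->
  poly_rel A z (fun w => cookie w x a i) (fun w => cookie w (x + z) a i).
Proof.
move=> Ax; exists [:: (1, [:: (x, a, i)])]; split => [q|w|w].
- by rewrite inE => /eqP-> t; rewrite inE => /eqP->.
- by rewrite big_seq1 /monomial big_seq1 mul1r.
- by rewrite big_seq1 /monomial big_seq1 mul1r.
Qed.

Lemma poly_relD A z f g f' g' : poly_rel A z f g -> poly_rel A z f' g' ->
  poly_rel A z (fun w => f w + f' w) (fun w => g w + g' w).
Proof.
move=> [s [sA fE gE]] [s' [s'A fE' gE']]; exists (s ++ s'); split => [q|w|w].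
- by rewrite mem_cat => /orP[/sA|/s'A].
- by rewrite big_cat fE fE'.
- by rewrite big_cat gE gE'.
Qed.

Lemma poly_relM A z f g f' g' : poly_rel A z f g -> poly_rel A z f' g' ->
  poly_rel A z (fun w => f w * f' w) (fun w => g w * g' w).
Proof.
move=> [s [sA fE gE]] [s' [s'A fE' gE']].
exists [seq (q.1 * q'.1, q.2 ++ q'.2) | q <- s, q' <- s']; split => [q|w|w].
- case/allpairsP => -[q1 q2] /= [/sA h1 /s'A h2 ->] t /=.
  by rewrite mem_cat => /orP[/h1|/h2].
- rewrite big_allpairs_dep /= fE mulr_suml; apply: eq_bigr => q _.
  rewrite fE' mulr_sumr; apply: eq_bigr => q' _.
  by rewrite /monomial big_cat /=; ring.
- rewrite big_allpairs_dep /= gE mulr_suml; apply: eq_bigr => q _.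
  rewrite gE' mulr_sumr; apply: eq_bigr => q' _.
  by rewrite /monomial /translate map_cat big_cat /=; ring.
Qed.

Lemma poly_rel_sum A z (J : Type) (r : seq J) (F G : J -> borel_env hk -> R) :
  (forall j, poly_rel A z (F j) (G j)) ->
  poly_rel A z (fun w => \sum_(j <- r) F j w) (fun w => \sum_(j <- r) G j w).
Proof.
move=> FG; elim: r => [|j r IH].
  apply: (poly_rel_ext _ _ (poly_rel_cst A z 0)) => w; by rewrite big_nil.
by apply: (poly_rel_ext _ _ (poly_relD (FG j) IH)) => w; rewrite big_cons.
Qed.

Lemma bm_monomial l : bounded_measurable (monomial l).
Proof. by apply: bm_prod => t; apply: bm_cookie. Qed.

Lemma bm_poly_sum (s : seq (R * seq trip)) :
  bounded_measurable (fun w => \sum_(q <- s) q.1 * monomial q.2 w).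
Proof.
by apply: bm_sum => q; apply: bmM; [exact: bm_cst|exact: bm_monomial].
Qed.

Lemma expect_poly_sum (s : seq (R * seq trip)) :
  expect P (fun w => \sum_(q <- s) q.1 * monomial q.2 w) =
  \sum_(q <- s) q.1 * expect P (monomial q.2).
Proof.
rewrite expect_sum => [|q]; last by apply: bmM; [exact: bm_cst|exact: bm_monomial].
by apply: eq_bigr => q _; rewrite expectZ//; exact: bm_monomial.
Qed.

Lemma poly_rel_bm A z f g : poly_rel A z f g -> bounded_measurable f.
Proof. by move=> [s [_ /funext-> _]]; exact: bm_poly_sum. Qed.

Lemma expect_poly_rel A z f g : poly_rel A z f g -> expect P f = expect P g.
Proof.
move=> [s [_ /funext-> /funext->]]; rewrite expect_poly_sum.
transitivity (\sum_(q <- [seq (q.1, translate z q.2) | q <- s])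
    q.1 * expect P (monomial q.2)).
  by rewrite big_map; apply: eq_bigr => q _; rewrite /= expect_monomial_translate.
rewrite -expect_poly_sum; apply: expect_ext => w.
by rewrite big_map.
Qed.

Lemma expect_poly_indep A A' f g : poly A f -> poly A' g ->
  (forall x, A x -> ~~ A' x) ->
  expect P (fun w => f w * g w) = expect P f * expect P g.
Proof.
move=> [s [sA /funext-> _]] [s' [s'A /funext-> _]] AA'.
rewrite !expect_poly_sum.
transitivity (expect P (fun w => \sum_(q <- [seq (q.1 * q'.1, q.2 ++ q'.2) |
    q <- s, q' <- s']) q.1 * monomial q.2 w)).
  apply: expect_ext => w; rewrite big_allpairs_dep /= mulr_suml.
  apply: eq_bigr => q _; rewrite mulr_sumr; apply: eq_bigr => q' _.
  by rewrite /monomial big_cat /=; ring.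
rewrite expect_poly_sum big_allpairs_dep /= mulr_suml.
apply: eq_big_seq => q qs; rewrite mulr_sumr; apply: eq_big_seq => q' qs'.
rewrite expect_monomial_cat; first by ring.
move=> t1 t2 t1q t2q; apply: contraTneq (sA q qs t1 t1q) => ->.
by apply/negP => /AA'; rewrite (s'A q' qs' t2 t2q).
Qed.
End cookie_polynomials.

(** * From uniform bounds in mean to almost sure statements *)

Section almost_sure.
Context d (T : measurableType d) (R : realType) (P : probability T R).

Lemma measure_union_le (A : nat -> set T) (e : R) :
  (forall n, measurable (A n)) -> nondecreasing_seq A ->
  (forall n, P (A n) <= e%:E)%E -> (P (\bigcup_n A n) <= e%:E)%E.
Proof.
move=> mA ndA Ae; have mU : measurable (\bigcup_n A n) by exact: bigcup_measurable.
have cA := @nondecreasing_cvg_mu _ _ _ P A mA mU ndA.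
rewrite -(cvg_lim _ cA)//; apply: lime_le; last exact: nearW.
by apply/cvg_ex; exists (P (\bigcup_n A n)).
Qed.

Lemma markov_expect (u : T -> R) (t : R) : bounded_measurable u ->
  (forall w, 0 <= u w) -> 0 < t ->
  (P [set w | (t < u w)%R] <= (expect P u / t)%:E)%E.
Proof.
move=> bu u0 t0; have mA : measurable [set w | t < u w].
  by apply: measurable_layer; case: bu.
rewrite -[X in (X <= _)%E]fineK; last first.
  by rewrite ge0_fin_numE// (le_lt_trans (probability_le1 P mA))// ltry.
rewrite lee_fin ler_pdivlMr// mulrC -expect_indic// -expectZ; last exact: bm_indic.
apply: expect_le => //; first by apply: bmM; [exact: bm_cst|exact: bm_indic].
by move=> w; rewrite layer_indic; case: ltP => [/ltW|]; rewrite ?mulr1 ?mulr0.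
Qed.

(** By monotonicity in [n], exceeding a threshold for some [n] is an increasing union, which
    Markov's inequality bounds uniformly; doing so for every [K] is then a null event. This serves
    both for environments and, with indicators, for trajectories. *)
Lemma ae_small (u : nat -> nat -> T -> R) :
  (forall K n, bounded_measurable (u K n)) -> (forall K n w, 0 <= u K n w) ->
  (forall K n m w, (n <= m)%N -> u K n w <= u K m w) ->
  (forall e, 0 < e -> exists K, forall n, expect P (u K n) <= e) ->
  {ae P, forall w, forall e, 0 < e -> exists K, forall n, u K n w <= e}.
Proof.
move=> bu u0 nd small.
pose A q K n := [set w | q.+1%:R^-1 < u K n w].
have mA q K n : measurable (A q K n) by apply: measurable_layer; case: (bu K n).
pose N q := \bigcap_K \bigcup_n A q K n.
have mN q : measurable (N q).
  by apply: bigcapT_measurable => K; exact: bigcup_measurable.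
have PN q : P (N q) = 0%E.
  apply/eqP; rewrite eq_le measure_ge0 andbT; apply/lee_addgt0Pr => e e0.
  rewrite add0e; have q0 : 0 < q.+1%:R^-1 :> R by rewrite invr_gt0.
  have [K hK] := small _ (mulr_gt0 e0 q0).
  apply: (@le_trans _ _ (P (\bigcup_n A q K n))).
    by apply: le_measure; rewrite ?inE//; [exact: bigcup_measurable|move=> w; apply].
  apply: measure_union_le => // [n m nm|n].
    apply/subsetPset => w; rewrite /A /= => /lt_le_trans; apply; exact: nd.
  apply: le_trans (markov_expect (bu K n) (u0 K n) q0) _.
  by rewrite lee_fin ler_pdivrMr.
have negl : P.-negligible (\bigcup_q N q).
  by apply: negligible_bigcup => q; exists (N q); split; [exact: mN|exact: PN|].
apply: negligibleS negl.
move=> w; apply: contra_notP => wN e e0.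
have := archi_boundP (ltW (divr_gt0 ltr01 e0)); rewrite div1r; set q := Num.bound _ => qe.
apply: contrapT => no; apply: wN; exists q => // K _.
apply: contrapT => noK; apply: no; exists K => n.
rewrite leNgt; apply/negP => en; apply: noK; exists n => //.
rewrite /A /=; apply: le_lt_trans en; rewrite invf_ple ?posrE//.
by apply: le_trans (ltW qe) _; rewrite ler_nat.
Qed.

End almost_sure.

Lemma expr_small (R : realType) (x e : R) : 0 <= x < 1 -> 0 < e ->
  exists n, x ^+ n <= e.
Proof.
move=> /andP[x0 x1] e0.
have /cvgrPdist_le /(_ e e0) [n _ /(_ n (leqnn n))] : x ^+ n @[n --> \oo] --> 0.
  by apply: cvg_expr; rewrite ger0_norm.
by rewrite /= sub0r normrN ger0_norm ?exprn_ge0//; exists n.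
Qed.

(** [u] tends to [p], so dividing the inequality by [k] gives [p <= (1 - e) * p] in the limit. *)
Lemma cesaro_vanish (R : realType) (u : nat -> R) (p e : R) :
  0 <= p -> 0 <= e <= 1 -> (forall k, p <= u k <= 1) ->
  (forall e', 0 < e' -> exists K, forall k, (K <= k)%N -> u k < p + e') ->
  (forall k, k.+1%:R * p <= 1 + (1 - e) * \sum_(0 <= j < k) u j) ->
  e * p = 0.
Proof.
move=> p0 /andP[e0 e1] pu up ineq; apply/eqP; rewrite eq_le mulr_ge0// andbT.
rewrite leNgt; apply/negP => ep.
have [J hJ] := up _ (divr_gt0 ep (ltr0Sn R 1)).
set d := e * p / 2 in hJ; have d0 : 0 < d by rewrite divr_gt0.
have sum_le k : \sum_(0 <= j < k) u j <= J%:R + k%:R * (p + d).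
  elim: k => [|k IH]; first by rewrite big_geq// mul0r addr0.
  rewrite big_nat_recr//=; have [Jk|kJ] := leqP J k.
    by rewrite -[k.+1%:R]natr1 mulrDl mul1r addrA lerD// ltW// hJ.
  have : \sum_(0 <= j < k) u j <= k%:R.
    rewrite -[X in _ <= X%:R](subn0 k) -sumr_const_nat.
    by apply: ler_sum => j _; case/andP: (pu j).
  have /andP[_ u1] := pu k.
  have : k.+1%:R <= J%:R :> R by rewrite ler_nat.
  rewrite -natr1 => h1 h2.
  have : 0 <= (k%:R + 1) * (p + d) by rewrite mulr_ge0 ?addr_ge0// ltW.
  lra.
have := archi_boundP (divr_ge0 (ler0n R J.+1) (ltW d0)).
set k := Num.bound _ => kd; have := ineq k; have := sum_le k.
move: kd; rewrite ltr_pdivrMr// -[J.+1%:R]natr1 -[k.+1%:R]natr1.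
set X := \sum_(_ <= _ < _) _ => kd h1 h2.
have : (1 - e) * X <= (1 - e) * (J%:R + k%:R * (p + d)).
  by rewrite ler_wpM2l// subr_ge0.
have ep2 : e * p = d * 2 by rewrite /d; field.
have : 0 <= e * J%:R by rewrite mulr_ge0.
have : 0 <= e * (k%:R * d) by rewrite !mulr_ge0// ltW.
have : k%:R * (e * p) = k%:R * d * 2 by rewrite ep2; ring.
nra.
Qed.

(** * The escape probability *)

Section annealed.
Variables (Y : state_space) (R : realType) (kappa : R).
Variable hk : 0 < kappa <= (2 * site_dim Y)%:R^-1.
Variable P : probability (borel_env hk) R.
Hypothesis iidP : is_iid P (@omega_at Y R kappa hk).

Implicit Types (h : seq (site Y)) (a : dir Y) (n m r : nat) (k b : int).
Implicit Types (A : pred (site Y)) (w : borel_env hk) (f g W : borel_env hk -> R).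

Let kappa_gt0 : 0 < kappa. Proof. by case/andP: hk. Qed.
Let adm w : admissible kappa (cookie w). Proof. exact: cookie_admissible. Qed.

Local Notation V w := (value (cookie w)).
Local Notation E := (expect P).

Definition lower (k : int) : pred (site Y) := fun x => height x < k.
Definition upper (k : int) : pred (site Y) := fun x => k <= height x.

(** [rel] couples histories whose walks use corresponding cookies. One induction thus serves for the
    sites on which a value depends and for its translates. *)
Lemma poly_rel_value (rel : seq (site Y) -> seq (site Y) -> Prop) A z S S'
    (F G : seq (site Y) -> borel_env hk -> R) n h h' :
  (forall h h', rel h h' -> S h = S' h' /\ poly_rel A z (F h) (G h')) ->
  (forall h h', rel h h' -> ~~ S h ->
     [/\ A (pos h), pos h' = pos h + z, prior h' = prior h
       & forall a, rel (extend h a) (extend h' a)]) ->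
  rel h h' ->
  poly_rel A z (fun w => V w S (F^~ w) n h) (fun w => V w S' (G^~ w) n h').
Proof.
move=> FG step; elim: n h h' => [|n IH] h h' hh'; first by have [] := FG _ _ hh'.
have [SE FGh] := FG _ _ hh'; rewrite /= -SE; case: (boolP (S h)) => [//|Sh].
have [Ah pE qE ext] := step _ _ hh' Sh; rewrite pE qE.
apply: poly_rel_sum => a; apply: poly_relM; first exact: poly_rel_cookie.
exact/IH/ext.
Qed.

Lemma poly_value (I : seq (site Y) -> Prop) A S (F : seq (site Y) -> borel_env hk -> R) n h :
  (forall h a, I h -> ~~ S h -> I (extend h a)) ->
  (forall h, I h -> ~~ S h -> A (pos h)) ->
  (forall h, I h -> poly A (F h)) -> I h ->
  poly A (fun w => V w S (F^~ w) n h).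
Proof.
move=> IS IA FA Ih.
apply: (poly_rel_value (rel := fun h h' => h' = h /\ I h)) => //.
- by move=> h1 _ [-> I1]; split => //; exact: FA.
- move=> h1 _ [-> I1] S1; split; [exact: IA|by rewrite addr0|by []|].
  by move=> a; split => //; exact: IS.
Qed.

Lemma poly_valueT S (F : seq (site Y) -> borel_env hk -> R) n h :
  (forall h, poly predT (F h)) -> poly predT (fun w => V w S (F^~ w) n h).
Proof. by move=> FA; apply: (poly_value (I := fun=> True)). Qed.

Lemma polyW A A' f : (forall x, A x -> A' x) -> poly A f -> poly A' f.
Proof.
move=> AA' [s [sA fE gE]]; exists s; split => // q qs t tq.
exact/AA'/(sA q qs t tq).
Qed.

Lemma poly_cst A (r : R) : poly A (fun _ : borel_env hk => r). Proof. exact: poly_rel_cst. Qed.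

Lemma polyD A f g : poly A f -> poly A g -> poly A (fun w => f w + g w).
Proof. exact: poly_relD. Qed.

Lemma polyM A f g : poly A f -> poly A g -> poly A (fun w => f w * g w).
Proof. exact: poly_relM. Qed.

Lemma polyB A f g : poly A f -> poly A g -> poly A (fun w => f w - g w).
Proof.
move=> fA gA; apply: (@poly_rel_ext _ _ _ _ A 0 (fun w => f w + (-1) * g w)
  (fun w => f w + (-1) * g w)).
- by move=> w; rewrite mulN1r.
- by move=> w; rewrite mulN1r.
- by apply: polyD => //; apply: polyM => //; exact: poly_cst.
Qed.

Lemma poly_sum A (J : Type) (s : seq J) (F : J -> borel_env hk -> R) :
  (forall j, poly A (F j)) -> poly A (fun w => \sum_(j <- s) F j w).
Proof. exact: poly_rel_sum. Qed.

Lemma poly_cookie A x a i : A x -> poly A (fun w => cookie w x a i).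
Proof.
by move=> Ax; have := @poly_rel_cookie _ _ _ hk A 0 x a i Ax; rewrite addr0.
Qed.

Lemma poly_bm A f : poly A f -> bounded_measurable f.
Proof. exact: (poly_rel_bm iidP). Qed.

Lemma poly_drift A x i : A x -> poly A (fun w => drift (cookie w) x i).
Proof.
move=> Ax; apply: poly_sum => a; apply: polyM; last exact: poly_cst.
exact: poly_cookie.
Qed.

Lemma bm_value_bool S (B : seq (site Y) -> bool) n h :
  bounded_measurable (fun w => V w S (fun h => (B h)%:R) n h).
Proof.
apply: (@poly_bm predT); apply: (@poly_valueT S (fun h _ => (B h)%:R)) => h'.
exact: poly_cst.
Qed.

(* Conditioning on the walk up to the stopping time, expressed by testing
   against polynomials in the cookies below level [k]. *)
Lemma expect_tower (I : seq (site Y) -> Prop) k S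
    (F G : seq (site Y) -> borel_env hk -> R) n h W :
  (forall h a, I h -> ~~ S h -> I (extend h a)) ->
  (forall h, I h -> ~~ S h -> ht h < k) ->
  (forall h, poly predT (F h)) -> (forall h, poly predT (G h)) ->
  (forall h W, I h -> poly (lower k) W -> (forall w, 0 <= W w) ->
     E (fun w => W w * F h w) <= E (fun w => W w * G h w)) ->
  I h -> poly (lower k) W -> (forall w, 0 <= W w) ->
  E (fun w => W w * V w S (F^~ w) n h) <= E (fun w => W w * V w S (G^~ w) n h).
Proof.
move=> IS Sk pF pG FG; elim: n h W => [|n IH] h W Ih pW W0; first exact: FG.
rewrite /=; case: (boolP (S h)) => [_|Sh]; first exact: FG.
have bW (F' : seq (site Y) -> borel_env hk -> R) a : (forall h, poly predT (F' h)) ->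
    bounded_measurable (fun w =>
      W w * cookie w (pos h) a (prior h) * V w S (F'^~ w) n (extend h a)).
  move=> pF'; apply: (@poly_bm predT); apply: polyM; last exact: poly_valueT.
  by apply: polyM; [apply: polyW pW|apply: poly_cookie].
have EE (F' : seq (site Y) -> borel_env hk -> R) : (forall h, poly predT (F' h)) ->
    E (fun w => W w * \sum_a cookie w (pos h) a (prior h) *
       V w S (F'^~ w) n (extend h a)) =
    \sum_a E (fun w => W w * cookie w (pos h) a (prior h) *
       V w S (F'^~ w) n (extend h a)).
  move=> pF'; rewrite -expect_sum => [|a]; last exact: bW.
  by apply: expect_ext => w; rewrite mulr_sumr; apply: eq_bigr => a _; rewrite mulrA.
rewrite !EE//; apply: ler_sum => a _; apply: IH.
- exact: IS.
- by apply: polyM => //; apply: poly_cookie; exact: Sk.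
- by move=> w; rewrite mulr_ge0//; case/andP: (cookie01 w (pos h) a (prior h)).
Qed.

Lemma poly_escape k hi n y :
  poly (upper k) (fun w => escape (cookie w) k hi n y).
Proof.
apply: (@poly_value (fun=> True) _ _ (fun h _ => (hi <= ht h)%R%:R)) => //.
  by move=> h _; rewrite /exits /upper -/(ht h); lia.
by move=> h _; exact: poly_cst.
Qed.

Lemma poly_no_return k n y : poly (upper k) (fun w => no_return (cookie w) k n y).
Proof.
apply: (@poly_value (fun=> True) _ _ (fun h _ => (above k h)%:R)) => //.
  by move=> h _; rewrite -aboveN negbK.
by move=> h _; exact: poly_cst.
Qed.

Lemma poly_late_fall k m n y :
  poly (upper k) (fun w => late_fall (cookie w) k m n y).
Proof.
apply: (@poly_value (fun=> True) _ _ (fun h w => (above (k + m%:Z) h)%:R *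
    V w (beneath k) (fun h => (beneath k h)%:R) n h)) => //.
  by move=> h _; rewrite /exits /upper -/(ht h); lia.
move=> h _; apply: polyM; first exact: poly_cst.
apply: (@poly_value (fun=> True) _ _ (fun h _ => (beneath k h)%:R)) => //.
  by move=> h' _; rewrite -aboveN negbK.
by move=> h' _; exact: poly_cst.
Qed.

Lemma poly_fall k r m n h :
  poly predT (fun w => fall_value (cookie w) k r m n h).
Proof.
by apply: (@poly_valueT _ (fun h _ => (falls k r m h)%:R)) => h'; exact: poly_cst.
Qed.

Definition esc (k : nat) n : R := E (fun w => escape (cookie w) 0 k%:Z n 0).

Lemma expect_escape k (m n : nat) y : height y = k ->
  E (fun w => escape (cookie w) k (k + m%:Z) n y) = esc m n.
Proof.
move=> yk; symmetry.
apply: (@expect_poly_rel _ _ _ _ _ iidP predT y).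
apply: (@poly_rel_value (fun h h' => h != [::] /\ h' = map (+%R^~ y) h) _ _ _ _
   (fun h _ => (m%:Z <= ht h)%R%:R) (fun h _ => (k + m%:Z <= ht h)%R%:R)).
- move=> h _ [h0 ->].
  have htE : ht (map (+%R^~ y) h) = ht h + k.
    by case: h h0 => //= x h _; rewrite /ht /= heightD yk.
  rewrite htE /exits htE; split; first by lia.
  by rewrite [k + _]addrC lerD2r; exact: poly_rel_cst.
- move=> h _ [h0 ->] Sh; case: h h0 {Sh} => //= x h _; split => //.
    rewrite /prior /= count_map; apply: eq_count => t /=.
    by rewrite (inj_eq (addIr y)).
  by move=> a; split => //=; rewrite /extend /= addrAC.
- by split => //=; rewrite add0r.
Qed.

Lemma esc_ge0 (k : nat) n : 0 <= esc k n.
Proof.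
by apply: expect_ge0 => w; apply: (value_bool_ge0 kappa_gt0 (adm w)).
Qed.

Lemma bm_escape k hi n y : bounded_measurable (fun w => escape (cookie w) k hi n y).
Proof. exact: bm_value_bool. Qed.

Lemma esc_le1 (k : nat) n : esc k n <= 1.
Proof.
rewrite -[leRHS](expect_cst P 1); apply: expect_le => [||w].
- exact: bm_escape.
- exact: bm_cst.
- exact: (value_bool_le1 kappa_gt0 (adm w)).
Qed.

Lemma esc_horizon (k : nat) n m : (n <= m)%N -> esc k n <= esc k m.
Proof.
move=> nm; apply: expect_le => [||w]; try exact: bm_escape.
apply: (value_horizon kappa_gt0 (adm w)) => // h.
by rewrite /exits negb_or => /andP[_ /negbTE->].
Qed.

Lemma esc_anti (k k' : nat) n : (k <= k')%N -> esc k' n <= esc k n.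
Proof.
move=> kk; apply: expect_le => [||w]; try exact: bm_escape.
apply: (value_tower kappa_gt0 (adm w) (I := fun=> True)) => //.
- by move=> h _; rewrite /exits; lia.
- move=> h n' _; rewrite /exits => hE _; case: (leP k%:Z (ht h)) => hkt.
    exact: (value_bool_le1 kappa_gt0 (adm w)).
  rewrite value_stop; last by rewrite /exits; lia.
  by rewrite [k'%:Z <= _]leNgt (_ : ht h < k'%:Z)//; lia.
- move=> h _; rewrite /exits => hE.
  by rewrite [k'%:Z <= _]leNgt (_ : ht h < k'%:Z)//; lia.
Qed.

Definition esc_lim (k : nat) : R := sup (range (esc k)).

Let esc_sup (k : nat) : has_sup (range (esc k)).
Proof.
split; first by exists (esc k 0%N), 0%N.
by exists 1 => _ [n _ <-]; exact: esc_le1.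
Qed.

Lemma esc_le_lim (k : nat) n : esc k n <= esc_lim k.
Proof. by apply: ub_le_sup; [case: (esc_sup k)|exists n]. Qed.

Lemma esc_lim_le (k : nat) (x : R) : (forall n, esc k n <= x) -> esc_lim k <= x.
Proof.
by move=> h; apply: ge_sup => [|_ [n _ <-]//]; exists (esc k 0%N), 0%N.
Qed.

Lemma esc_lim_ge0 (k : nat) : 0 <= esc_lim k.
Proof. exact: le_trans (esc_ge0 k 0) (esc_le_lim k 0). Qed.

Lemma esc_lim_le1 (k : nat) : esc_lim k <= 1.
Proof. by apply: esc_lim_le => n; exact: esc_le1. Qed.

Lemma esc_lim_anti (k k' : nat) : (k <= k')%N -> esc_lim k' <= esc_lim k.
Proof.
move=> kk; apply: esc_lim_le => n; exact: le_trans (esc_anti n kk) (esc_le_lim k n).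
Qed.

(* Probability of never going below the initial level. *)
Definition p_esc : R := inf (range esc_lim).

Let esc_inf : has_inf (range esc_lim).
Proof.
split; first by exists (esc_lim 0), 0%N.
by exists 0 => _ [k _ <-]; exact: esc_lim_ge0.
Qed.

Lemma p_esc_le (k : nat) : p_esc <= esc_lim k.
Proof. by apply: ge_inf; [case: esc_inf|exists k]. Qed.

Lemma p_esc_ge0 : 0 <= p_esc.
Proof.
by apply: lb_le_inf => [|_ [k _ <-]]; [case: esc_inf|exact: esc_lim_ge0].
Qed.

Lemma p_esc_le1 : p_esc <= 1.
Proof. exact: le_trans (p_esc_le 0) (esc_lim_le1 0). Qed.

Lemma p_esc_approx (e : R) : 0 < e ->
  exists K, forall k : nat, (K <= k)%N -> esc_lim k < p_esc + e.
Proof.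
move=> e0; have [_ [K _ <-] hK] := inf_adherent e0 esc_inf.
by exists K => k /esc_lim_anti /le_lt_trans; apply.
Qed.

(** Escaping to level [k + n] takes at least [n] steps, spent at or above [k]. *)
Lemma expect_no_return k n y : height y = k ->
  p_esc <= E (fun w => no_return (cookie w) k n y).
Proof.
move=> yk; apply: le_trans (p_esc_le n) _; apply: esc_lim_le => N.
rewrite -(expect_escape n N yk); apply: expect_le => [||w].
- exact: bm_escape.
- exact: poly_bm (poly_no_return _ _ _).
- apply: (escape_no_return kappa_gt0 (adm w)); first by rewrite lerDl.
  by rewrite /ht /= yk.
Qed.

Lemma expect_mul_upper k W g : poly (lower k) W -> poly (upper k) g ->
  E (fun w => W w * g w) = E W * E g.
Proof.
move=> pW pg; apply: (expect_poly_indep iidP pW pg) => x.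
by rewrite /lower /upper -ltNge.
Qed.

End annealed.

(** * The sign of the escape probability *)

Section criterion.
Variables (Y : state_space) (R : realType) (kappa : R).
Variable hk : 0 < kappa <= (2 * site_dim Y)%:R^-1.
Variable P : probability (borel_env hk) R.
Hypothesis iidP : is_iid P (@omega_at Y R kappa hk).

Implicit Types (h : seq (site Y)) (a : dir Y) (n m r I N : nat).
Implicit Types (A : pred (site Y)) (w : borel_env hk) (f g W : borel_env hk -> R).

Let kappa_gt0 : 0 < kappa. Proof. by case/andP: hk. Qed.
Let adm w : admissible kappa (cookie w). Proof. exact: cookie_admissible. Qed.

Local Notation V w := (value (cookie w)).
Local Notation E := (expect P).
Local Notation esc := (esc P).
Local Notation esc_lim := (esc_lim P).
Local Notation p := (p_esc P).

Definition mean_drift i : R := E (fun w => drift (cookie w) 0 i).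

Lemma expect_drift x i : E (fun w => drift (cookie w) x i) = mean_drift i.
Proof.
symmetry; apply: (@expect_poly_rel _ _ _ _ _ iidP predT x).
apply: poly_rel_sum => a; apply: poly_relM; last exact: poly_rel_cst.
by have := @poly_rel_cookie _ _ _ hk predT x 0 a i isT; rewrite add0r.
Qed.

Lemma mean_drift_ge0 i : 0 <= mean_drift i.
Proof. by apply: expect_ge0 => w; apply: (drift_ge0 (adm w)). Qed.

Lemma bm_drift x i : bounded_measurable (fun w => drift (cookie w) x i).
Proof. by apply: (@poly_bm _ _ _ _ _ iidP predT); exact: poly_drift. Qed.

Lemma mean_drift_le i : mean_drift i <= 1 - kappa *+ 2.
Proof.
rewrite -[leRHS](expect_cst P); apply: expect_le => [||w].
- exact: bm_drift.
- exact: bm_cst.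
- exact: (drift_le kappa_gt0 (adm w)).
Qed.

Definition mean_level_drift I : R := (width Y)%:R * \sum_(0 <= i < I) mean_drift i.

Lemma poly_level_drift A j I : (forall x, height x = j -> A x) ->
  poly A (fun w => level_drift (cookie w) j I).
Proof.
move=> jA; pose F x w := if height x == j then
  \sum_(0 <= i < I) drift (cookie w) x i else 0.
have FE w : \sum_(x <- level Y j) F x w = level_drift (cookie w) j I.
  by apply: eq_big_seq => x; rewrite mem_level /F => ->.
apply: (poly_rel_ext FE FE); apply: poly_sum => x; rewrite /F.
have [/jA Ax|_] := eqVneq (height x) j; last exact: poly_cst.
by apply: poly_sum => i; exact: poly_drift.
Qed.

Lemma expect_level_drift j I :
  E (fun w => level_drift (cookie w) j I) = mean_level_drift I.
Proof.
rewrite expect_sum => [|x]; last by apply: bm_sum => i; exact: bm_drift.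
rewrite (eq_bigr (fun=> \sum_(0 <= i < I) mean_drift i)) => [|x _].
  rewrite /mean_level_drift -(size_level Y j); elim: level => [|x s IH].
    by rewrite big_nil mul0r.
  by rewrite big_cons IH /= -natr1 mulrDl mul1r addrC.
rewrite expect_sum => [|i]; last exact: bm_drift.
by apply: eq_bigr => i _; rewrite expect_drift.
Qed.

Section weak_drift.
Hypothesis weak : forall I, mean_level_drift I <= 1.

(** The factor [kappa * p] accounts for a step to the right followed by escape for ever. If the
    level offers 1 in mean, at least [2 kappa] is then wasted, since the one cookie used has drift
    at most [1 - 2 kappa]. *)
Let e : R := kappa ^+ 2 * p *+ 2.

Let kp1 : kappa * p <= 1.
Proof.
by rewrite mulr_ile1 ?(ltW kappa_gt0) ?p_esc_ge0 ?p_esc_le1// ltW//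
  (kappa_lt1 kappa_gt0 (adm point)).
Qed.

(** The first visit to level [j] has probability [esc j n] and is decided by lower levels. From
    there [level_consumed] applies, and its bound separates into cookies of level [j] and of higher
    levels, which are independent of one another and of the past. *)
Lemma expect_level_consumed (j k : nat) n : (j < k)%N ->
  E (fun w => V w (exits (-1) k%:Z) (consumed (cookie w) (on_level j%:Z)) n [:: 0])
  <= (1 - e) * esc j n.
Proof.
move=> jk; pose D w := level_drift (cookie w) j%:Z n.+1.
pose q h w := no_return (cookie w) (j%:Z + 1) n (pos h + shiftv (right_dir Y)).
pose F h w := (j%:Z <= ht h)%R%:R *
  (D w - kappa * q h w * (D w - drift (cookie w) (pos h) 0)).
pose G h (w : borel_env hk) : R := (1 - e) * (j%:Z <= ht h)%R%:R.
pose I h := [/\ h != [::], {in behead h, forall x, height x < j%:Z} & ht h <= j%:Z].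
set S := @exits Y (0 - 1) j%:Z.
have I0 : I [:: 0] by split; rewrite // /ht /= height0.
have IS h a : I h -> ~~ S h -> I (extend h a).
  move=> [h0 hb hj]; rewrite /S /exits negb_or -!ltNge => /andP[_ {}hj]; split => //.
    case: h h0 hb hj => //= x h _ hb xj y; rewrite inE => /orP[/eqP->//|]; exact: hb.
  by have := ht_extend_le h a; lia.
have pF h : poly predT (F h).
  apply: polyM; first exact: poly_cst; apply: polyB; first exact: poly_level_drift.
  apply: polyM; last by apply: polyB; [exact: poly_level_drift|exact: poly_drift].
  by apply: polyM; [exact: poly_cst|apply: polyW; last exact: poly_no_return].
have pG h : poly predT (G h) by exact: poly_cst.
have EG : E (fun w => V w S (G^~ w) n [:: 0]) = (1 - e) * esc j n.
  rewrite /esc -expectZ; last exact: (bm_escape iidP).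
  by apply: expect_ext => w; exact: valueZ.
rewrite -EG; apply: (@le_trans _ _ (E (fun w => V w S (F^~ w) n [:: 0]))).
  apply: expect_le => [||w].
  - apply: (@poly_bm _ _ _ _ _ iidP predT); apply: (@poly_valueT _ _ _ _ _
      (fun h w => consumed (cookie w) (on_level j%:Z) h)) => h.
    rewrite /consumed; elim: (behead h) => [|x t IH]; first exact: poly_cst.
    by apply: polyD => //; apply: polyM; [exact: poly_cst|exact: poly_drift].
  - by apply: (@poly_bm _ _ _ _ _ iidP predT); exact: poly_valueT.
  apply: (value_tower_sized kappa_gt0 (adm w) (I := I)) => //.
  - by move=> h _; rewrite /S /exits; lia.
  - move=> h m [h0 hb hj] Sh mn sz; rewrite /F.
    case: (leP j%:Z (ht h)) => jh; last first.
      rewrite value_stop; first by rewrite mul0r /consumed drift_sum_low.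
      by move: Sh; rewrite /S /exits; lia.
    by rewrite mul1r (level_consumed kappa_gt0 (adm w))// ?sz//; lia.
  - move=> h [h0 hb hj] Sh _; rewrite /consumed drift_sum_low//.
    have -> : F h w = 0; last by [].
    by rewrite /F; case: leP => jh; rewrite ?mul0r//; move: Sh; rewrite /S /exits jh orbT.
have mul1E f : E f = E (fun w => 1 * f w).
  by apply: expect_ext => w; rewrite mul1r.
rewrite mul1E [leRHS]mul1E.
apply: (@expect_tower _ _ _ _ _ iidP I j%:Z S F G n [:: 0] (fun=> 1)) => //;
  last exact: poly_cst.
- by move=> h _; rewrite /S /exits negb_or -!ltNge => /andP[].
- move=> h W [h0 hb hj] pW W0; rewrite /F /G.
case: (leP j%:Z (ht h)) => jh; last first.
  by under eq_fun do rewrite mul0r mulr0; under [X in _ <= E X]eq_fun do rewrite !mulr0.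
have {jh}hj : ht h = j%:Z by lia.
pose y := pos h + shiftv (right_dir Y); have yj : height y = j%:Z + 1.
  by rewrite heightD height_shiftv dot_ell_right [height _]hj.
pose d w := drift (cookie w) (pos h) 0.
have pD : poly (on_level j%:Z) D by apply: poly_level_drift => x /eqP.
have pd : poly (on_level j%:Z) d by apply: poly_drift; apply/eqP.
have pq : poly (upper (j%:Z + 1)) (q h) by exact: poly_no_return.
have up1 f : poly (on_level j%:Z) f -> poly (upper j%:Z) f.
  by apply: polyW => x; rewrite /on_level /upper => /eqP->.
have up2 f : poly (upper (j%:Z + 1)) f -> poly (upper j%:Z) f.
  by apply: polyW => x; rewrite /upper; lia.
have pDq : poly (upper j%:Z) (fun w => D w - kappa * q h w * (D w - d w)).
  apply: polyB; first exact: up1.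
  apply: polyM; last by apply: polyB; exact: up1.
  by apply: polyM; [exact: poly_cst|exact: up2].
rewrite (expect_ext P (g := fun w => W w * (D w - kappa * q h w * (D w - d w)))); last first.
  by move=> w; rewrite mul1r.
rewrite (expect_mul_upper iidP pW pDq).
rewrite [leRHS](expect_ext P (g := fun w => (1 - e) * W w)); last first.
  by move=> w; rewrite mulr1 mulrC.
rewrite expectZ; last exact: (poly_bm iidP pW).
rewrite [leRHS]mulrC ler_wpM2l//; first exact: expect_ge0.
have bD : bounded_measurable D by exact: (poly_bm iidP pD).
have bDd : bounded_measurable (fun w => D w - d w) by exact: (poly_bm iidP (polyB pD pd)).
have -> : E (fun w => D w - kappa * q h w * (D w - d w)) =
    mean_level_drift n.+1 - kappa * (E (q h) * (mean_level_drift n.+1 - mean_drift 0)).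
  rewrite expectB//; last first.
    by apply: bmM => //; apply: bmM; [exact: bm_cst|exact: (poly_bm iidP pq)].
  rewrite expect_level_drift; congr (_ - _).
  rewrite (expect_ext P (g := fun w => kappa * (q h w * (D w - d w)))); last first.
    by move=> w; rewrite mulrA.
  rewrite expectZ; last by apply: bmM => //; exact: (poly_bm iidP pq).
  congr (_ * _); rewrite (expect_poly_indep iidP pq (polyB pD pd)); last first.
    by move=> x; rewrite /upper /on_level; lia.
  by rewrite expectB// ?expect_level_drift ?expect_drift//; exact: bm_drift.
have Eq : p <= E (q h) by exact: (expect_no_return iidP).
have s1 := weak n.+1; set s := mean_level_drift n.+1 in s1 *.
have d1 := mean_drift_le 0; set dr := mean_drift 0 in d1 *.
have sd : dr <= s.
  rewrite /s /dr -(expect_drift (pos h)) -(expect_level_drift j%:Z).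
  apply: expect_le => // [|w]; first exact: bm_drift.
  by rewrite -hj; apply: (drift_le_level (adm w)).
apply: (@le_trans _ _ (s - kappa * (p * (s - dr)))).
  by rewrite lerD2l lerN2 ler_wpM2l ?(ltW kappa_gt0)// ler_wpM2r// subr_ge0.
rewrite -subr_ge0.
(* The first term is the slack in [s <= 1], zero in the critical case; the second is nonnegative by
   the bound on the mean drift of one cookie. *)
have -> : 1 - e - (s - kappa * (p * (s - dr))) =
    (1 - kappa * p) * (1 - s) + kappa * p * (1 - kappa *+ 2 - dr).
  by rewrite /e; ring.
by rewrite addr_ge0// !mulr_ge0 ?subr_ge0 ?p_esc_ge0// ltW.
Qed.

Lemma p_esc_eq0 : p = 0.
Proof.
have e0 : 0 <= e.
  by rewrite /e mulrn_wge0// mulr_ge0 ?exprn_ge0 ?p_esc_ge0// ltW.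
have e1 : e <= 1.
  have [/(_ (right_dir Y)) /andP[h1 h2] _ _] := adm point 0 0%N.
  have k2 : kappa *+ 2 <= 1 by rewrite mulr2n; lra.
  have -> : e = kappa *+ 2 * (kappa * p) by rewrite /e; ring.
  by rewrite mulr_ile1// ?mulrn_wge0 ?mulr_ge0 ?p_esc_ge0// ltW.
have ineq (k : nat) : k.+1%:R * p <= 1 + (1 - e) * \sum_(0 <= j < k) esc_lim j.
  apply: (@le_trans _ _ (k.+1%:R * esc_lim k)).
    by rewrite ler_wpM2l// (p_esc_le iidP).
  rewrite mulrC -ler_pdivlMr; last by rewrite ltr0n.
  apply: esc_lim_le => n; rewrite ler_pdivlMr; last by rewrite ltr0n.
  rewrite mulrC /esc -expectZ; last exact: (bm_escape iidP).
  have bc (j : nat) : bounded_measurable (fun w => V w (exits (-1) k%:Z)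
      (consumed (cookie w) (on_level j%:Z)) n [:: 0]).
    apply: (@poly_bm _ _ _ _ _ iidP predT); apply: (@poly_valueT _ _ _ _ _
    (fun h w => consumed (cookie w) (on_level j%:Z) h)) => h.
    rewrite /consumed; elim: (behead h) => [|x t IH]; first exact: poly_cst.
    by apply: polyD => //; apply: polyM; [exact: poly_cst|exact: poly_drift].
  apply: (@le_trans _ _ (E (fun w => 1 + \sum_(0 <= j < k)
     V w (exits (-1) k%:Z) (consumed (cookie w) (on_level j%:Z)) n [:: 0]))).
    apply: expect_le => [||w].
    - by apply: bmM; [exact: bm_cst|exact: (bm_escape iidP)].
    - by apply: bmD; [exact: bm_cst|exact: bm_sum].
    - exact: (escape_consumed kappa_gt0 (adm w)).
  rewrite expectD; [|exact: bm_cst|exact: bm_sum].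
  rewrite expect_cst lerD2l expect_sum// mulr_sumr !big_nat.
  apply: ler_sum => j /andP[_ jk]; apply: le_trans (expect_level_consumed n jk) _.
  by rewrite ler_wpM2l ?subr_ge0// (esc_le_lim iidP).
have pu (k : nat) : p <= esc_lim k <= 1 by rewrite p_esc_le// esc_lim_le1.
have e01 : 0 <= e <= 1 by rewrite e0.
have := cesaro_vanish (p_esc_ge0 iidP) e01 pu (p_esc_approx iidP) ineq.
(* As [e] is itself proportional to [p], the conclusion is that [p * p] vanishes. *)
have -> : e * p = kappa * (kappa * 2) * (p * p) by rewrite /e; ring.
move=> /eqP; rewrite !mulf_eq0 pnatr_eq0 (gt_eqF kappa_gt0) /= orbb.
exact: eqP.
Qed.
End weak_drift.

Let width_gt0R : 0 < (width Y)%:R :> R. Proof. by rewrite ltr0n width_gt0. Qed.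

(** First [m] makes an exit at [- m] unlikely, then the number of clock periods makes a late exit
    unlikely. Neither depends on the environment. *)
Lemma hitting_time_small (k : nat) (e : R) : (0 < k)%N -> 0 < e ->
  exists n, forall w,
    V w (above k%:Z) (fun h => (beneath k%:Z h)%:R) n [:: 0] <= e.
Proof.
move=> k0 e0; have e20 : 0 < e / 2 by rewrite divr_gt0.
have := archi_boundP (divr_ge0 (ler0n R k) (ltW e20)); set m := Num.bound _ => km.
have kappa_bound : 0 <= 1 - kappa ^+ (k + m) / 2 < 1.
  have k1 : kappa ^+ (k + m) <= 1.
    by rewrite exprn_ile1 ?(ltW kappa_gt0)// ltW ?(kappa_lt1 kappa_gt0 (adm point)).
  by have : 0 < kappa ^+ (k + m) by [rewrite exprn_gt0]; lra.
have [N hN] := expr_small kappa_bound (divr_gt0 e20 (ltr0Sn R 1)).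
exists (N.+2 * (k + m).+1)%N => w.
apply: le_trans (hitting_time_tail kappa_gt0 (adm w) k0 (leqnn (N.+2 * (k + m).+1))) _.
have : k%:R / (k + m)%:R <= e / 2.
  rewrite ler_pdivrMr ?ltr0n ?addn_gt0 ?k0// mulrC -ler_pdivrMr//.
  by rewrite (le_trans (ltW km))// ler_nat leq_addl.
by move: hN; rewrite ler_pdivlMr//; lra.
Qed.

(** By translation invariance all [width Y] starting sites give the same escape probability, over
    [(k - j).+1] levels because they lie on level [j - 1]. *)
Lemma expect_few_entries (j k N n : nat) : (j < k)%N ->
  E (fun w => V w (above k%:Z)
    (fun h => (above k%:Z h && (entries j%:Z h <= N)%N)%:R) n [:: 0]) <=
  (kappa ^+ (width Y).+1)^-1 ^+ N.+1 * ((width Y)%:R * esc_lim (k - j).+1).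
Proof.
move=> jk; set C := _ ^+ N.+1; set M := (n * (width Y).+1).+1.
have C0 : 0 <= C by rewrite exprn_ge0// invr_ge0 exprn_ge0// ltW.
apply: (@le_trans _ _ (E (fun w => C * \sum_(x <- level Y j%:Z)
    escape (cookie w) (j%:Z - 1) (j%:Z - 1 + (k - j).+1%:Z) M
      (x - shiftv (right_dir Y))))).
  have bs : bounded_measurable (fun w => \sum_(x <- level Y j%:Z)
    escape (cookie w) (j%:Z - 1) (j%:Z - 1 + (k - j).+1%:Z) M
      (x - shiftv (right_dir Y))) by apply: bm_sum => x; exact: (bm_escape iidP).
  apply: expect_le => [||w]; first exact: (bm_value_bool iidP).
    by apply: bmM => //; exact: bm_cst.
  rewrite /escape (_ : j%:Z - 1 + (k - j).+1%:Z = k%:Z); last by lia.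
  rewrite (_ : j%:Z - 1 - 1 = j%:Z - 2); last by lia.
  by apply: (few_entries kappa_gt0 (adm w)); rewrite ?ltz_nat.
rewrite expectZ; last by apply: bm_sum => x; exact: (bm_escape iidP).
rewrite ler_wpM2l// expect_sum => [|x]; last exact: (bm_escape iidP).
rewrite -(size_level Y j%:Z) -sum1_size natr_sum mulr_suml.
rewrite !big_seq; apply: ler_sum => x; rewrite mem_level => /eqP xj.
rewrite mul1r (expect_escape iidP) ?(esc_le_lim iidP)//.
by rewrite heightD heightN height_shiftv dot_ell_right xj.
Qed.

(** [N] makes fewer than [I] visits unlikely after many crossings; then, as [p = 0], [m] makes few
    crossings unlikely at levels at least [m] below [k]; then the horizon makes reaching [k] likely.
    A fixed surplus of drift at each of [k - m] levels contradicts the bound [k] for large [k]. *)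
Lemma p_esc_gt0 I : 1 < mean_level_drift I -> 0 < p.
Proof.
move=> s1; rewrite lt_neqAle eq_sym (p_esc_ge0 iidP) andbT; apply/eqP => p0.
set s := mean_level_drift I in s1; set L := (width Y)%:R : R.
set B := (width Y * I)%:R : R; have B0 : 0 <= B by rewrite ler0n.
(* Since [s = 1 + 4 * d], three errors of at most [d] each leave [1 + d]. *)
have d0 : 0 < (s - 1) / 4 by rewrite divr_gt0// subr_gt0.
set d := (s - 1) / 4 in d0.
have B1 : 0 < B + 1 by rewrite ltr_pwDr.
have t0 : 0 < d / (B + 1) by rewrite divr_gt0.
set t := d / (B + 1) in t0.
have Bt x : x <= t -> B * x <= d.
  move=> xt; apply: (@le_trans _ _ (B * t)); first exact: ler_wpM2l.
  by rewrite /t mulrA ler_pdivrMr// mulrC ler_wpM2l ?(ltW d0)// lerDl.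
set rho := 1 - kappa ^+ (width Y).+1 / 2.
have rho01 : 0 <= rho < 1.
  have k1 : kappa ^+ (width Y).+1 <= 1.
    by rewrite exprn_ile1 ?(ltW kappa_gt0)// ltW ?(kappa_lt1 kappa_gt0 (adm point)).
  by rewrite /rho; have : 0 < kappa ^+ (width Y).+1 by [rewrite exprn_gt0]; lra.
have L2I : 0 < L * 2 ^+ I by rewrite mulr_gt0// exprn_gt0.
have [N hN] := expr_small rho01 (divr_gt0 t0 L2I).
rewrite ler_pdivlMr// in hN.
set C := (kappa ^+ (width Y).+1)^-1 ^+ N.+1.
have C0 : 0 < C by rewrite exprn_gt0// invr_gt0 exprn_gt0.
have [m hm] := p_esc_approx iidP (divr_gt0 t0 (mulr_gt0 C0 width_gt0R)).
have {}hm (k : nat) : (m <= k)%N -> C * (L * esc_lim k) <= t.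
  move=> /hm; rewrite p0 add0r ltr_pdivlMr ?mulr_gt0// => h.
  by rewrite mulrA mulrC ltW.
have key (k : nat) : (0 < k)%N -> (k - m)%:R * (1 + d) <= k%:R :> R.
  move=> k0; have [n hn] := hitting_time_small k0 t0.
  pose X1 w := V w (above k%:Z) (fun h => (beneath k%:Z h)%:R) n [:: 0].
  pose X2 (j : nat) w := V w (above k%:Z)
    (fun h => (above k%:Z h && (entries j%:Z h <= N)%N)%:R) n [:: 0].
  pose X3 (x : site Y) w := V w (above k%:Z) (fun h =>
        ((N < entries (height x) h) && (count_mem x h < I))%N%:R) n [:: 0].
  have b1 : bounded_measurable X1 by exact: (bm_value_bool iidP).
  have b2 (j : nat) : bounded_measurable (X2 j) by exact: (bm_value_bool iidP).
  have b3 (x : site Y) : bounded_measurable (X3 x) by exact: (bm_value_bool iidP).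
  have b3s (j : nat) : bounded_measurable (fun w => \sum_(x <- level Y j%:Z) X3 x w).
    exact: bm_sum.
  have b12 (j : nat) : bounded_measurable (fun w => X1 w + X2 j w) by exact: bmD.
  have b123 (j : nat) : bounded_measurable (fun w => X1 w + X2 j w +
    \sum_(x <- level Y j%:Z) X3 x w) by exact: bmD.
  have bB (j : nat) : bounded_measurable (fun w => B * (X1 w + X2 j w +
    \sum_(x <- level Y j%:Z) X3 x w)) by apply: bmM => //; exact: bm_cst.
  have bD (j : nat) : bounded_measurable (fun w => level_drift (cookie w) j%:Z I).
    by apply: (@poly_bm _ _ _ _ _ iidP predT); exact: poly_level_drift.
  have bDB (j : nat) : bounded_measurable (fun w => level_drift (cookie w) j%:Z I -
    B * (X1 w + X2 j w + \sum_(x <- level Y j%:Z) X3 x w)).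
    apply: (bm_ext (f := fun w => level_drift (cookie w) j%:Z I + (-1) *
      (B * (X1 w + X2 j w + \sum_(x <- level Y j%:Z) X3 x w)))).
      by move=> w; rewrite mulN1r.
    by apply: bmD => //; apply: bmM => //; exact: bm_cst.
  have : E (fun w => \sum_(0 <= j < k - m) (level_drift (cookie w) j%:Z I - B *
      (X1 w + X2 j w + \sum_(x <- level Y j%:Z) X3 x w))) <= k%:R.
    rewrite -[leRHS](expect_cst P); apply: expect_le => [||w]; first exact: bm_sum.
      exact: bm_cst.
    exact: (consumed_lower kappa_gt0 (adm w)).
  apply: le_trans; rewrite expect_sum//.
  rewrite -[X in X%:R * _](subn0 (k - m)%N) mulr_natl -sumr_const_nat !big_nat.
  apply: ler_sum => j /andP[_ jkm]; rewrite expectB//.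
  rewrite expect_level_drift expectZ// expectD// expectD// expect_sum//.
  have h1 : E X1 <= t.
    rewrite -[leRHS](expect_cst P); apply: expect_le => //; exact: bm_cst.
  have h2 : E (X2 j) <= t.
    have jk : (j < k)%N by apply: leq_trans jkm (leq_subr _ _).
    apply: (@le_trans _ _ (C * (L * esc_lim (k - j).+1))).
      exact: expect_few_entries.
    by apply/hm/leqW/ltnW; rewrite ltn_subRL addnC -ltn_subRL.
  have h3 : \sum_(x <- level Y j%:Z) E (X3 x) <= t.
    apply: le_trans hN; rewrite mulrCA /L -(size_level Y j%:Z) -sum1_size natr_sum mulr_suml.
    apply: ler_sum => x _; rewrite mul1r -[leRHS](expect_cst P).
    apply: expect_le => //; first exact: bm_cst.
    by move=> w; exact: (visits_bound kappa_gt0 (adm w)).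
  rewrite -/s !mulrDr; have := Bt _ h1; have := Bt _ h2; have := Bt _ h3.
  by have : s = 1 + 4 * d by [rewrite /d; field]; lra.
have := archi_boundP (divr_ge0 (addr_ge0 (ler0n R m) (mulr_ge0 (ler0n R m) (ltW d0))) (ltW d0)).
set k := Num.bound _; rewrite ltr_pdivrMr// => km.
have := key (k + m).+1 isT; rewrite subSn ?leq_addl// addnK -[k.+1%:R]natr1.
rewrite -[(k + m).+1%:R]natr1 natrD => h.
have : (k%:R + 1) * (1 + d) = k%:R + 1 + k%:R * d + d by ring.
have : 0 <= m%:R * d by rewrite mulr_ge0// ltW.
lra.
Qed.
End criterion.

(** * Mean probability of a deep fall when the escape probability is positive *)

Section falls.
Variables (Y : state_space) (R : realType) (kappa : R).
Variable hk : 0 < kappa <= (2 * site_dim Y)%:R^-1.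
Variable P : probability (borel_env hk) R.
Hypothesis iidP : is_iid P (@omega_at Y R kappa hk).

Implicit Types (h : seq (site Y)) (a : dir Y) (n m r : nat) (k b : int).
Implicit Types (w : borel_env hk) (f g W : borel_env hk -> R).

Let kappa_gt0 : 0 < kappa. Proof. by case/andP: hk. Qed.
Let adm w : admissible kappa (cookie w). Proof. exact: cookie_admissible. Qed.

Local Notation V w := (value (cookie w)).
Local Notation E := (expect P).
Local Notation esc := (esc P).
Local Notation esc_lim := (esc_lim P).
Local Notation p := (p_esc P).

Lemma esc_lim_le_from (m n0 : nat) (x y z : R) : 0 <= y ->
  (forall n, (n0 <= n)%N -> x + y * esc m n <= z) -> x + y * esc_lim m <= z.
Proof.
move=> y0 h; have [y_eq0|y_neq0] := eqVneq y 0.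
  by have := h n0 (leqnn _); rewrite y_eq0 !mul0r.
have {y_neq0} y_gt0 : 0 < y by rewrite lt_neqAle eq_sym y_neq0.
rewrite addrC -lerBrDr mulrC -ler_pdivlMr//; apply: esc_lim_le => n.
rewrite ler_pdivlMr// mulrC lerBrDr addrC.
apply: le_trans (h (maxn n0 n) (leq_maxl _ _)); rewrite lerD2l ler_wpM2l//.
exact: (esc_horizon iidP _ (leq_maxr _ _)).
Qed.

(** [late_fall_le] with [K] equal to [k + m + n], in the limit of long horizons; climbing [m + n]
    levels has limit probability at least [p]. *)
Lemma expect_late_fall k m n y : height y = k ->
  E (fun w => late_fall (cookie w) k m n y) <= esc_lim m - p.
Proof.
move=> yk; set x := E _.
have x_le n' : (n <= n')%N -> x + 1 * esc (m + n) n' <= esc_lim m.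
  move=> nn; rewrite mul1r -lerBrDr.
  apply: (@le_trans _ _ (esc m n' - esc (m + n) n')); last first.
    by rewrite lerD2r (esc_le_lim iidP).
  rewrite -!(expect_escape iidP _ _ yk) -expectB; try exact: (bm_escape iidP).
  apply: expect_le => [||w].
  - exact: (poly_bm iidP (@poly_late_fall _ _ _ hk _ _ _ _)).
  - apply: (bm_ext (f := fun w => escape (cookie w) k (k + m%:Z) n' y +
      (-1) * escape (cookie w) k (k + (m + n)%:Z) n' y)).
      by move=> w; rewrite mulN1r.
    apply: bmD; first exact: (bm_escape iidP).
    by apply: bmM; [exact: bm_cst|exact: (bm_escape iidP)].
  - by apply: (late_fall_le kappa_gt0 (adm w)); rewrite // PoszD addrA.
have := esc_lim_le_from ler01 x_le; rewrite mul1r => h.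
by have := p_esc_le iidP (m + n)%N; lra.
Qed.

(** For each block of [m] levels: a late fall, of probability at most [esc_lim m - p], or a fall
    before the block is climbed, of probability at most [1 - p], followed by the same alternative
    one block higher. *)
Fixpoint fall_bound m r : R :=
  if r is r'.+1 then (esc_lim m - p) + (1 - p) * fall_bound m r' else 1.

Lemma fall_bound_ge0 m r : 0 <= fall_bound m r.
Proof.
elim: r => [|r IH] /=; first exact: ler01.
by rewrite addr_ge0 ?subr_ge0 ?(p_esc_le iidP)// mulr_ge0// subr_ge0 (p_esc_le1 iidP).
Qed.

(** The weight [W] carries what the past has revealed below [k]. On arrival at [k + m] the cookies
    seen since then also lie below that level, so the induction hypothesis applies with a new
    weight; this takes the place of conditioning. *)
Lemma expect_fall m r k n h W : (0 < m)%N ->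
  h != [::] -> {in behead h, forall x, height x < k} -> ht h = k ->
  poly (lower k) W -> (forall w, 0 <= W w) ->
  E (fun w => W w * fall_value (cookie w) k r m n h) <= fall_bound m r * E W.
Proof.
move=> m0; elim: r k n h W => [|r IH] k n h W h0 hb hk' pW W0.
  rewrite mul1r; apply: expect_le => [||w].
  - by apply: bmM; [exact: (poly_bm iidP pW)|exact: (poly_bm iidP (@poly_fall _ _ _ hk _ _ _ _ _))].
  - exact: (poly_bm iidP pW).
  - by rewrite ler_piMr// (value_bool_le1 kappa_gt0 (adm w)).
have bW : bounded_measurable W by exact: (poly_bm iidP pW).
have EW0 : 0 <= E W by exact: expect_ge0.
set S := @above Y (k + m%:Z).
pose F h w := (S h && (0 < entries k h)%N)%:R *
  fall_value (cookie w) (k + m%:Z) r m n h.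
pose G h (w : borel_env hk) := fall_bound m r * (S h && (0 < entries k h)%N)%:R : R.
have pF h' : poly predT (F h').
  by apply: polyM; [exact: poly_cst|exact: poly_fall].
have pG h' : poly predT (G h') by exact: poly_cst.
have bVF : bounded_measurable (fun w => W w * V w S (F^~ w) n h).
  apply: bmM => //; apply: (@poly_bm _ _ _ _ _ iidP predT); exact: poly_valueT.
have blate : bounded_measurable (fun w => W w * late_fall (cookie w) k m n (pos h)).
  by apply: bmM => //; exact: (poly_bm iidP (@poly_late_fall _ _ _ hk _ _ _ _)).
apply: (@le_trans _ _ (E (fun w => W w * V w S (F^~ w) n h +
   W w * late_fall (cookie w) k m n (pos h)))).
  apply: expect_le => [||w].
  - by apply: bmM => //; exact: (poly_bm iidP (@poly_fall _ _ _ hk _ _ _ _ _)).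
  - exact: bmD.
  - by rewrite -mulrDr ler_wpM2l// (fall_split kappa_gt0 (adm w)).
rewrite expectD// [fall_bound _ _]/= mulrDl addrC lerD//.
  rewrite (expect_mul_upper iidP pW (@poly_late_fall _ _ _ hk _ _ _ _)) mulrC ler_wpM2r//.
  exact: expect_late_fall.
pose I h := [/\ h != [::], {in behead h, forall x, height x < k + m%:Z}
  & ht h <= k + m%:Z].
have km : 0 < m%:Z :> int by [].
apply: (@le_trans _ _ (E (fun w => W w * V w S (G^~ w) n h))).
  apply: (@expect_tower _ _ _ _ _ iidP I (k + m%:Z)) => //.
  - move=> h' a [h'0 h'b h'k]; rewrite /S aboveN /beneath => {}h'k; split => //.
      case: h' h'0 h'b h'k => //= y h' _ h'b yk z; rewrite inE => /orP[/eqP->//|].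
      exact: h'b.
    by have := ht_extend_le h' a; lia.
  - by move=> h' _; rewrite /S aboveN.
  - move=> h' W' [h'0 h'b h'k] pW' W'0; rewrite /F /G.
    case: (boolP (S h' && _)) => [/andP[Sh' _]|_]; last first.
      by under eq_fun do rewrite mul0r mulr0; under [X in _ <= E X]eq_fun do rewrite !mulr0.
    have {}h'k : ht h' = k + m%:Z by apply/eqP; rewrite eq_le h'k.
    under eq_fun do rewrite mul1r.
    rewrite [leRHS](expect_ext P (g := fun w => fall_bound m r * W' w)); last first.
      by move=> w; rewrite mulr1 mulrC.
    by rewrite expectZ; [exact: IH|exact: (poly_bm iidP pW')].
  - split => //; last by rewrite hk' lerDl.
    by move=> x xh; have := hb x xh; lia.
  - by apply: polyW pW => x; rewrite /lower; lia.
pose H w := V w S (fun h => (S h && (0 < entries k h)%N)%:R) n h.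
have bH : bounded_measurable H by exact: (bm_value_bool iidP).
rewrite (expect_ext P (g := fun w => fall_bound m r * (W w * H w))); last first.
  by move=> w; rewrite mulrCA; congr (_ * _); exact: valueZ.
rewrite expectZ; last exact: bmM.
rewrite [(1 - p) * _]mulrC -mulrA ler_wpM2l ?fall_bound_ge0//.
apply: (@le_trans _ _ ((1 - esc_lim m) * E W)); last first.
  by rewrite ler_wpM2r// lerD2l lerN2 (p_esc_le iidP).
rewrite mulrBl mul1r lerBrDr mulrC.
apply: (esc_lim_le_from (n0 := n)) => // n' nn.
rewrite -(expect_escape iidP _ _ hk') -(expect_mul_upper iidP pW (@poly_escape _ _ _ hk _ _ _ _)).
have be : bounded_measurable (fun w => W w * escape (cookie w) k (k + m%:Z) n' (pos h)).
  by apply: bmM => //; exact: (bm_escape iidP).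
rewrite -expectD//; last exact: bmM.
apply: expect_le => [||w] //; first by apply: bmD => //; exact: bmM.
rewrite -mulrDr ler_piMr// -lerBrDr.
exact: (early_fall_le kappa_gt0 (adm w)).
Qed.

(** Unfolding gives at most [(1 - p) ^+ r + r%:R * (esc_lim m - p)]: [r] is chosen for the first
    term, then [m] for the second. *)
Lemma fall_bound_small (e : R) : 0 < p -> 0 < e ->
  exists m r, (0 < m)%N /\ fall_bound m r <= e.
Proof.
move=> p0 e0; have p1 : 0 <= 1 - p < 1.
  by rewrite subr_ge0 (p_esc_le1 iidP) ltrBlDr ltrDl.
have le_bound m r : fall_bound m r <= (1 - p) ^+ r + r%:R * (esc_lim m - p).
  elim: r => [|r IH] /=; first by rewrite mul0r addr0.
  have d0 : 0 <= esc_lim m - p by rewrite subr_ge0 (p_esc_le iidP).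
  apply: (@le_trans _ _ (esc_lim m - p + ((1 - p) ^+ r.+1 + r%:R * (esc_lim m - p)))).
    rewrite lerD2l exprS; case/andP: p1 => p1 p2.
    apply: le_trans (ler_wpM2l p1 IH) _; rewrite mulrDr lerD2l.
    by rewrite ler_piMl ?mulr_ge0// ltW.
  by rewrite addrCA -[r.+1%:R]natr1 mulrDl mul1r [_ + r%:R * _]addrC.
have e2 : 0 < e / 2 by rewrite divr_gt0.
have [r hr] := expr_small p1 e2.
have [K hK] := p_esc_approx iidP (divr_gt0 e2 (ltr0Sn R r)).
exists K.+1, r; split => //; apply: le_trans (le_bound _ _) _.
have : r%:R * (esc_lim K.+1 - p) <= e / 2.
  have := hK K.+1 (leqnSn K); rewrite -ltrBlDl => /ltW h.
  apply: (@le_trans _ _ (r.+1%:R * (esc_lim K.+1 - p))).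
    by rewrite ler_wpM2r ?subr_ge0 ?(p_esc_le iidP)// ler_nat.
  by rewrite mulrC -ler_pdivlMr.
lra.
Qed.

Lemma expect_fall_start (b m r n : nat) : (0 < m)%N ->
  E (fun w => fall_value (cookie w) b%:Z r m n [:: 0]) <= fall_bound m r.
Proof.
move=> m0; set S := @above Y b%:Z.
pose F h w := (S h)%:R * fall_value (cookie w) b%:Z r m n h.
pose G h (w : borel_env hk) := fall_bound m r * (S h)%:R : R.
have pF h : poly predT (F h) by apply: polyM; [exact: poly_cst|exact: poly_fall].
have pG h : poly predT (G h) by exact: poly_cst.
apply: (@le_trans _ _ (E (fun w => V w S (F^~ w) n [:: 0]))).
  apply: expect_le => [||w].
  - exact: (poly_bm iidP (@poly_fall _ _ _ hk _ _ _ _ _)).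
  - by apply: (@poly_bm _ _ _ _ _ iidP predT); exact: poly_valueT.
  - exact: (fall_start kappa_gt0 (adm w)).
apply: (@le_trans _ _ (E (fun w => V w S (G^~ w) n [:: 0]))); last first.
  rewrite -[leRHS](expect_cst P); apply: expect_le => [||w].
  - by apply: (@poly_bm _ _ _ _ _ iidP predT); exact: poly_valueT.
  - exact: bm_cst.
  - have := valueZ (cookie w) S (fall_bound m r) (fun h => (S h)%:R) n [:: 0].
    rewrite /G => ->; rewrite ler_piMr ?fall_bound_ge0//.
    exact: (value_bool_le1 kappa_gt0 (adm w)).
pose I h := [/\ h != [::], {in behead h, forall x, height x < b%:Z}
  & ht h <= b%:Z].
have mul1E f : E f = E (fun w => 1 * f w).
  by apply: expect_ext => w; rewrite mul1r.
rewrite mul1E [leRHS]mul1E.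
apply: (@expect_tower _ _ _ _ _ iidP I b%:Z) => //; last exact: poly_cst.
- move=> h' a [h'0 h'b h'k]; rewrite /S aboveN /beneath => {}h'k; split => //.
    case: h' h'0 h'b h'k => //= y h' _ h'b yk z; rewrite inE => /orP[/eqP->//|].
    exact: h'b.
  by have := ht_extend_le h' a; lia.
- by move=> h' _; rewrite /S aboveN.
- move=> h' W' [h'0 h'b h'k] pW' W'0; rewrite /F /G.
  case: (boolP (S h')) => [Sh'|_]; last first.
    by under eq_fun do rewrite mul0r mulr0; under [X in _ <= E X]eq_fun do rewrite !mulr0.
  have {}h'k : ht h' = b%:Z by apply/eqP; rewrite eq_le h'k.
  under eq_fun do rewrite mul1r.
  rewrite [leRHS](expect_ext P (g := fun w => fall_bound m r * W' w)); last first.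
    by move=> w; rewrite mulr1 mulrC.
  by rewrite expectZ; [exact: expect_fall|exact: (poly_bm iidP pW')].
- by split; rewrite // /ht /= height0.
Qed.
End falls.

(** * Trajectories of the excited random walk *)

Section trajectories.
Variable Y : state_space.
Implicit Types (X : nat -> site Y) (n m : nat) (h : seq (site Y)).
Implicit Types (S f : seq (site Y) -> bool).

Fixpoint trace X n := if n is n'.+1 then X n :: trace X n' else [:: X 0%N].

Lemma eq_trace X X' n : (forall m, (m <= n)%N -> X m = X' m) ->
  trace X n = trace X' n.
Proof.
elim: n => [|n IH] E /=; first by rewrite E.
by rewrite E// IH// => m mn; rewrite E// ltnW.
Qed.

Lemma trace_neq0 X n : trace X n != [::]. Proof. by case: n. Qed.

Lemma pos_trace X n : pos (trace X n) = X n. Proof. by case: n. Qed.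

Lemma ht_trace X n : ht (trace X n) = height (X n).
Proof. by rewrite /ht pos_trace. Qed.

Lemma count_trace (Q : pred (site Y)) X n :
  count Q (trace X n) = (\sum_(m < n.+1) Q (X m))%N.
Proof.
elim: n => [|n IH]; first by rewrite big_ord_recr big_ord0 /= addn0.
by rewrite big_ord_recr /= IH addnC.
Qed.

Lemma visits_trace X n : visits X n = (prior (trace X n)).+1.
Proof.
rewrite -prior_count ?trace_neq0// count_trace /visits -sum1dep_card big_mkcond.
by apply: eq_bigr => m _; rewrite pos_trace /=; case: eqP.
Qed.

(* The pathwise counterpart of [value]. *)
Fixpoint run (S f : seq (site Y) -> bool) X m n : bool :=
  if m is m'.+1 then
    if S (trace X n) then f (trace X n) else run S f X m' n.+1
  else f (trace X n).

Lemma run_first S f X n j : (forall m, ~~ run S f X m n) -> S (trace X (n + j)) ->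
  exists i, S (trace X i) && ~~ f (trace X i).
Proof.
elim: j n => [|j IH] n nrun; rewrite ?addn0 => Sn.
  by exists n; rewrite Sn (nrun 0%N).
have [Sn'|Sn'] := boolP (S (trace X n)).
  by exists n; rewrite Sn' (nrun 0%N).
apply: (IH n.+1); last by rewrite addSnnS.
by move=> m; have := nrun m.+1; rewrite /= (negbTE Sn').
Qed.

Lemma run_never S f X m n : (forall j, ~~ S (trace X j)) ->
  run S f X m n = f (trace X (n + m)).
Proof.
move=> nS; elim: m n => [|m IH] n /=; rewrite ?addn0// (negbTE (nS n)) IH.
by rewrite addSnnS.
Qed.

Lemma run_horizon S f X m m' n : (forall h, f h -> S h) -> (m <= m')%N ->
  run S f X m n -> run S f X m' n.
Proof.
move=> fS; elim: m m' n => [|m IH] [|m'] n //= mm.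
  by move=> fn; rewrite (fS _ fn).
by case: ifP => // _; exact: IH.
Qed.

End trajectories.

(** * Finite-horizon values as bounds for the walk in a fixed environment *)

Section excited_walk.
Variables (Y : state_space) (R : realType) (kappa : R).
Variable hk : 0 < kappa <= (2 * site_dim Y)%:R^-1.
Variable w : borel_env hk.
Context d (T : measurableType d) (P : probability T R) (X : nat -> T -> site Y).
Hypothesis erw : is_ERW P X 0 w.
Implicit Types (n m : nat) (h : seq (site Y)) (t : T).

Let kappa_gt0 : 0 < kappa. Proof. by case/andP: hk. Qed.
Let adm : admissible kappa (cookie w). Proof. exact: cookie_admissible. Qed.

Let at_trace n h : set T := [set t | trace (X ^~ t) n = h].

Lemma measurable_at_trace n h : measurable (at_trace n h).
Proof.
case: erw => mX _ _.
have mX1 n' x : measurable [set t | X n' t = x] by exact: (mX n' [set x]).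
elim: n h => [|n IH] h; rewrite /at_trace.
  case: h => [|x [|y h]]; last 2 first.
  - rewrite (_ : mkset _ = [set t | X 0%N t = x])//.
    by apply/seteqP; split => t /= [->].
  - by rewrite (_ : mkset _ = set0)//; apply/seteqP; split => t //= [].
  by rewrite (_ : mkset _ = set0)//; apply/seteqP; split => t.
case: h => [|x h]; first by rewrite (_ : mkset _ = set0)//; apply/seteqP; split.
rewrite (_ : mkset _ = [set t | X n.+1 t = x] `&` at_trace n h).
  exact: measurableI.
apply/seteqP; split => t /= [E1 E2]; first by split.
by rewrite E1; congr (_ :: _); exact: E2.
Qed.

(** Histories are countable through codes of sites, so the event is a countable union of events that
    fix the trajectory up to time [n]. *)
Lemma measurable_trace n (Q : pred (seq (site Y))) :
  measurable [set t | Q (trace (X ^~ t) n)].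
Proof.
have [code inj] := site_embedding Y.
pose pick (i : nat) : set T := [set t | Q (trace (X ^~ t) n) /\
  choice.pickle [seq code x | x <- trace (X ^~ t) n] = i].
have -> : [set t | Q (trace (X ^~ t) n)] = \bigcup_i pick i.
  apply/seteqP; split => [t Qt|t [i _ []]//].
  by exists (choice.pickle [seq code x | x <- trace (X ^~ t) n]).
apply: bigcup_measurable => i _.
have [[h [Qh hi]]|no] := pselect (exists h, Q h /\
    choice.pickle [seq code x | x <- h] = i); last first.
  rewrite (_ : pick i = set0)//; apply/seteqP; split => t //= [Qt ti].
  by apply: no; exists (trace (X ^~ t) n).
rewrite (_ : pick i = at_trace n h); first exact: measurable_at_trace.
apply/seteqP; split => t; rewrite /pick /at_trace /=; last by move=> ->.
move=> [Qt]; rewrite -hi => /(pcan_inj choice.pickleK).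
exact: inj_map.
Qed.

Let fin_P (A : set T) : measurable A -> P A \is a fin_num.
Proof.
by move=> mA; rewrite ge0_fin_numE// (le_lt_trans (probability_le1 P mA))// ltry.
Qed.

Lemma walk_step n h a : h != [::] ->
  P (at_trace n.+1 (extend h a)) =
  ((\sum_(b | shiftv b == shiftv a) cookie w (pos h) b (prior h))%:E *
    P (at_trace n h))%E.
Proof.
move=> h0; case: erw => _ _ /(_ n a) [_ cond].
have hist : history X n (at_trace n h).
  exists [set g : 'I_n.+1 -> site Y | trace (fun m => g (inord m)) n = h] => //.
  rewrite setTI; apply/seteqP; split => t; rewrite /at_trace /=;
    rewrite (eq_trace (X' := X ^~ t))// => m mn; by rewrite inordK.
have := cond _ hist.
rewrite (_ : _ `&` _ = at_trace n.+1 (extend h a)); last first.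
  apply/seteqP; split => t; rewrite /at_trace /=.
    move=> [E1 E2]; have {}E1 : trace (X ^~ t) n = h := E1.
    by rewrite E2 -E1 /extend pos_trace.
  by move=> [E1 E2]; split => //; rewrite E1 -E2 pos_trace.
move=> <-; rewrite -integral_cst; last exact: measurable_at_trace.
apply: eq_integral => t; rewrite inE /at_trace /= => <-; congr EFin.
by rewrite visits_trace pos_trace.
Qed.

Let S_ := seq (site Y) -> bool.

Lemma measurable_run (S f : S_) m n : measurable [set t | run S f (X ^~ t) m n].
Proof.
elim: m n => [|m IH] n /=; first exact: measurable_trace.
rewrite (_ : mkset _ =
    [set t | S (trace (X ^~ t) n) && f (trace (X ^~ t) n)] `|`
    ([set t | ~~ S (trace (X ^~ t) n)] `&` [set t | run S f (X ^~ t) m n.+1])).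
  apply: measurableU; first exact: (measurable_trace n (fun h => S h && f h)).
  by apply: measurableI => //; exact: (measurable_trace n (fun h => ~~ S h)).
apply/seteqP; split => t /=; case: (S _) => //=.
- by left.
- by right.
- by case=> [//|[]].
- by case=> [//|[]].
Qed.

(** The event is split by the next site. Sites rather than directions are enumerated because two
    directions may lead to the same site; trajectories that make any other move are null, as the
    one-step probabilities add up to 1. *)
Lemma run_le_value (S f : S_) m n h : h != [::] ->
  (P (at_trace n h `&` [set t | run S f (X ^~ t) m n]) <=
   P (at_trace n h) * (value (cookie w) S (fun h => (f h)%:R) m h)%:E)%E.
Proof.
have mAR m' n' h' : measurable (at_trace n' h' `&` [set t | run S f (X ^~ t) m' n']).
  by apply: measurableI; [exact: measurable_at_trace|exact: measurable_run].
have stop m' n' h' : (forall t, at_trace n' h' t -> run S f (X ^~ t) m' n' = f h') ->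
    (P (at_trace n' h' `&` [set t | run S f (X ^~ t) m' n']) <=
     P (at_trace n' h') * ((f h')%:R)%:E)%E.
  move=> E; case: (boolP (f h')) => fh; rewrite ?mule1 ?mule0.
    by apply: le_measure; rewrite ?inE; [exact: mAR|exact: measurable_at_trace|move=> t []].
  rewrite (_ : _ `&` _ = set0) ?measure0//; apply/seteqP; split => t //= [/E->].
  by apply/negP.
elim: m n h => [|m IH] n h h0; first by apply: stop => t /= ->.
rewrite [value _ _ _ _ _]/=; case: (boolP (S h)) => Sh.
  by apply: (stop m.+1) => t /= ->; rewrite Sh.
pose moves := undup [seq pos h + shiftv a | a <- enum (dir Y)].
pose next y := at_trace n.+1 (y :: h) `&` [set t | run S f (X ^~ t) m n.+1].
pose stray := at_trace n h `\` \big[setU/set0]_(y <- moves) at_trace n.+1 (y :: h).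
pose cy (y : site Y) : R :=
  \sum_(b | pos h + shiftv b == y) cookie w (pos h) b (prior h).
have P_next y : y \in moves -> P (at_trace n.+1 (y :: h)) = ((cy y)%:E * P (at_trace n h))%E.
  rewrite mem_undup => /mapP[a _ ->]; rewrite -[_ :: h]/(extend h a) walk_step//.
  congr (_%:E * _)%E; apply: eq_bigl => b; by rewrite (inj_eq (addrI _)).
have sum_moves (F : dir Y -> R) :
    \sum_(y <- moves) \sum_(b | pos h + shiftv b == y) F b = \sum_b F b.
  under eq_bigr do rewrite big_mkcond.
  rewrite exchange_big /=; apply: eq_bigr => b _.
  rewrite (bigD1_seq (pos h + shiftv b))/= ?undup_uniq//; last first.
    by rewrite mem_undup; apply/mapP; exists b; rewrite ?mem_enum.
  by rewrite eqxx big1 ?addr0// => y; rewrite eq_sym => /negbTE->.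
have mU : measurable (\big[setU/set0]_(y <- moves) at_trace n.+1 (y :: h)).
  by apply: bigsetU_measurable => y _; exact: measurable_at_trace.
have sub (s : seq (site Y)) :
    \big[setU/set0]_(y <- s) at_trace n.+1 (y :: h) `<=` at_trace n h.
  by elim/big_ind: _ => // [A B AA BB t [/AA|/BB]//|y _ t]; rewrite /at_trace /= => -[].
have P_moves : P (\big[setU/set0]_(y <- moves) at_trace n.+1 (y :: h)) = P (at_trace n h).
  transitivity (\sum_(y <- moves) P (at_trace n.+1 (y :: h)))%E.
    have := undup_uniq [seq pos h + shiftv a | a <- enum (dir Y)]; rewrite -/moves.
    elim: (moves) => [|y s IHs]; first by rewrite !big_nil measure0.
    rewrite /= !big_cons => /andP[ys us]; rewrite -IHs// measureU//.
    - exact: measurable_at_trace.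
    - by apply: bigsetU_measurable => z _; exact: measurable_at_trace.
    apply/seteqP; split => t // [yt zt]; case/negP: ys.
    elim: (s) zt => [|z s' IHs']; rewrite ?big_nil// big_cons inE => -[zt|/IHs'->].
      by move: yt zt; rewrite /at_trace /= => -[-> _] [-> _]; rewrite eqxx.
    by rewrite orbT.
  rewrite (eq_big_seq (fun y => ((cy y)%:E * P (at_trace n h)))%E)//.
  rewrite -(fineK (fin_P (measurable_at_trace n h))).
  under eq_bigr do rewrite -EFinM.
  by rewrite sumEFin -mulr_suml sum_moves (adm_sum adm) mul1r.
have P_stray : P stray = 0%E.
  rewrite measureD//; last 2 first.
  - exact: measurable_at_trace.
  - by rewrite ltey_eq fin_P//; exact: measurable_at_trace.
  rewrite (setIidr (@sub moves)).
  by rewrite [X in (_ - X)%E]P_moves subee// fin_P//; exact: measurable_at_trace.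
have union_bound (s : seq (site Y)) :
    (P (\big[setU/set0]_(y <- s) next y) <= \sum_(y <- s) P (next y))%E.
  elim: s => [|y s IHs]; first by rewrite !big_nil measure0.
  rewrite !big_cons; apply: le_trans (leeD2l _ IHs); apply: measureU2.
    exact: mAR.
  by apply: bigsetU_measurable => z _; exact: mAR.
apply: (@le_trans _ _ (P (\big[setU/set0]_(y <- moves) next y `|` stray))).
  apply: le_measure; rewrite ?inE.
  - exact: (mAR m.+1).
  - apply: measurableU; first by apply: bigsetU_measurable => z _; exact: mAR.
    by apply: measurableD => //; exact: measurable_at_trace.
  move=> t [th]; rewrite /= th (negbTE Sh) => tr.
  have [tU|tU] := pselect ((\big[setU/set0]_(y <- moves) at_trace n.+1 (y :: h)) t).
    left; elim: (moves) tU => [|y s IHs]; rewrite ?big_nil// !big_cons => -[yt|/IHs].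
      by left.
    by right.
  by right; split.
apply: (@le_trans _ _ (P (\big[setU/set0]_(y <- moves) next y) + P stray)%E).
  apply: measureU2; first by apply: bigsetU_measurable => z _; exact: mAR.
  by apply: measurableD => //; exact: measurable_at_trace.
rewrite P_stray adde0; apply: (le_trans (union_bound _)).
rewrite -(fineK (fin_P (measurable_at_trace n h))) -EFinM.
set pA := fine _.
apply: (@le_trans _ _ (\sum_(y <- moves) (cy y * pA *
    value (cookie w) S (fun h => (f h)%:R) m (y :: h))%:E)%E).
  rewrite !big_seq; apply: lee_sum => y ym.
  apply: (@le_trans _ _ (P (at_trace n.+1 (y :: h)) *
    (value (cookie w) S (fun h => (f h)%:R) m (y :: h))%:E)%E); first exact: IH.
  by rewrite P_next// -(fineK (fin_P (measurable_at_trace n h))) -!EFinM.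
rewrite sumEFin lee_fin le_eqVlt; apply/orP; left; apply/eqP.
rewrite mulr_sumr -sum_moves; apply: eq_bigr => y _; rewrite /cy mulrAC mulr_suml mulr_suml.
by apply: eq_bigr => b /eqP <-; rewrite /extend; ring.
Qed.

Lemma run_le_start (S f : S_) m :
  (P [set t | run S f (X ^~ t) m 0] <=
   (value (cookie w) S (fun h => (f h)%:R) m [:: 0])%:E)%E.
Proof.
case: erw => mX X0 _.
have A0 : at_trace 0 [:: 0] = X 0%N @^-1` [set 0].
  by apply/seteqP; split => t; rewrite /at_trace /=; [case|move=> ->].
have mA0 : measurable (at_trace 0 [:: 0]) by exact: measurable_at_trace.
have mR := measurable_run S f m 0.
rewrite -[X in (X <= _)%E]adde0.
set A := at_trace 0 [:: 0] in A0 mA0; pose B : set T := [set t | run S f (X ^~ t) m 0].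
have PA0 : P A = 1%E by rewrite A0.
have PC0 : P (~` A) = 0%E by rewrite probability_setC// PA0 subee.
apply: (@le_trans _ _ (P ((A `&` B) `|` ~` A))).
  rewrite adde0; apply: le_measure; rewrite ?inE//.
    by apply: measurableU; [exact: measurableI|exact: measurableC].
  by move=> t tr; have [?|?] := pselect (A t); [left|right].
apply: (@le_trans _ _ (P (A `&` B) + P (~` A))%E).
  by apply: measureU2; [exact: measurableI|exact: measurableC].
rewrite PC0 adde0; apply: (@le_trans _ _ (P A *
    (value (cookie w) S (fun h => (f h)%:R) m [:: 0%R])%:E)%E).
  exact: run_le_value.
by rewrite PA0 mul1e.
Qed.

Lemma run_ae (S f : nat -> S_) (m : nat -> nat -> nat) :
  (forall K n n' Z, (n <= n')%N -> run (S K) (f K) Z (m K n) 0 ->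
     run (S K) (f K) Z (m K n') 0) ->
  (forall e, 0 < e -> exists K, forall n,
     value (cookie w) (S K) (fun h => (f K h)%:R) (m K n) [:: 0] <= e) ->
  {ae P, forall t, exists K, forall n, ~~ run (S K) (f K) (X ^~ t) (m K n) 0}.
Proof.
move=> mono small.
pose u K n t : R := \1_[set t | run (S K) (f K) (X ^~ t) (m K n) 0] t.
have uE K n t : u K n t = (run (S K) (f K) (X ^~ t) (m K n) 0)%:R.
  by rewrite /u indicE; congr (nat_of_bool _)%:R; apply/idP/idP; rewrite inE.
have := @ae_small _ _ _ P u; case=> [K n|K n t|K n n' t nn|e e0|].
- by apply: bm_indic; exact: measurable_run.
- by rewrite uE.
- by rewrite !uE ler_nat; case: (boolP (run _ _ _ (m K n) _)) => // /(mono _ _ _ _ nn)->.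
- have [K hK] := small e e0; exists K => n; apply: le_trans (hK n).
  rewrite expect_indic; last exact: measurable_run.
  by rewrite -lee_fin fineK ?run_le_start//; apply: fin_P; exact: measurable_run.
move=> A [mA PA sA]; exists A; split => //.
(* An indicator that is at most 1/2 vanishes. *)
apply: subset_trans sA => t; apply: contra_not => /(_ (1 / 2)) [|K hK].
  by rewrite divr_gt0.
exists K => n; apply/negP => r; have : 1 <= 1 / 2 :> R by have := hK n; rewrite uE r.
lra.
Qed.
End excited_walk.

(** * Transience and recurrence *)

Section limits.
Variable R : realType.
Implicit Types u : nat -> int.

Lemma unbounded_frequently u : (forall k : nat, exists n, k%:Z <= u n) ->
  forall k M : nat, exists2 n, (M <= n)%N & k%:Z <= u n.
Proof.
move=> unb k M; elim: M k => [|M IH] k; first by have [n] := unb k; exists n.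
have [n Mn un] := IH (maxn k `|u M|.+1); exists n; last by lia.
by rewrite ltn_neqAle Mn andbT; apply/eqP => E; rewrite -E in un; lia.
Qed.

Lemma unbounded_limn_esup u : (forall k : nat, exists n, k%:Z <= u n) ->
  limn_esup (fun n => (u n)%:~R%:E : \bar R) = +oo%E.
Proof.
move=> /unbounded_frequently unb; rewrite limn_esup_lim.
rewrite (_ : esups _ = cst +oo%E) ?lim_cst//.
apply/funext => n; apply: eq_infty => r.
have [i ni ui] := unb (Num.bound `|r|) n.
apply: (@le_trans _ _ (u i)%:~R%:E); last by apply: ereal_sup_ubound; exists i.
rewrite lee_fin (le_trans (ler_norm r))// (le_trans (ltW (archi_boundP _)))//.
by rewrite pmulrn ler_int.
Qed.

Lemma unbounded_limn_einf u : (forall k : nat, exists n, u n <= - k%:Z) ->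
  limn_einf (fun n => (u n)%:~R%:E : \bar R) = -oo%E.
Proof.
move=> unb; rewrite /limn_einf.
rewrite [X in limn_esup X](_ : _ = fun n => (- u n)%:~R%:E); last first.
  by apply/funext => n; rewrite /= mulrNz EFinN.
rewrite unbounded_limn_esup// => k; have [n un] := unb k; exists n; lia.
Qed.

End limits.

Lemma infinite_visits (Y : state_space) (X : nat -> site Y) (x : site Y) :
  (forall I, exists n, (I <= count_mem x (trace X n))%N) ->
  infinite_set [set n | X n = x].
Proof.
move=> often /finite_seqP[s sE]; pose M := (\max_(i <- s) i).+1.
have late i : (M <= i)%N -> X i != x.
  move=> Mi; apply/eqP => Xi.
  have : i \in s by have : [set n | X n = x] i by []; rewrite sE.
  by move=> /(@leq_bigmax_seq _ s predT id i)/(_ isT); rewrite leqNgt Mi.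
have few n : (count_mem x (trace X n) <= minn n.+1 M)%N.
  elim: n => [|n IH] /=; first by rewrite addn0; case: eqP => // _; rewrite leq_min.
  have [nM|nM] := ltnP n.+1 M.
    rewrite leq_min in IH; have [IH1 _] := andP IH.
    have IH2 : ((X n.+1 == x) + count_mem x (trace X n) <= n.+2)%N.
      exact: (@leq_add _ _ 1 n.+1 (leq_b1 _) IH1).
    by rewrite leq_min IH2 (leq_trans IH2).
  by rewrite (negbTE (late _ nM)) (leq_trans IH)// leq_min geq_minr andbT; lia.
have [n] := often M.+1; have := few n; rewrite leq_min => /andP[_].
by move=> /leq_ltn_trans h /h; rewrite ltnn.
Qed.

Section drift_series.
Variables (Y : state_space) (R : realType) (kappa : R).
Variable hk : 0 < kappa <= (2 * site_dim Y)%:R^-1.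
Variable P : probability (borel_env hk) R.
Hypothesis iidP : is_iid P (@omega_at Y R kappa hk).

Let adm (w : borel_env hk) : admissible kappa (cookie w).
Proof. exact: cookie_admissible. Qed.

Lemma integral_delta :
  (\int[P]_w delta 0 w = \sum_(0 <= i <oo) (mean_drift P i)%:E)%E.
Proof.
pose f i (w : borel_env hk) := (drift (cookie w) 0 i)%:E.
have f0 i w : (0 <= f i w)%E by rewrite lee_fin (drift_ge0 (adm w)).
rewrite (_ : delta _ = fun w => \sum_(0 <= i <oo) f i w)%E; last first.
  apply/funext => w; rewrite /delta.
  rewrite -(@nneseries_addn _ (fun i => (\sum_a omega w 0 a i * (dot_ell a)%:~R)%:E) 1).
    by apply: eq_eseriesr => i _; rewrite addn1.
  case=> [|i]; last exact: f0.
  rewrite (_ : (\sum_a _)%:E = f 0%N w); first exact: f0.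
  by [].
rewrite integral_nneseries//; last first.
  by move=> i; apply/measurable_EFinP; case: (bm_drift iidP 0 i).
apply: eq_eseriesr => i _; rewrite /mean_drift /expect /Rintegral fineK//.
apply: integrable_fin_num => //; apply: bounded_measurable_integrable.
exact: (bm_drift iidP).
Qed.

(** Partial sums bring the criterion down to finitely many cookies, where the polynomial estimates
    apply. *)
Lemma mean_level_drift_le1 :
  (\int[P]_w delta 0 w <= ((width Y)%:R^-1)%:E)%E <->
  forall I, mean_level_drift P I <= 1.
Proof.
have L0 : 0 < (width Y)%:R :> R by rewrite ltr0n width_gt0.
have m0 i : (0 <= (mean_drift P i)%:E)%E by rewrite lee_fin (mean_drift_ge0 P).
have sumE I : (\sum_(0 <= i < I) mean_drift P i <= (width Y)%:R^-1) =
    (mean_level_drift P I <= 1).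
  by rewrite /mean_level_drift mulrC -ler_pdivlMr// div1r.
rewrite integral_delta; split => [le1 I|le1].
  rewrite -sumE -lee_fin -sumEFin; apply: le_trans le1.
  exact: nneseries_lim_ge.
apply: lime_le; first exact: is_cvg_nneseries.
by apply: nearW => I; rewrite sumEFin lee_fin sumE.
Qed.

End drift_series.

Section quenched.
Variables (Y : state_space) (R : realType) (kappa : R).
Variable hk : 0 < kappa <= (2 * site_dim Y)%:R^-1.
Variable w : borel_env hk.
Context d (T : measurableType d) (P : probability T R) (X : nat -> T -> site Y).
Hypothesis erw : is_ERW P X 0 w.
Implicit Types (n m : nat) (h : seq (site Y)) (t : T).

Let kappa_gt0 : 0 < kappa. Proof. by case/andP: hk. Qed.
Let adm : admissible kappa (cookie w). Proof. exact: cookie_admissible. Qed.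

(** Valid in every environment. The index [K] is here the number of steps, and [k.+1] meets the
    requirement of a positive level. *)
Lemma walk_unbounded_above :
  {ae P, forall t, forall k : nat, exists n, k%:Z <= height (X n t)}.
Proof.
apply: ae_foralln => k.
apply: filterS (run_ae erw (S := fun=> @above Y k.+1%:Z)
  (f := fun _ h => ~~ above k.+1%:Z h) (m := fun K _ => K) _ _) => //.
  move=> t [K /(_ 0%N) nrun]; apply: contrapT => low; case/negP: nrun.
  have nS j : ~~ above k.+1%:Z (trace (X ^~ t) j).
    apply/negP; rewrite /above ht_trace => high; apply: low; exists j; lia.
  by rewrite run_never.
move=> e e0; have [n hn] := hitting_time_small hk (k := k.+1) isT e0.
exists n => _; have := hn w; congr (_ <= _); congr (value _ _ _ _ _).
by apply/funext => h; rewrite aboveN.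
Qed.

Lemma trace_ae (S f : nat -> seq (site Y) -> bool) :
  (forall K h, f K h -> S K h) ->
  (forall e, 0 < e -> exists K, forall n,
     value (cookie w) (S K) (fun h => (f K h)%:R) n [:: 0] <= e) ->
  {ae P, forall t, exists K, forall j, S K (trace (X ^~ t) j) ->
     exists i, S K (trace (X ^~ t) i) && ~~ f K (trace (X ^~ t) i)}.
Proof.
move=> fS small.
apply: filterS (run_ae erw (S := S) (f := f) (m := fun _ n => n) _ small).
  by move=> t [K nrun]; exists K => j; exact: run_first nrun.
by move=> K n n' Z; apply: run_horizon; exact: fS.
Qed.

(** Some depth of fall below [b] never occurs; once the walk has been that high, as it will be, it
    stays at or above [b]. *)
Lemma falls_transient (rm : nat -> nat * nat) :
  (forall (b : nat) e, 0 < e -> exists K, forall n,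
     fall_value (cookie w) b%:Z (rm K).1 (rm K).2 n [:: 0] <= e) ->
  {ae P, forall t, ((height (X n t))%:~R : R) @[n --> \oo] --> +oo%R}.
Proof.
move=> small; have no_fall : {ae P, forall t, forall b : nat, exists r m,
    forall j, ~~ falls b%:Z r m (trace (X ^~ t) j)}.
  apply: ae_foralln => b; pose S K := @falls Y b%:Z (rm K).1 (rm K).2.
  apply: filterS (@trace_ae S S (fun _ _ => id) (small b)) => t [K nS].
  exists (rm K).1, (rm K).2 => j; apply/negP => /nS[i].
  by rewrite andbN.
apply: filterS2 no_fall walk_unbounded_above => t no_fall high.
apply/cvgryPge => A; have [r [m nf]] := no_fall (Num.bound `|A|).
have [n0 hn0] := high (Num.bound `|A| + r * m)%N.
exists n0 => // n /= n0n; apply: le_trans (ler_norm A) _.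
apply: (le_trans (ltW (archi_boundP _))) => //.
rewrite pmulrn ler_int leNgt; apply/negP => low; have /negP := nf n; apply.
rewrite /falls /beneath ht_trace low /=; apply/hasP; exists (X n0 t) => //.
have [i ->] : exists i, n = (n0 + i)%N by exists (n - n0)%N; rewrite subnKC.
elim: i => [|i IH]; last by rewrite addnS inE IH orbT.
by rewrite addn0; case: (n0) => [|k]; rewrite inE eqxx.
Qed.

Section few_entries.
Hypothesis few_entries : forall (N : nat) e, 0 < e -> exists K, forall n,
  value (cookie w) (above K.+1%:Z)
    (fun h => (above K.+1%:Z h && (entries 0 h <= N)%N)%:R) n [:: 0] <= e.

(** Level [K.+1] is reached and, for a suitable [K], not before more than [N] entries below 0. *)
Lemma entries_unbounded :
  {ae P, forall t, forall N, exists i, (N < entries 0 (trace (X ^~ t) i))%N}.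
Proof.
apply: ae_foralln => N.
apply: filterS2 walk_unbounded_above (@trace_ae (fun K => @above Y K.+1%:Z)
  (fun K h => above K.+1%:Z h && (entries 0 h <= N)%N) _ (few_entries N)).
  move=> t high [K first]; have [j hj] := high K.+1.
  have [|i] := first j; first by rewrite /above ht_trace.
  by move=> /andP[->] /=; rewrite -ltnNge; exists i.
by move=> K h /andP[].
Qed.

(** Entries are unbounded, and the geometric factor [x ^+ N] beats the fixed [2 ^+ I]. *)
Lemma targets_unbounded (Q : pred (site Y)) (I : nat) (x : R) : 0 <= x < 1 ->
  (forall N n, value (cookie w) (fun h => N < entries 0 h)%N
     (fun h => ((N < entries 0 h) && (count Q h < I))%N%:R) n [:: 0] <=
     x ^+ N * 2 ^+ I) ->
  {ae P, forall t, exists n, (I <= count Q (trace (X ^~ t) n))%N}.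
Proof.
move=> x01 bound; apply: filterS2 entries_unbounded (@trace_ae
  (fun N h => N < entries 0 h)%N
  (fun N h => (N < entries 0 h) && (count Q h < I))%N _ _).
- move=> t many [N]; have [j hj] := many N; move=> /(_ j hj)[i /andP[->]] /=.
  by rewrite -leqNgt; exists i.
- by move=> N h /andP[].
move=> e e0; have I0 : (0 : R) < 2 ^+ I by rewrite exprn_gt0.
have [N hN] := expr_small x01 (divr_gt0 e0 I0).
exists N => n; apply: le_trans (bound N n) _.
by rewrite -ler_pdivlMr.
Qed.

Let kappa_power i : 0 <= 1 - kappa ^+ i / 2 < 1.
Proof.
have k1 : kappa ^+ i <= 1.
  by rewrite exprn_ile1 ?(ltW kappa_gt0)// ltW ?(kappa_lt1 kappa_gt0 adm).
by have : 0 < kappa ^+ i by [rewrite exprn_gt0]; lra.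
Qed.

Lemma walk_returns : {ae P, forall t, infinite_set [set n | X n t = 0]}.
Proof.
have often : {ae P, forall t, forall I, exists n,
    (I <= count_mem 0%R (trace (X ^~ t) n))%N}.
  apply: ae_foralln => I; apply: targets_unbounded (kappa_power (width Y).+1) _ => N n.
  have := @visits_bound _ _ _ _ kappa_gt0 adm (fun h => N < entries 0 h)%N 0 0 n N I.
  by rewrite height0.
by apply: filterS often => t; exact: infinite_visits.
Qed.

Lemma walk_unbounded_below :
  {ae P, forall t, forall m : nat, exists n, height (X n t) <= - m%:Z}.
Proof.
apply: ae_foralln => m.
have low : {ae P, forall t, exists n,
    (1 <= count (below m) (trace (X ^~ t) n))%N}.
  apply: targets_unbounded (kappa_power m.+1) _ => N n.
  exact: (descent_bound kappa_gt0 adm).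
apply: filterS low => t [n].
rewrite -has_count => /hasP[x xn]; rewrite /below => xm.
elim: n xn => [|n IH]; rewrite inE; first by move/eqP => xE; exists 0%N; rewrite -xE.
by case/orP => [/eqP xE|/IH//]; exists n.+1; rewrite -xE.
Qed.

End few_entries.
End quenched.

Section annealed_to_quenched.
Variables (Y : state_space) (R : realType) (kappa : R).
Variable hk : 0 < kappa <= (2 * site_dim Y)%:R^-1.
Variable P : probability (borel_env hk) R.
Hypothesis iidP : is_iid P (@omega_at Y R kappa hk).

Let kappa_gt0 : 0 < kappa. Proof. by case/andP: hk. Qed.
Let adm (w : borel_env hk) : admissible kappa (cookie w).
Proof. exact: cookie_admissible. Qed.

Lemma ae_value_small (S f : nat -> seq (site Y) -> bool) :
  (forall K h, f K h -> S K h) ->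
  (forall e, 0 < e -> exists K, forall n,
     expect P (fun w => value (cookie w) (S K) (fun h => (f K h)%:R) n [:: 0]) <= e) ->
  {ae P, forall w, forall e, 0 < e -> exists K, forall n,
     value (cookie w) (S K) (fun h => (f K h)%:R) n [:: 0] <= e}.
Proof.
move=> fS; apply: ae_small => [K n|K n w|K n m w nm].
- exact: (bm_value_bool iidP).
- exact: (value_bool_ge0 kappa_gt0 (adm w)).
apply: (value_horizon kappa_gt0 (adm w)) => // h.
by apply: contraNeq; rewrite pnatr_eq0 eqb0 negbK; exact: fS.
Qed.

Lemma p_esc_gt0_transient : 0 < p_esc P -> {ae P, forall w, transient w}.
Proof.
(* [rm] enumerates the pairs [(r, m)] by the single integer index that [ae_small] allows; integers
   that code no pair are sent to (0, 0). *)
move=> p0; pose rm K : nat * nat := odflt (0, 0)%N (choice.unpickle K).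
have small : {ae P, forall w, forall (b : nat) e, 0 < e -> exists K, forall n,
    fall_value (cookie w) b%:Z (rm K).1 (rm K).2 n [:: 0] <= e}.
  apply: ae_foralln => b; pose S K := @falls Y b%:Z (rm K).1 (rm K).2.
  apply: (@ae_value_small S S) => // e e0.
  have [m [r [m0 le_e]]] := fall_bound_small iidP p0 e0.
  exists (choice.pickle (r, m)) => n; rewrite /S /rm choice.pickleK /=.
  exact: le_trans (expect_fall_start iidP b r n m0) le_e.
apply: filterS small => w small d T Q X erw.
exact: (falls_transient erw small).
Qed.

(** Escape over many levels has probability close to [p = 0], small enough for large [K] to beat the
    fixed price [C] of the forced paths. *)
Lemma p_esc_eq0_recurrent : p_esc P = 0 ->
  {ae P, forall w, recurrent w /\ oscillating w}.
Proof.
move=> p0; have small : {ae P, forall w, forall (N : nat) e, 0 < e -> exists K,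
    forall n, value (cookie w) (above K.+1%:Z)
      (fun h => (above K.+1%:Z h && (entries 0 h <= N)%N)%:R) n [:: 0] <= e}.
  apply: ae_foralln => N; apply: (@ae_value_small (fun K => @above Y K.+1%:Z)
    (fun K h => above K.+1%:Z h && (entries 0 h <= N)%N)).
    by move=> K h /andP[].
  move=> e e0; set C := (kappa ^+ (width Y).+1)^-1 ^+ N.+1 * (width Y)%:R.
  have C0 : 0 < C.
    by rewrite mulr_gt0 ?ltr0n ?width_gt0// exprn_gt0// invr_gt0 exprn_gt0.
  have [K hK] := p_esc_approx iidP (divr_gt0 e0 C0).
  exists K => n; apply: le_trans (expect_few_entries iidP N n (ltn0Sn K)) _.
  rewrite mulrA -/C mulrC -ler_pdivlMr// ltW// -[X in _ < X]add0r -p0.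
  by apply: hK; rewrite subn0; lia.
apply: filterS small => w few; split => d T Q X erw.
  exact: (walk_returns erw few).
apply: filterS2 (walk_unbounded_above erw) (walk_unbounded_below erw few).
by move=> t high low; split; [exact: unbounded_limn_esup|exact: unbounded_limn_einf].
Qed.

End annealed_to_quenched.

Theorem theorem2 (R : realType) (Y : state_space) (kappa : R)
    (hk : 0 < kappa <= (2 * site_dim Y)%:R^-1)
    (P : probability (borel_env hk) R)
    (iidP : is_iid P (@omega_at Y R kappa hk)) :
  ((((width Y)%:R^-1)%:E < \int[P]_w delta 0 w)%E ->
     {ae P, forall w, transient w}) /\
  ((\int[P]_w delta 0 w <= ((width Y)%:R^-1)%:E)%E ->
     {ae P, forall w, recurrent w /\ oscillating w}).
Proof.
split=> [strong|/(mean_level_drift_le1 iidP) weak].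
  apply: (p_esc_gt0_transient iidP).
  have /existsNP[I /negP] : ~ forall I, mean_level_drift P I <= 1.
    by move/(mean_level_drift_le1 iidP); rewrite leNgt strong.
  by rewrite -ltNge; exact: p_esc_gt0.
exact/(p_esc_eq0_recurrent iidP)/(p_esc_eq0 iidP).
Qed.
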